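(* Let $\zeta=p/d$ with $p,d$ relatively prime positive integers, and let $\mathcal O$ be the BGG category of $D(2|1;\zeta)$-modules of integral weights. For each $k\in\mathbb N=\{0,1,2,\dots\}$, there is a block $\mathcal B_k$ in $\mathcal O$ which contains the simple modules $L_f$, for $f\in\mathrm{WT}_k$. Moreover, any atypical block in $\mathcal O$ is one of the $\mathcal B_k$, for $k\in\mathbb N$.
   Context: $\mathfrak g=D(2|1;\zeta)$ is the $17$-dimensional simple Lie superalgebra of basic type with Cartan matrix $\begin{pmatrix}0&1&\zeta\\-1&2&0\\-1&0&2\end{pmatrix}$, whose first simple root is odd and whose other two simple roots are even. Its Cartan subalgebra $\mathfrak h$ has basis $h_{2\delta},h_{2\epsilon_1},h_{2\epsilon_2}$ with dual basis $\delta,\epsilon_1,\epsilon_2$ of $\mathfrak h^*$. The bilinear form on $\mathfrak h^*$ makes $\delta,\epsilon_1,\epsilon_2$ orthogonal with $(\delta,\delta)=-(1+\zeta)$, $(\epsilon_1,\epsilon_1)=1$, $(\epsilon_2,\epsilon_2)=\zeta$. The simple roots are $\delta-\epsilon_1-\epsilon_2$ (odd), $2\epsilon_1$, $2\epsilon_2$; positive even roots $2\delta,2\epsilon_1,2\epsilon_2$; positive odd roots $\delta\pm\epsilon_1\pm\epsilon_2$. $\mathfrak n_+$ is the sum of positive root spaces and $\rho=-\delta+\epsilon_1+\epsilon_2$. The weight lattice is $X=\mathbb Z\delta+\mathbb Z\epsilon_1+\mathbb Z\epsilon_2$, and $(x,y,z)$ stands for $x\delta+y\epsilon_1+z\epsilon_2$.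 $\mathcal O$ is the category of finitely generated $\mathfrak h$-semisimple $\mathfrak g$-modules with weights in $X$ that are locally finite over $\mathfrak n_+$. For $\lambda\in X$, $L_\lambda$ is the irreducible module of highest weight $\lambda-\rho$ (note the $\rho$-shift). $L_\lambda$ is called atypical if $(\lambda,\alpha)=0$ for some odd root $\alpha$, and typical otherwise; typical and atypical simple modules never lie in the same block, and a block is called atypical if its simple objects are atypical. For $k\in\mathbb N$, $n\in\mathbb Z$ and signs $a,b,c\in\{+,-\}$ set $f_{k;n}^{abc}=(a|n|,\,b|n+kp|,\,c|n-kd|)$, and let $\mathrm{WT}_k=\{f_{k;n}^{abc}\mid n\in\mathbb Z,\ a,b,c\in\{+,-\}\}$ (as a set of weights; in particular $\mathrm{WT}_0=\{(\pm n,\pm n,\pm n)\mid n\ge 1\}\cup\{(0,0,0)\}$). *)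

(* Defs.v *)
From mathcomp Require Import all_boot all_order all_algebra.
From mathcomp Require Import reals complex.
From Stdlib Require Import Relation_Operators.

Set Implicit Arguments.
Unset Strict Implicit.
Unset Printing Implicit Defensive.

Import GRing.Theory.
Local Open Scope ring_scope.

(* Parities are booleans: false is even, true is odd.  All the definitions    *)
(* over a field K are meant for characteristic 0.                             *)

Record lieSuperalgebra (K : fieldType) := LieSuperalgebra {
  ls_sort :> vectType K;
  brk : ls_sort -> ls_sort -> ls_sort;
  ls_part : bool -> {vspace ls_sort};
  brk_linearr : forall x, linear (brk x);
  brk_linearl : forall y, linear (brk^~ y);
  ls_part_sum : (ls_part false + ls_part true = fullv)%VS;
  ls_part_cap : (ls_part false :&: ls_part true = 0)%VS;
  brk_part : forall a b x y, x \in ls_part a -> y \in ls_part b ->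
    brk x y \in ls_part (a (+) b);
  brk_skew : forall a b x y, x \in ls_part a -> y \in ls_part b ->
    brk x y = - ((-1) ^+ (a && b) *: brk y x);
  brk_jacobi : forall a b x y z, x \in ls_part a -> y \in ls_part b ->
    brk x (brk y z) = brk (brk x y) z + (-1) ^+ (a && b) *: brk y (brk x z)
}.

Section LieSuperalgebras.
Variables (K : fieldType) (g : lieSuperalgebra K).
Implicit Types U W : {vspace g}.

Definition graded_subspace U :=
  (U :&: ls_part g false + U :&: ls_part g true)%VS = U.

Definition ideal U :=
  graded_subspace U /\ forall x y, y \in U -> brk x y \in U.

Definition simple_superalgebra :=
  (exists x y : g, brk x y <> 0) /\
  forall U, ideal U -> U = 0%VS \/ U = fullv.

Definition even_ideal U :=
  (U <= ls_part g false)%VS /\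
  forall x y, x \in ls_part g false -> y \in U -> brk x y \in U.

(* The even part is reductive: its adjoint module is completely reducible. *)
Definition reductive_even_part :=
  forall U, even_ideal U -> exists W,
    [/\ even_ideal W, (U + W = ls_part g false)%VS & (U :&: W = 0)%VS].

(* B is a nondegenerate even invariant supersymmetric bilinear form. *)
Definition invariant_form (B : g -> g -> K) :=
  [/\ (forall x c y z, B x (c *: y + z) = c * B x y + B x z) /\
      (forall y c x z, B (c *: x + z) y = c * B x y + B z y),
      forall x y, x \in ls_part g false -> y \in ls_part g true -> B x y = 0,
      forall a b x y, x \in ls_part g a -> y \in ls_part g b ->
        B x y = (-1) ^+ (a && b) * B y x,
      forall x y z, B (brk x y) z = B x (brk y z)
    & forall x, (forall y, B x y = 0) -> x = 0].

Definition basic_superalgebra :=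
  [/\ simple_superalgebra, reductive_even_part & exists B, invariant_form B].

Definition chevalley_generators n (A : 'M[K]_n) (par : 'I_n -> bool)
    (e f h : 'I_n -> g) :=
  [/\ forall i, [/\ e i \in ls_part g (par i), f i \in ls_part g (par i)
        & h i \in ls_part g false],
      free [seq h i | i <- enum 'I_n],
      forall i j, brk (h i) (h j) = 0,
      forall i j, [/\ brk (h i) (e j) = A i j *: e j,
        brk (h i) (f j) = - (A i j *: f j)
        & brk (e i) (f j) = if i == j then h i else 0]
    & forall U, (forall x y, x \in U -> y \in U -> brk x y \in U) ->
        (forall i, [/\ e i \in U, f i \in U & h i \in U]) -> U = fullv].

End LieSuperalgebras.

Definition D21_cartan_matrix (K : fieldType) (zeta : K) : 'M[K]_3 :=
  \matrix_(i, j) nth 0 (nth [::] [:: [:: 0; 1; zeta];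
                                     [:: -1; 2; 0];
                                     [:: -1; 0; 2]] i) j.

Record D21 (K : fieldType) (zeta : K) := MkD21 {
  D21_alg :> lieSuperalgebra K;
  D21_e : 'I_3 -> D21_alg;
  D21_f : 'I_3 -> D21_alg;
  D21_h : 'I_3 -> D21_alg;
  D21_dim : \dim (fullv : {vspace D21_alg}) = 17;
  D21_basic : basic_superalgebra D21_alg;
  D21_chevalley : chevalley_generators (D21_cartan_matrix zeta)
    (fun i => i == ord0) D21_e D21_f D21_h
}.

(* (x, y, z) stands for x delta + y epsilon_1 + z epsilon_2. *)
Definition weight : Type := (int * int * int)%type.

Definition rho : weight := (-1, 1, 1).

Definition even_pos_roots : seq weight := [:: (2, 0, 0); (0, 2, 0); (0, 0, 2)].

Definition odd_pos_roots : seq weight :=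
  [:: (1, 1, 1); (1, 1, -1); (1, -1, 1); (1, -1, -1)].

Definition pos_roots := even_pos_roots ++ odd_pos_roots.

Definition odd_root (alpha : weight) :=
  (alpha \in odd_pos_roots) || (- alpha \in odd_pos_roots).

Section WeightForm.
Variables (K : fieldType) (zeta : K).

Definition weight_form (l m : weight) : K :=
  - (1 + zeta) * (l.1.1 * m.1.1)%:~R + (l.1.2 * m.1.2)%:~R
  + zeta * (l.2 * m.2)%:~R.

Definition atypical (l : weight) :=
  exists2 alpha, odd_root alpha & weight_form l alpha = 0.

End WeightForm.

Record superModule (K : fieldType) (g : lieSuperalgebra K) := SuperModule {
  sm_sort :> lmodType K;
  act : g -> sm_sort -> sm_sort;
  sm_part : bool -> sm_sort -> Prop;
  act_linearr : forall x, linear (act x);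
  act_linearl : forall v, linear (act^~ v);
  sm_part0 : forall a, sm_part a 0;
  sm_part_linear : forall a c u v,
    sm_part a u -> sm_part a v -> sm_part a (c *: u + v);
  sm_part_sum : forall v, exists v0 v1,
    [/\ sm_part false v0, sm_part true v1 & v = v0 + v1];
  sm_part_cap : forall v, sm_part false v -> sm_part true v -> v = 0;
  act_part : forall a b x v, x \in ls_part g a -> sm_part b v ->
    sm_part (a (+) b) (act x v);
  act_brk : forall a b x y v, x \in ls_part g a -> y \in ls_part g b ->
    act (brk x y) v = act x (act y v) - (-1) ^+ (a && b) *: act y (act x v)
}.

Section Modules.
Variables (K : fieldType) (g : lieSuperalgebra K).
Implicit Types L M N : superModule g.

(* Morphisms need not preserve the grading, so that a module and its parity   *)
(* shift are isomorphic.                                                      *)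
Definition intertwining M N (phi : {linear M -> N}) :=
  forall x v, phi (act x v) = act x (phi v).

Definition isomorphic M N :=
  exists2 phi : {linear M -> N}, intertwining phi & bijective phi.

Definition submodule M (U : M -> Prop) :=
  [/\ U 0, forall c u v, U u -> U v -> U (c *: u + v)
    & forall x v, U v -> U (act x v)].

Definition graded_submodule M (U : M -> Prop) :=
  submodule U /\
  forall v0 v1, sm_part false v0 -> sm_part true v1 -> U (v0 + v1) -> U v0.

Definition irreducible M :=
  (exists v : M, v <> 0) /\
  forall U : M -> Prop, graded_submodule U ->
    (forall v, U v -> v = 0) \/ (forall v, U v).

Definition finitely_generated M :=
  exists s : seq M, forall U : M -> Prop,
    submodule U -> (forall v, v \in s -> U v) -> forall v, U v.

Definition subquotient L M :=
  exists N (iota : {linear N -> M}) (pi : {linear N -> L}),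
    [/\ intertwining iota, intertwining pi, injective iota
      & forall w, exists v, pi v = w].

End Modules.

Definition sum_of (K : fieldType) (V : lmodType K) (P : V -> Prop) (v : V) :=
  exists2 s : seq V, (forall u, u \in s -> P u) & v = \sum_(u <- s) u.

Definition in_span (K : fieldType) (V : lmodType K) (s : seq V) (v : V) :=
  exists c : nat -> K, v = \sum_(i < size s) c i *: s`_i.

Section CategoryO.
Variables (K : fieldType) (zeta : K) (g : D21 zeta).
Implicit Types (L M E : superModule g) (l : weight).

(* The simple roots delta - epsilon_1 - epsilon_2, 2 epsilon_1, 2 epsilon_2   *)
(* take the values A i j on the i-th Chevalley generator of the Cartan        *)
(* subalgebra; solving for the basis dual to delta, epsilon_1, epsilon_2      *)
(* gives the following elements (zeta != -1).                                 *)
Definition h_2eps1 : g := D21_h g (inord 1).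
Definition h_2eps2 : g := D21_h g (inord 2).
Definition h_2delta : g :=
  (1 + zeta)^-1 *: (2 *: D21_h g (inord 0) - h_2eps1 - zeta *: h_2eps2).

Definition has_root (x : g) (alpha : weight) :=
  [/\ brk h_2delta x = alpha.1.1%:~R *: x,
      brk h_2eps1 x = alpha.1.2%:~R *: x
    & brk h_2eps2 x = alpha.2%:~R *: x].

Definition in_nplus : g -> Prop :=
  sum_of (fun x => exists2 alpha, alpha \in pos_roots & has_root x alpha).

Definition has_weight M (v : M) l :=
  [/\ act h_2delta v = l.1.1%:~R *: v,
      act h_2eps1 v = l.1.2%:~R *: v
    & act h_2eps2 v = l.2%:~R *: v].

Definition integral_weight_module M :=
  forall v : M, sum_of (fun u : M => exists l, has_weight u l) v.

Definition locally_finite_nplus M :=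
  forall v : M, exists2 s : seq M, in_span s v &
    forall x u, in_nplus x -> in_span s u -> in_span s (act x u).

Definition in_O M :=
  [/\ finitely_generated M, integral_weight_module M & locally_finite_nplus M].

(* M is L_l, the irreducible module of highest weight l - rho. *)
Definition is_L l M :=
  irreducible M /\
  exists v : M, [/\ v <> 0, has_weight v (l - rho)
    & forall x, in_nplus x -> act x v = 0].

Definition nonsplit_extension L M :=
  exists E (iota : {linear L -> E}) (pi : {linear E -> M}),
    [/\ in_O E, intertwining iota /\ intertwining pi,
        injective iota /\ (forall w, exists v, pi v = w),
        forall v, pi v = 0 <-> exists u, iota u = v
      & ~ exists2 sigma : {linear M -> E},
          intertwining sigma & cancel sigma pi].

Definition simple_in_O L := in_O L /\ irreducible L.

(* The equivalence relation on simple objects of O generated by isomorphism   *)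
(* and Ext^1(M, L) != 0.                                                      *)
Definition linked : superModule g -> superModule g -> Prop :=
  clos_refl_sym_trans (superModule g) (fun L M =>
    [/\ simple_in_O L, simple_in_O M
      & isomorphic L M \/ nonsplit_extension L M]).

(* A block is the full subcategory of the objects of O all of whose           *)
(* composition factors are in one linkage class of simple objects.            *)
Definition is_block (B : superModule g -> Prop) :=
  exists2 L, simple_in_O L &
    forall M, B M <-> in_O M /\
      forall S, irreducible S -> subquotient S M -> linked L S.

Definition atypical_block (B : superModule g -> Prop) :=
  forall L, B L -> irreducible L ->
    exists2 l, is_L l L & atypical zeta l.

End CategoryO.

Definition signed (a : bool) (m : int) : int := (-1) ^+ a * m.

Definition f_weight (p d k : nat) (n : int) (a b c : bool) : weight :=
  (signed a `|n|, signed b `|n + (k * p)%:Z|, signed c `|n - (k * d)%:Z|).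

Definition WT (p d k : nat) (f : weight) :=
  exists n a b c, f = f_weight p d k n a b c.

(* Main.v *)
Require Import Defs.
From HB Require Import structures.
From mathcomp Require Import all_boot all_order all_algebra.
From mathcomp Require Import ring lra zify.
From mathcomp Require Import boolp functions generic_quotient ring_quotient.
From mathcomp Require Import reals complex.
From Stdlib Require Import Relation_Operators.

(** Put alpha_0 = delta - epsilon_1 - epsilon_2, alpha_1 = 2 epsilon_1 and
    alpha_2 = 2 epsilon_2.  The block B_k is the linkage class of L_f for
    f = (0, -kp, kd).  Two facts make up the proposition: every L_f with f in
    WT_k is linked to this one ([WT_linked]), and every atypical weight lies in
    some WT_k ([atypical_WT]).

    Arithmetic.  A weight (x, y, z) is atypical when (1 + zeta) x equals
    y + zeta z for some choice of the signs of y and z.  After clearing the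
    denominator d of zeta, p divides d (y - x), hence y - x because p and d are
    coprime; so y = x + t p and z = x - t d for an integer t, up to these
    signs.  Changing the signs of all coordinates replaces t by - t, so t may
    be taken to be a natural number k.

    Linkage.  Two moves connect WT_k.  If the value m of the coroot of alpha_i
    at the rho-shifted weight f is a positive integer, i = 1 or 2, then L_f and
    L_(f - m alpha_i) are linked: this changes the sign of y or of z.  If f is
    orthogonal to alpha_0, then L_f and L_(f - alpha_0) are linked: this moves
    the weight (n, -(n + cp), -(n - cd)) to the one for n - 1.  Up to the signs
    of y and z, every element of WT_k is such a weight for c = k or for c = -k,
    and the two sequences meet, up to these signs, at n = 0.

    Why the moves preserve linkage ([linked_lowered]).  The module used is a
    coinduced one.  Let the e_i act on functions of finite support on words in
    the simple roots by (e_i phi)(w) = phi(i w), let the h_i act according to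
    the weights of words, and define the f_i by recursion so that [e_i, f_j] is
    h_i or 0.  The functions killed by every operator attached to a bracket
    expression that vanishes in g form a g-module N ([cofree]); this
    construction uses no basis of the enveloping algebra.  Every nonzero
    submodule of N contains the vacuum, the indicator of the empty word
    ([submodule_vac]), so the vacuum generates an irreducible highest weight
    module: this is where the L_f come from ([exists_L]).  The indicator u of
    the word i^m lies in N, as no relation of weight a multiple of alpha_i can
    kill it ([rel_simple_multiple]).  Under the hypotheses of the moves, u is
    not in the submodule generated by the vacuum, but every e_j u is: so the
    lowered simple module is a subquotient of the module X generated by u,
    whose socle is the simple module generated by the vacuum.

    A module of finite length with simple socle has linked composition factors.
    Let Y be a largest submodule whose factors are linked to the socle, U
    minimal among the submodules that strictly contain Y, and P minimal among
    the submodules of U that are not inside Y.  Then P meets Y in its only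
    maximal submodule, which is not 0 because it contains the socle, and
    dividing P by a maximal submodule of this intersection yields a nonsplit
    extension of U / Y by a factor of Y.  So U has the property of Y as well, a
    contradiction unless Y = X.

    X has finite length ([exists_length]).  Each positive even root gives an
    sl2 whose Casimir operator commutes with the even part of g
    ([cas_even]) and, since the odd part is a sum of doublets, moves the label
    m of an eigenvalue m^2 by 1 under one odd element
    ([cas_prod_odd]).  Odd elements anticommute up to lower terms, so all of X
    is reached from u by even elements and boundedly many odd ones
    ([filt_generated]).  Hence the weights of singular vectors in subquotients
    of X are bounded, these vectors are functions of bounded support, and the
    dimension of the bounded part is a strictly increasing function on the
    submodules.

    All of this rests on the root space decomposition of g, obtained from the
    Chevalley generators and dim g = 17: fourteen explicit brackets are nonzero
    root vectors for distinct roots, so with the Cartan subalgebra they form a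
    basis ([root_vectorsP], [gbasis_span]). *)

Set Implicit Arguments.
Unset Strict Implicit.
Unset Printing Implicit Defensive.
Import Order.TTheory GRing.Theory Num.Theory.
Local Open Scope ring_scope.

(** * Linear identities in modules *)

Section ModuleExpressions.
Variables (K : comRingType) (V : lmodType K).

Inductive mexp :=
  MAtom of nat | MZero | MAdd of mexp & mexp | MOpp of mexp | MScale of K & mexp.

Fixpoint meval (env : seq V) (t : mexp) : V :=
  match t with
  | MAtom n => nth 0 env n
  | MZero => 0
  | MAdd a b => meval env a + meval env b
  | MOpp a => - meval env a
  | MScale c a => c *: meval env a
  end.

Fixpoint mcoef (t : mexp) (i : nat) : K :=
  match t with
  | MAtom n => if Nat.eqb n i then 1 else 0
  | MZero => 0
  | MAdd a b => mcoef a i + mcoef b i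
  | MOpp a => - mcoef a i
  | MScale c a => c * mcoef a i
  end.

Lemma meval_coef env t : meval env t = \sum_(i < size env) mcoef t i *: nth 0 env i.
Proof.
elim: t => [n||a IHa b IHb|a IHa|c a IHa] /=; rewrite ?IHa ?IHb.
- have E i : Nat.eqb n i = (n == i) by apply/PeanoNat.Nat.eqb_spec/eqP.
  have [nenv|nenv] := ltnP n (size env); last first.
    rewrite nth_default // big1 // => i _; rewrite E.
    case: eqP => [ni|_]; last by rewrite scale0r.
    by rewrite ni leqNgt ltn_ord in nenv.
  rewrite (bigD1 (Ordinal nenv)) //= E eqxx scale1r big1 ?addr0 // => i.
  by rewrite E -val_eqE /= eq_sym => /negbTE ->; rewrite scale0r.
- by rewrite big1 // => i _; rewrite scale0r.
- by rewrite -big_split; apply: eq_bigr => i _; rewrite scalerDl.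
- by rewrite -sumrN; apply: eq_bigr => i _; rewrite scaleNr.
- by rewrite scaler_sumr; apply: eq_bigr => i _; rewrite scalerA.
Qed.

Fixpoint forall_below (n : nat) (P : nat -> Prop) : Prop :=
  if n is n'.+1 then P n' /\ forall_below n' P else True.

Lemma meval_eq env t1 t2 : forall_below (size env) (fun i => mcoef t1 i = mcoef t2 i) ->
  meval env t1 = meval env t2.
Proof.
move=> H; rewrite !meval_coef; apply: eq_bigr => -[i ilt] _ /=; congr (_ *: _).
elim: (size env) ilt H => // n IH; rewrite ltnS leq_eqVlt => /orP[/eqP ->|iltn] [H1 H2] //.
exact: IH.
Qed.

End ModuleExpressions.

Ltac mod_find x l :=
  lazymatch l with
  | ?y :: ?l' =>
    match l with
    | _ => let _ := match l with _ => unify x y end in constr:(Some O)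
    | _ => let r := mod_find x l' in
           lazymatch r with Some ?n => constr:(Some (S n)) | None => constr:(@None nat) end
    end
  | _ => constr:(@None nat)
  end.

Ltac mod_atoms t l :=
  lazymatch t with
  | (?a + ?b)%R => let l := mod_atoms a l in mod_atoms b l
  | (- ?a)%R => mod_atoms a l
  | (?c *: ?a)%R => mod_atoms a l
  | 0%R => l
  | _ => let r := mod_find t l in
         lazymatch r with Some _ => l | None => constr:(t :: l) end
  end.

Ltac mod_quote K t l :=
  lazymatch t with
  | (?a + ?b)%R => let a := mod_quote K a l in let b := mod_quote K b l in
                   constr:(@MAdd K a b)
  | (- ?a)%R => let a := mod_quote K a l in constr:(@MOpp K a)
  | (?c *: ?a)%R => let a := mod_quote K a l in constr:(@MScale K c a)
  | 0%R => constr:(@MZero K)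
  | _ => let r := mod_find t l in
         lazymatch r with Some ?n => constr:(@MAtom K n) end
  end.

(** Decides an equation between linear combinations of arbitrary vectors by
    comparing the coefficient of each vector with ring. *)
Ltac module_over K :=
  lazymatch goal with
  | |- @eq ?T ?a ?b =>
    let l := mod_atoms a (@nil T) in
    let l := mod_atoms b l in
    let ea := mod_quote K a l in
    let eb := mod_quote K b l in
    apply: (@meval_eq K _ l ea eb);
    cbn [forall_below size mcoef Nat.eqb];
    repeat split; try ring
  end.

(** * Subspaces and weight components *)

Section Subspaces.
Variables (K : fieldType) (V : lmodType K).

Definition subspace (U : V -> Prop) :=
  U 0 /\ forall c u v, U u -> U v -> U (c *: u + v).

Inductive lspan (S : V -> Prop) : V -> Prop :=
| lspan0 : lspan S 0
| lspanZD c u v : S u -> lspan S v -> lspan S (c *: u + v).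

Lemma subspaceZ U c u : subspace U -> U u -> U (c *: u).
Proof. by case=> U0 US Uu; rewrite -[_ *: _]addr0; apply: US. Qed.

Lemma subspaceD U u v : subspace U -> U u -> U v -> U (u + v).
Proof. by case=> U0 US Uu Uv; rewrite -[u]scale1r; apply: US. Qed.

Lemma subspaceN U u : subspace U -> U u -> U (- u).
Proof. by move=> UP Uu; rewrite -scaleN1r; apply: subspaceZ. Qed.

Lemma subspaceB U u v : subspace U -> U u -> U v -> U (u - v).
Proof. by move=> UP Uu Uv; apply: subspaceD => //; apply: subspaceN. Qed.

Lemma subspace_sum U I (r : seq I) (P : pred I) (F : I -> V) :
  subspace U -> (forall i, P i -> U (F i)) -> U (\sum_(i <- r | P i) F i).
Proof.
move=> UP FU; apply: big_ind => //; first by case: UP.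
by move=> x y; apply: subspaceD.
Qed.

Lemma subspace_sum_seq U (I : eqType) (r : seq I) (F : I -> V) :
  subspace U -> (forall i, i \in r -> U (F i)) -> U (\sum_(i <- r) F i).
Proof.
move=> UP FU; rewrite big_seq; exact: subspace_sum.
Qed.

Lemma subspaceI U W : subspace U -> subspace W ->
  subspace (fun x => U x /\ W x).
Proof.
move=> [U0 US] [W0 WS]; split=> // c u v [Uu Wu] [Uv Wv].
by split; [apply: US | apply: WS].
Qed.

Lemma lspan_min S U x : subspace U -> (forall u, S u -> U u) ->
  lspan S x -> U x.
Proof. by move=> [U0 US] SU; elim=> // c u v Su _ Uv; apply: US; auto. Qed.

Lemma lspan_subspace S : subspace (lspan S).
Proof.
split=> [|c u v Su Sv]; first exact: lspan0.
elim: Su => [|a x y Sx _ IH]; first by rewrite scaler0 add0r.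
by rewrite scalerDr scalerA -addrA; apply: lspanZD.
Qed.

Lemma lspan_gen (S : V -> Prop) x : S x -> lspan S x.
Proof. by move=> Sx; rewrite -[x]scale1r -[_ *: _]addr0; apply: lspanZD => //; apply: lspan0. Qed.

Lemma lspan_mono S S' x : (forall u, S u -> lspan S' u) ->
  lspan S x -> lspan S' x.
Proof. by move=> SS'; apply: lspan_min => //; apply: lspan_subspace. Qed.

End Subspaces.
#[global] Hint Resolve lspan_subspace : core.

Section LinearFacts.
Variables (K : fieldType) (V W : lmodType K) (f : V -> W).
Hypothesis lf : linear f.
Lemma lin0 : f 0 = 0.
Proof. by have := lf (-1) 0 0; rewrite scaler0 addr0 scaleN1r addNr. Qed.
Lemma linD x y : f (x + y) = f x + f y.
Proof. by rewrite -[x]scale1r lf !scale1r. Qed.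
Lemma linZ c x : f (c *: x) = c *: f x.
Proof. by rewrite -[c *: x]addr0 lf lin0 addr0. Qed.
Lemma linN x : f (- x) = - f x.
Proof. by rewrite -scaleN1r linZ scaleN1r. Qed.
Lemma linB x y : f (x - y) = f x - f y.
Proof. by rewrite linD linN. Qed.
Lemma lin_sum I (r : seq I) (P : pred I) (F : I -> V) :
  f (\sum_(i <- r | P i) F i) = \sum_(i <- r | P i) f (F i).
Proof. by apply: (big_morph f linD lin0). Qed.

Lemma lspan_linear (S : V -> Prop) (U : W -> Prop) v : subspace U ->
  (forall u, S u -> U (f u)) -> lspan S v -> U (f v).
Proof.
move=> [U0 UL] H; apply: (@lspan_min _ _ _ (fun v => U (f v))) => //.
by split=> [|c a b Ua Ub]; rewrite ?lin0 // lf; apply: UL.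
Qed.
End LinearFacts.

Section WeightVectors.
Variables (K : numFieldType) (V : lmodType K) (T1 T2 T3 : V -> V).
Hypotheses (l1 : linear T1) (l2 : linear T2) (l3 : linear T3).

Definition wtv (x : V) (l : weight) :=
  [/\ T1 x = l.1.1%:~R *: x, T2 x = l.1.2%:~R *: x & T3 x = l.2%:~R *: x].

Lemma wtv_subspace l : subspace (wtv^~ l).
Proof.
split=> [|c u v [a1 a2 a3] [b1 b2 b3]].
  by split; rewrite lin0 ?scaler0.
by split; rewrite ?l1 ?l2 ?l3 ?a1 ?a2 ?a3 ?b1 ?b2 ?b3 scalerDr !scalerA [c * _]mulrC.
Qed.

Lemma wt_neqP (l l' : weight) : l != l' ->
  [\/ (l.1.1%:~R : K) != l'.1.1%:~R, (l.1.2%:~R : K) != l'.1.2%:~R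
    | (l.2%:~R : K) != l'.2%:~R].
Proof.
case: l l' => [[a b] c] [[a' b'] c'] /=; rewrite !eqr_int !xpair_eqE !negb_and.
by case/orP=> [/orP[]|] ?; [constructor 1|constructor 2|constructor 3]; rewrite ?eqr_int.
Qed.

Lemma wtv_uniq x l l' : wtv x l -> wtv x l' -> x <> 0 -> l = l'.
Proof.
move=> [a1 a2 a3] [b1 b2 b3] x0; apply/eqP/negPn/negP => /wt_neqP.
have aux (a b : K) : a *: x = b *: x -> a = b.
  move/eqP; rewrite -subr_eq0 -scalerBl scaler_eq0 subr_eq0.
  by case/orP=> /eqP // /x0.
by case=> /eqP; apply; apply: aux; rewrite -?a1 -?b1 -?a2 -?b2 -?a3 -?b3.
Qed.

(** Vandermonde argument by induction on the list: subtracting a multiple of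
    the sum from its image under one of the operators removes one component
    and multiplies each other one by a difference of eigenvalues, which is
    nonzero for at least one of the three operators. *)
Lemma weight_components (U : V -> Prop) (s : seq weight) (u : weight -> V) :
  subspace U -> (forall x, U x -> [/\ U (T1 x), U (T2 x) & U (T3 x)]) ->
  uniq s -> (forall l, l \in s -> wtv (u l) l) ->
  U (\sum_(l <- s) u l) -> forall l, l \in s -> U (u l).
Proof.
move=> Usub UT; elim: s u => [//|l0 s IH] u /= /andP[l0s us] wu Us.
have key (T : V -> V) (cf : weight -> K) : linear T ->
    (forall x, U x -> U (T x)) ->
    (forall l, l \in l0 :: s -> T (u l) = cf l *: u l) ->
    forall l, l \in s -> U ((cf l - cf l0) *: u l).
  move=> lT TU Tu l ls; apply: (IH (fun l => (cf l - cf l0) *: u l)) => //.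
    by move=> l' l's; apply: (subspaceZ _ (wtv_subspace _)); apply: wu; rewrite inE l's orbT.
  have := subspaceB Usub (TU _ Us) (subspaceZ (cf l0) Usub Us).
  rewrite (lin_sum lT) scaler_sumr -sumrB big_cons Tu ?mem_head // subrr add0r.
  rewrite big_seq_cond (eq_bigr (fun l => (cf l - cf l0) *: u l)).
    by rewrite -big_seq_cond.
  by move=> l' /andP[l's _]; rewrite Tu ?inE ?l's ?orbT // scalerBl.
have Ul l : l \in s -> U (u l).
  move=> ls.
  have nel : l != l0 by apply: contraNneq l0s => <-.
  have fin (c : K) : c != 0 -> U (c *: u l) -> U (u l).
    by move=> c0 /(subspaceZ c^-1 Usub); rewrite scalerA mulVf // scale1r.
  have [] := wt_neqP nel; rewrite -subr_eq0 => /fin; apply.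
  - apply: (key T1 (fun l => l.1.1%:~R)) => // [x /UT[] //|l' /wu[] //].
  - apply: (key T2 (fun l => l.1.2%:~R)) => // [x /UT[] //|l' /wu[] //].
  - apply: (key T3 (fun l => l.2%:~R)) => // [x /UT[] //|l' /wu[] //].
move=> l; rewrite inE => /orP[/eqP->|]; last exact: Ul.
have := subspaceB Usub Us (subspace_sum_seq Usub Ul).
by rewrite big_cons addrK.
Qed.

Definition comps (x : V) (s : seq weight) (u : weight -> V) :=
  [/\ uniq s, x = \sum_(l <- s) u l & forall l, l \in s -> wtv (u l) l].

Lemma lspan_decomp (S : V -> Prop) x :
  (forall u, S u -> exists l, wtv u l) -> lspan S x ->
  exists s u, comps x s u /\
    forall l, l \in s -> lspan (fun y => S y /\ wtv y l) (u l).
Proof.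
move=> wS; elim=> [|c y z Sy _ [s [u [[us zE wu] Su]]]].
  by exists [::], (fun=> 0); split=> //; split; rewrite ?big_nil.
have [l0 wy] := wS _ Sy.
exists (if l0 \in s then s else l0 :: s), (fun l => if l == l0 then
  (if l0 \in s then c *: y + u l0 else c *: y) else u l).
have ly : lspan (fun z => S z /\ wtv z l0) y by apply: lspan_gen.
case: ifP => l0s; last first.
  split; last first.
    move=> l; rewrite inE; case: eqP => [-> _|_ /=]; last exact: Su.
    exact: subspaceZ.
  split=> /=.
  - by rewrite l0s.
  - rewrite big_cons eqxx zE; congr (_ + _); apply: eq_big_seq => l ls.
    by case: eqP => // le; rewrite -le ls in l0s.
  - move=> l; rewrite inE; case: eqP => [-> _|_ /=]; last exact: wu.
    by apply: (subspaceZ _ (wtv_subspace _)).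
split; last first.
  move=> l ls; case: eqP => [->|_ /=]; last exact: Su.
  by apply: subspaceD => //; [exact: subspaceZ|apply: Su].
split=> //.
- rewrite zE !(big_rem _ l0s) /= eqxx -addrA; congr (_ + (_ + _)).
  apply: eq_big_seq => l; rewrite mem_rem_uniq // inE.
  by case: eqP.
- move=> l ls; case: eqP => [->|_ /=]; last exact: wu.
  apply: (subspaceD (wtv_subspace _)); last exact: wu.
  by apply: (subspaceZ _ (wtv_subspace _)).
Qed.

Lemma comps_mem x s u l : comps x s u -> wtv x l -> l \in s ->
  x = u l.
Proof.
move=> [us xE wu] wx ls.
have := @weight_components (fun x => x = 0) s
   (fun l' => u l' - (if l' == l then x else 0)).
move=> H; suff: u l - (if l == l then x else 0) = 0.
  by rewrite eqxx => /subr0_eq.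
apply: H => //.
- by split=> // c a b -> ->; rewrite scaler0 addr0.
- by move=> _ ->; rewrite !lin0.
- move=> l' l's; apply: (subspaceB (wtv_subspace _)); first exact: wu.
  by case: eqP => [->//|_]; case: (wtv_subspace l').
- by rewrite sumrB -xE (big_rem _ ls) /= eqxx big1_seq ?addr0 ?subrr // => l' /andP[_];
    rewrite mem_rem_uniq // inE; case: eqP.
Qed.

Lemma comps_notin x s u l : comps x s u -> wtv x l -> l \notin s ->
  x = 0.
Proof.
move=> [us xE wu] wx ls.
have cx : comps x (l :: s) (fun l' => if l' == l then 0 else u l').
  split; rewrite /= ?ls //.
    rewrite big_cons eqxx add0r xE; apply: eq_big_seq => l' l's.
    by case: eqP l's ls => // -> ->.
  move=> l'; rewrite inE; case: eqP => [_ _|_]; last exact: wu.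
  by case: (wtv_subspace l').
by rewrite (comps_mem cx wx) ?mem_head // eqxx.
Qed.

(** In a span of weight vectors, a vector of weight l needs only the
    generators of weight l, because weight components are unique. *)
Lemma lspan_proj (S : V -> Prop) x l :
  (forall u, S u -> exists l, wtv u l) -> lspan S x -> wtv x l ->
  lspan (fun y => S y /\ wtv y l) x.
Proof.
move=> wS Sx wx; have [s [u [cx Su]]] := lspan_decomp wS Sx.
have [ls|ls] := boolP (l \in s).
  by rewrite (comps_mem cx wx ls); apply: Su.
by rewrite (comps_notin cx wx ls); apply: lspan0.
Qed.

End WeightVectors.

(** * The simple roots and their root vectors *)

Section Bracket.
Variables (K : fieldType) (g : lieSuperalgebra K).
Implicit Types x y z : g.

Lemma brk0r x : brk x 0 = 0. Proof. exact: (lin0 (brk_linearr x)). Qed.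
Lemma brkDr x y z : brk x (y + z) = brk x y + brk x z.
Proof. exact: (linD (brk_linearr x)). Qed.
Lemma brkNr x y : brk x (- y) = - brk x y.
Proof. exact: (linN (brk_linearr x)). Qed.
Lemma brkZr c x y : brk x (c *: y) = c *: brk x y.
Proof. exact: (linZ (brk_linearr x)). Qed.
Lemma brk0l x : brk 0 x = 0. Proof. exact: (lin0 (brk_linearl x)). Qed.
Lemma brkDl x y z : brk (y + z) x = brk y x + brk z x.
Proof. exact: (linD (brk_linearl x)). Qed.
Lemma brkNl x y : brk (- y) x = - brk y x.
Proof. exact: (linN (brk_linearl x)). Qed.
Lemma brkZl c x y : brk (c *: y) x = c *: brk y x.
Proof. exact: (linZ (brk_linearl x)). Qed.

Lemma part_split x : exists x0 x1,
  [/\ x0 \in ls_part g false, x1 \in ls_part g true & x = x0 + x1].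
Proof.
have : x \in fullv by rewrite memvf.
rewrite -ls_part_sum => /memv_addP[x0 px0 [x1 px1 ->]].
by exists x0, x1.
Qed.

Lemma part_cap x : x \in ls_part g false -> x \in ls_part g true -> x = 0.
Proof.
move=> x0 x1; have : x \in (ls_part g false :&: ls_part g true)%VS.
  by rewrite memv_cap x0 x1.
by rewrite ls_part_cap memv0 => /eqP.
Qed.

Lemma jacE a b x y z : x \in ls_part g a -> y \in ls_part g b -> ~~ (a && b) ->
  brk x (brk y z) = brk (brk x y) z + brk y (brk x z).
Proof.
by move=> xa yb /negbTE ab; rewrite (brk_jacobi _ xa yb) ab scale1r.
Qed.

Lemma jacO x y z : x \in ls_part g true -> y \in ls_part g true ->
  brk x (brk y z) = brk (brk x y) z - brk y (brk x z).
Proof. by move=> xa yb; rewrite (brk_jacobi _ xa yb) /= expr1 scaleN1r. Qed.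

Lemma jac0 h x y : h \in ls_part g false ->
  brk h (brk x y) = brk (brk h x) y + brk x (brk h y).
Proof.
move=> h0; have [x0 [x1 [p0 p1 ->]]] := part_split x.
by rewrite !(brkDl, brkDr) (jacE _ h0 p0) // (jacE _ h0 p1) // addrACA.
Qed.

Lemma skewE a b x y : x \in ls_part g a -> y \in ls_part g b -> ~~ (a && b) ->
  brk x y = - brk y x.
Proof. by move=> xa yb /negbTE ab; rewrite (brk_skew xa yb) ab scale1r. Qed.

End Bracket.

Lemma mem_span_lspan (F : fieldType) (vT : vectType F) (X : seq vT) x : x \in <<X>>%VS -> lspan (fun y => y \in X) x.
Proof.
move=> xX; rewrite (coord_span (X := in_tuple X) xX).
apply: (subspace_sum _ (lspan_subspace _)) => i _.
by apply: subspaceZ => //; apply: lspan_gen; apply: mem_nth.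
Qed.

Definition i1 : 'I_3 := inord 1.
Definition i2 : 'I_3 := inord 2.
Definition simple_root (i : 'I_3) : weight :=
  nth 0 [:: (1, -1, -1); (0, 2, 0); (0, 0, 2)] i.

Lemma val_i1 : (i1 : nat) = 1%N. Proof. by rewrite /= inordK. Qed.
Lemma val_i2 : (i2 : nat) = 2%N. Proof. by rewrite /= inordK. Qed.
Lemma I3_cases (i : 'I_3) : [\/ i = ord0, i = i1 | i = i2].
Proof.
case: i => [[|[|[|n]]] Hi] //.
- by constructor 1; apply: val_inj.
- by constructor 2; apply: val_inj; rewrite /= inordK.
- by constructor 3; apply: val_inj; rewrite /= inordK.
Qed.
Lemma neq10 : (i1 == ord0) = false. Proof. by rewrite -(inj_eq val_inj) /= !inordK. Qed.
Lemma neq20 : (i2 == ord0) = false. Proof. by rewrite -(inj_eq val_inj) /= !inordK. Qed.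
Lemma neq01 : (ord0 == i1) = false. Proof. by rewrite -(inj_eq val_inj) /= !inordK. Qed.
Lemma neq02 : (ord0 == i2) = false. Proof. by rewrite -(inj_eq val_inj) /= !inordK. Qed.
Lemma neq12 : (i1 == i2) = false. Proof. by rewrite -(inj_eq val_inj) /= !inordK. Qed.
Lemma neq21 : (i2 == i1) = false. Proof. by rewrite -(inj_eq val_inj) /= !inordK. Qed.
Definition I3E := (neq10, neq20, neq01, neq02, neq12, neq21).

Section RootSystem.
Variables (K : numFieldType) (zeta : K) (g : D21 zeta).
Hypothesis zeta1 : 1 + zeta != 0.
Local Notation e := (@D21_e K zeta g).
Local Notation f := (@D21_f K zeta g).
Local Notation h := (@D21_h K zeta g).
Local Notation A := (D21_cartan_matrix zeta).
Local Notation part := (ls_part g).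
Local Notation hd := (h_2delta g).

Lemma cartanE i j : A i j = nth 0 (nth [::] [:: [:: 0; 1; zeta];
                                     [:: -1; 2; 0]; [:: -1; 0; 2]] i) j.
Proof. by rewrite mxE. Qed.

Lemma e_part i : e i \in part (i == ord0).
Proof. by have [H _ _ _ _] := D21_chevalley g; have [] := H i. Qed.
Lemma f_part i : f i \in part (i == ord0).
Proof. by have [H _ _ _ _] := D21_chevalley g; have [] := H i. Qed.
Lemma h_part i : h i \in part false.
Proof. by have [H _ _ _ _] := D21_chevalley g; have [] := H i. Qed.
Lemma h_h i j : brk (h i) (h j) = 0.
Proof. by have [_ _ H _ _] := D21_chevalley g. Qed.
Lemma h_e i j : brk (h i) (e j) = A i j *: e j.
Proof. by have [_ _ _ H _] := D21_chevalley g; have [] := H i j. Qed.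
Lemma h_f i j : brk (h i) (f j) = - (A i j *: f j).
Proof. by have [_ _ _ H _] := D21_chevalley g; have [] := H i j. Qed.
Lemma e_f i j : brk (e i) (f j) = if i == j then h i else 0.
Proof. by have [_ _ _ H _] := D21_chevalley g; have [] := H i j. Qed.
Lemma h_free : free [seq h i | i <- enum 'I_3].
Proof. by have [_ H _ _ _] := D21_chevalley g. Qed.

Lemma hd_part : hd \in part false.
Proof.
rewrite /h_2delta /h_2eps1 /h_2eps2.
by rewrite memvZ ?memvB ?memvZ ?h_part.
Qed.

(** The simple roots evaluated on the basis h_(2 delta), h_(2 epsilon_1),
    h_(2 epsilon_2) of the Cartan subalgebra. *)
Lemma rootE (i : 'I_3) : [/\
  (1 + zeta)^-1 * (2 * A ord0 i - A i1 i - zeta * A i2 i) = (simple_root i).1.1%:~R,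
  A i1 i = (simple_root i).1.2%:~R & A i2 i = (simple_root i).2%:~R].
Proof.
have [->|->|->] := I3_cases i; rewrite !cartanE /simple_root ?val_i1 ?val_i2 /=;
  by split=> //; field.
Qed.

Lemma inord0 : inord 0 = ord0 :> 'I_3.
Proof. by apply: val_inj; rewrite /= inordK. Qed.

Lemma hd_e i : brk hd (e i) = (simple_root i).1.1%:~R *: e i.
Proof.
have [<- _ _] := rootE i.
rewrite /h_2delta /h_2eps1 /h_2eps2 inord0 -/i1 -/i2.
rewrite !(brkZl, brkDl, brkNl) !h_e -!scaleNr !scalerA -!scalerDl scalerA.
by congr (_ *: _); ring.
Qed.

Lemma hd_f i : brk hd (f i) = - ((simple_root i).1.1%:~R *: f i).
Proof.
have [<- _ _] := rootE i.
rewrite /h_2delta /h_2eps1 /h_2eps2 inord0 -/i1 -/i2.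
rewrite !(brkZl, brkDl, brkNl) !h_f -?scaleNr !scalerA -?scaleNr ?scalerA -!scalerDl ?scalerA.
by congr (_ *: _); ring.
Qed.

Lemma hd_h i : brk hd (h i) = 0.
Proof.
rewrite /h_2delta /h_2eps1 /h_2eps2.
by rewrite !(brkZl, brkDl, brkNl) !h_h !(scaler0, addr0, oppr0).
Qed.

Lemma h0E : h ord0 = 2^-1 *: ((1 + zeta) *: hd + h i1 + zeta *: h i2).
Proof.
rewrite /h_2delta /h_2eps1 /h_2eps2 inord0 -/i1 -/i2.
rewrite scalerA divff // scale1r -[_ + h i1 + _]addrA [h i1 + _]addrC addrA.
rewrite subrK subrK scalerA mulVf ?scale1r //.
by rewrite pnatr_eq0.
Qed.

Lemma has_root_subspace l : subspace (fun x : g => has_root x l).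
Proof. by apply: wtv_subspace; apply: brk_linearr. Qed.

Lemma has_root_e i : has_root (e i) (simple_root i).
Proof.
have [_ E1 E2] := rootE i; split; first exact: hd_e.
  by rewrite /h_2eps1 h_e -/i1 E1.
by rewrite /h_2eps2 h_e -/i2 E2.
Qed.

Lemma has_root_f i : has_root (f i) (- simple_root i).
Proof.
have [_ E1 E2] := rootE i; split; rewrite /= mulrNz scaleNr.
- exact: hd_f.
- by rewrite /h_2eps1 h_f -/i1 E1.
- by rewrite /h_2eps2 h_f -/i2 E2.
Qed.

Lemma has_root_h i : has_root (h i) 0.
Proof. by split; rewrite /= ?mulr0z ?scale0r ?hd_h // ?h_h. Qed.

Lemma has_root_brk (x y : g) a b : has_root x a -> has_root y b ->
  has_root (brk x y) (a + b).
Proof.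
move=> [x1 x2 x3] [y1 y2 y3]; split => /=; rewrite mulrzDr scalerDl.
- by rewrite (jac0 _ _ hd_part) x1 y1 brkZl brkZr.
- by rewrite (jac0 _ _ (h_part _)) x2 y2 brkZl brkZr.
- by rewrite (jac0 _ _ (h_part _)) x3 y3 brkZl brkZr.
Qed.

Lemma has_root_uniq (x : g) l l' : has_root x l -> has_root x l' -> x <> 0 -> l = l'.
Proof. exact: wtv_uniq. Qed.

(** What makes a list of root vectors free together with a basis of the Cartan
    subalgebra. *)
Definition root_list (s : seq (weight * g)) :=
  [/\ uniq (0 :: [seq p.1 | p <- s]),
      forall p, p \in s -> has_root p.2 p.1 & forall p, p \in s -> p.2 != 0].

Definition cartan_basis : seq g := [:: h ord0; h i1; h i2].

Lemma cartan_free : free cartan_basis.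
Proof.
have := h_free; rewrite (_ : [seq h i | i <- enum 'I_3] = cartan_basis) //.
rewrite /cartan_basis enum_ordSl enum_ordSl enum_ordSl /=.
rewrite (_ : enum 'I_0 = [::]) /=; last by apply/size0nil; rewrite size_enum_ord.
by congr [:: _; h _; h _]; apply: val_inj; rewrite /= !inordK.
Qed.

Lemma root_list_free s : root_list s -> free ([seq p.2 | p <- s] ++ cartan_basis).
Proof.
elim: s => [_|[l x] s IH [] /=]; first exact: cartan_free.
rewrite inE negb_or => /andP[/andP[l0 s0] /andP[ls us]] wt n0.
rewrite free_cons IH; last first.
  split; rewrite /= ?s0 // => p ps; [apply: wt|apply: n0]; by rewrite inE ps orbT.
rewrite andbT; apply/negP => /mem_span_lspan xX.
have /= wx := wt _ (mem_head _ _).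
have nx : x != 0 := n0 _ (mem_head _ _).
have wX (u : g) : u \in [seq p.2 | p <- s] ++ cartan_basis ->
    exists2 l', has_root u l' & l' != l.
  rewrite mem_cat => /orP[/mapP[p ps ->]|].
    exists p.1; first by apply: wt; rewrite inE ps orbT.
    by apply: contraNneq ls => <-; apply: map_f.
  rewrite !inE => /or3P[] /eqP->; exists 0 => //; exact: has_root_h.
have := lspan_proj (brk_linearr _) (brk_linearr _) (brk_linearr _) (l := l) _ xX wx.
case/(_ _)/Wrap => [u /wX[l' ? _]|]; first by exists l'.
move=> /(@lspan_min _ _ _ (fun x => x = 0)) x0; move/eqP: nx; apply; apply: x0.
  by split=> // c u v -> ->; rewrite scaler0 addr0.
move=> u [/wX[l' wu' nl] wu]; apply: contrapT => u0.
by move/eqP: nl; apply; apply: has_root_uniq u0.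
Qed.

Lemma root_list_size s : root_list s -> (size s <= 14)%N.
Proof.
move=> /root_list_free /eqP; rewrite size_cat size_map => dimE.
have := dimvS (subvf <<[seq p.2 | p <- s] ++ cartan_basis>>).
by rewrite dimE D21_dim /= addn3 -[17%N]/(14.+3).
Qed.

End RootSystem.

(** * The fourteen nonzero roots *)

Section PositiveSide.
Variables (K : numFieldType) (zeta : K) (g : D21 zeta).
Hypothesis zeta1 : 1 + zeta != 0.
Local Notation part := (ls_part g).
Variables (x y : 'I_3 -> g) (r : 'I_3 -> weight) (c1 c2 : K).
Local Notation k i := (brk (y i) (x i)).
Hypotheses (x_part : forall i, x i \in part (i == ord0))
  (y_part : forall i, y i \in part (i == ord0))
  (yx : forall i j, i != j -> brk (y i) (x j) = 0)
  (x_neq0 : forall i, x i != 0)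
  (x_root : forall i, has_root (x i) (r i))
  (rE : r =1 simple_root \/ r =1 (fun i => - simple_root i))
  (k00 : brk (k ord0) (x ord0) = 0)
  (k01 : brk (k ord0) (x i1) = c1 *: x i1)
  (k02 : brk (k ord0) (x i2) = c2 *: x i2)
  (c12 : c1 + c2 != 0)
  (k10 : brk (k i1) (x ord0) = x ord0)
  (k11 : brk (k i1) (x i1) = - 2 *: x i1)
  (k12 : brk (k i1) (x i2) = 0)
  (k20 : brk (k i2) (x ord0) = x ord0)
  (k21 : brk (k i2) (x i1) = 0).

Lemma k_part i : k i \in part false.
Proof. by have := brk_part (y_part i) (x_part i); rewrite addbb. Qed.

Let x0p : x ord0 \in part true. Proof. exact: x_part. Qed.
Let y0p : y ord0 \in part true. Proof. exact: y_part. Qed.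
Let x1p : x i1 \in part false. Proof. by have := x_part i1; rewrite neq10. Qed.
Let y1p : y i1 \in part false. Proof. by have := y_part i1; rewrite neq10. Qed.
Let x2p : x i2 \in part false. Proof. by have := x_part i2; rewrite neq20. Qed.
Let y2p : y i2 \in part false. Proof. by have := y_part i2; rewrite neq20. Qed.

Let x12 := brk (x i1) (x i2).
Let chain n := iter n (brk (x i1)) x12.

Let chainS n : chain n.+1 = brk (x i1) (chain n). Proof. by []. Qed.

Let chain_root n : has_root (chain n) (r i2 + r i1 *+ n.+1).
Proof.
elim: n => [|n IH]; first by rewrite mulr1n addrC; exact: has_root_brk.
by rewrite mulrS addrCA; apply: has_root_brk.
Qed.

Let chain_k n : brk (k i1) (chain n) = - (2 * n.+1%:R) *: chain n.
Proof.
elim: n => [|n IH].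
  by rewrite /= (jac0 _ _ (k_part _)) k11 k12 brk0r addr0 brkZl mulr1.
rewrite chainS (jac0 _ _ (k_part _)) k11 IH brkZl brkZr -scalerDl.
by congr (_ *: _); rewrite -[n.+2%:R]natr1; ring.
Qed.

Let chain_y n : brk (y i1) (chain n.+1) = - (n.+1%:R * n.+2%:R) *: chain n.
Proof.
elim: n => [|n IH].
  have /= E := chain_k 0; rewrite /= (jac0 _ _ y1p) E (jac0 _ _ y1p) k12.
  rewrite yx ?neq12 // brk0r addr0 brk0r addr0.
  by congr (_ *: _); ring.
rewrite (chainS n.+1) (jac0 _ _ y1p) chain_k IH brkZr -chainS -scalerDl; congr (_ *: _).
by rewrite -[n.+3%:R]natr1 -[n.+2%:R]natr1; ring.
Qed.

Let chain_neq0 n : x12 != 0 -> chain n != 0.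
Proof.
move=> n0; elim: n => // n IH; apply/eqP => E; have := chain_y n.
rewrite E brk0r => /esym/eqP; rewrite scaler_eq0 (negbTE IH) orbF oppr_eq0 mulf_eq0.
by rewrite !pnatr_eq0.
Qed.

Lemma simple_root1 : simple_root i1 = (0, 2, 0).
Proof. by rewrite /simple_root val_i1. Qed.
Lemma simple_root2 : simple_root i2 = (0, 0, 2).
Proof. by rewrite /simple_root val_i2. Qed.
Let chain_weights n : uniq (0 :: [seq r i2 + r i1 *+ m.+1 | m <- iota 0 n]).
Proof.
have inj : injective (fun m => r i2 + r i1 *+ m.+1).
  move=> m m' /addrI H.
  have {}H : simple_root i1 *+ m.+1 = simple_root i1 *+ m'.+1.
    by case: rE H => E; rewrite E // !mulNrn => /oppr_inj.
  have := congr1 (fun l : weight => l.1.2) H.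
  rewrite simple_root1; have E (u : weight) q : (u *+ q).1.2 = u.1.2 *+ q :> int.
    by elim: q => // q IH; rewrite !mulrS -IH.
  by rewrite !E /=; lia.
rewrite cons_uniq map_inj_uniq // iota_uniq andbT.
apply/mapP => -[m _ H]; have := congr1 (fun l : weight => l.2) H => {H}.
have E (u v : weight) q : (u + v *+ q).2 = u.2 + v.2 *+ q :> int.
  by elim: q => [|q IH]; rewrite ?mulr0n ?addr0 // !mulrS [v + _]addrC addrA [v.2 + _]addrC addrA -IH.
rewrite E; case: rE => E'; rewrite !E' simple_root1 simple_root2 /=.
  by rewrite mul0rn.
by rewrite oppr0 mul0rn.
Qed.

(** The two even simple generators commute.  If [x1, x2] were nonzero, then,
    by the sl2-type computation with y1 above, all ad(x1)^n [x1, x2] would be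
    nonzero root vectors for distinct roots, too many for dimension 17. *)
Lemma brk12_eq0 : brk (x i1) (x i2) = 0.
Proof.
apply/eqP/negPn/negP => n0.
have := @root_list_size _ _ g [seq (r i2 + r i1 *+ m.+1, chain m) | m <- iota 0 15].
rewrite size_map size_iota => /(_ _)/Wrap[] //; split.
- by rewrite -map_comp; apply: (chain_weights 15).
- by move=> _ /mapP[m _ ->]; apply: chain_root.
- by move=> _ /mapP[m _ ->]; apply: chain_neq0.
Qed.

(** The root vectors on one side of the Cartan subalgebra, for e or f in the
    role of x. *)
Definition side : seq (weight * g) :=
  [:: (r ord0, x ord0); (r i1, x i1); (r i2, x i2);
      (r i1 + r ord0, brk (x i1) (x ord0)); (r i2 + r ord0, brk (x i2) (x ord0));
      (r i2 + (r i1 + r ord0), brk (x i2) (brk (x i1) (x ord0)));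
      (r ord0 + (r i2 + (r i1 + r ord0)),
        brk (x ord0) (brk (x i2) (brk (x i1) (x ord0))))].

Lemma side_root p : p \in side -> has_root p.2 p.1.
Proof.
rewrite !inE; do 6?[case/predU1P => [->|];
  first by rewrite /=; do ?[exact: x_root|apply: has_root_brk]].
by move/eqP->; rewrite /=; do ?[exact: x_root|apply: has_root_brk].
Qed.

(** Each bracket is nonzero because bracketing with a suitable y undoes the
    last bracketing with x, up to a nonzero factor; for the last vector, of
    root 2 delta, this factor is c1 + c2 = 1 + zeta up to sign. *)
Lemma side_neq0 p : p \in side -> p.2 != 0.
Proof.
have n0 (u v w : g) : brk u v = w -> w != 0 -> v != 0.
  by move=> <-; apply: contra_neq => ->; rewrite brk0r.
have y1x0 : brk (y i1) (x ord0) = 0 by rewrite yx // neq10.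
have y2x0 : brk (y i2) (x ord0) = 0 by rewrite yx // neq20.
have y2x1 : brk (y i2) (x i1) = 0 by rewrite yx // neq21.
have y0x1 : brk (y ord0) (x i1) = 0 by rewrite yx // neq01.
have y0x2 : brk (y ord0) (x i2) = 0 by rewrite yx // neq02.
have E10 : brk (y i1) (brk (x i1) (x ord0)) = x ord0.
  by rewrite (jac0 _ _ y1p) y1x0 brk0r addr0.
have E20 : brk (y i2) (brk (x i2) (x ord0)) = x ord0.
  by rewrite (jac0 _ _ y2p) y2x0 brk0r addr0.
have E210 : brk (y i2) (brk (x i2) (brk (x i1) (x ord0))) = brk (x i1) (x ord0).
  rewrite (jac0 _ _ y2p) (jac0 _ _ (k_part i2)) k20 k21 brk0l add0r.
  by rewrite (jac0 _ _ y2p) y2x1 y2x0 brk0l brk0r addr0 brk0r addr0.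
have E0 : brk (y ord0) (brk (x ord0) (brk (x i2) (brk (x i1) (x ord0)))) =
    (c1 + c2) *: brk (x i2) (brk (x i1) (x ord0)).
  rewrite (jacO _ y0p x0p) (jac0 _ _ (k_part ord0)) (jac0 _ _ (k_part ord0)).
  rewrite k00 k01 k02 brk0r addr0 !brkZl brkZr.
  rewrite (jacE _ y0p x2p) // y0x2 brk0l add0r (jacE _ y0p x1p) // y0x1 brk0l add0r.
  rewrite (skewE x1p (k_part ord0)) // k01 -scaleNr brkZr.
  by rewrite (skewE x2p x1p) // brk12_eq0 oppr0 scaler0 brk0r subr0 -scalerDl addrC.
have N10 := n0 (y i1) _ _ E10 (x_neq0 _).
have N20 := n0 (y i2) _ _ E20 (x_neq0 _).
have N210 := n0 (y i2) _ _ E210 N10.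
have N0 : (c1 + c2) *: brk (x i2) (brk (x i1) (x ord0)) != 0.
  by rewrite scaler_eq0 negb_or c12.
have {}N0 := n0 (y ord0) _ _ E0 N0.
by rewrite !inE; do 6?[case/predU1P => [->|]; first by rewrite /= ?x_neq0];
  move/eqP->.
Qed.

End PositiveSide.

Lemma uniq_map_inj (T U : eqType) (F : T -> U) (s : seq T) x y :
  uniq (map F s) -> x \in s -> y \in s -> F x = F y -> x = y.
Proof.
elim: s => //= a s IH /andP[aF us]; rewrite !inE => /predU1P[->|xs] /predU1P[->|ys] //.
- by move=> E; rewrite E map_f in aF.
- by move=> E; rewrite -E map_f in aF.
- exact: IH.
Qed.

Section Roots.
Variables (K : numFieldType) (zeta : K) (g : D21 zeta).
Hypothesis zeta1 : 1 + zeta != 0.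
Local Notation e := (@D21_e K zeta g).
Local Notation f := (@D21_f K zeta g).
Local Notation h := (@D21_h K zeta g).

Definition neg_simple_root i : weight := - simple_root i.

Definition root_vectors : seq (weight * g) :=
  side e simple_root ++ side f neg_simple_root.

Definition nonzero_roots : seq weight := [seq p.1 | p <- root_vectors].

Lemma nonzero_rootsE : nonzero_roots =
  [:: (1, -1, -1); (0, 2, 0); (0, 0, 2); (1, 1, -1); (1, -1, 1); (1, 1, 1);
      (2, 0, 0); (-1, 1, 1); (0, -2, 0); (0, 0, -2); (-1, -1, 1); (-1, 1, -1);
      (-1, -1, -1); (-2, 0, 0)].
Proof.
by rewrite /nonzero_roots /= /neg_simple_root simple_root1 simple_root2.
Qed.

Lemma h_neq0 i : h i != 0.
Proof. by apply: (free_not0 (h_free g)); apply: map_f; rewrite mem_enum. Qed.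

Lemma f_e i j : brk (f i) (e j) = if i == j then - (-1) ^+ (i == ord0) *: h i else 0.
Proof.
rewrite (brk_skew (f_part g i) (e_part g j)) e_f [j == i]eq_sym.
by have [->|_] := eqVneq i j; rewrite ?scaler0 ?oppr0 // andbb scaleNr.
Qed.

Lemma e_neq0 i : e i != 0.
Proof.
apply/eqP => E; have := e_f g i i; rewrite E brk0l eqxx => /esym/eqP.
by rewrite (negbTE (h_neq0 i)).
Qed.

Lemma f_neq0 i : f i != 0.
Proof.
apply/eqP => E; have := e_f g i i; rewrite E brk0r eqxx => /esym/eqP.
by rewrite (negbTE (h_neq0 i)).
Qed.

Lemma root_vectorsP : root_list root_vectors.
Proof.
have Hs p : p \in side e simple_root -> p.2 != 0.
  apply: (@side_neq0 _ _ g zeta1 e f simple_root 1 zeta) => //; rewrite ?f_e ?eqxx ?I3E /=;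
    rewrite ?brkZl ?h_e ?cartanE ?val_i1 ?val_i2 /=.
  - exact: e_part.
  - exact: f_part.
  - by move=> i j /negbTE ij; rewrite f_e ij.
  - exact: e_neq0.
  - exact: has_root_e.
  - by left.
  1-8: by rewrite ?expr1 ?expr0 !scalerA ?opprK ?mulr0 ?mulN1r ?mul1r ?opprK
    ?scale0r ?scale1r.
have Hf p : p \in side f neg_simple_root -> p.2 != 0.
  apply: (@side_neq0 _ _ g zeta1 f e neg_simple_root (-1) (-zeta)) => //; rewrite ?e_f ?eqxx ?I3E /=;
    rewrite ?h_f ?cartanE ?val_i1 ?val_i2 /=.
  - exact: f_part.
  - exact: e_part.
  - by move=> i j /negbTE ij; rewrite e_f ij.
  - exact: f_neq0.
  - exact: has_root_f.
  - by right.
  1-9: by rewrite -?opprD ?oppr_eq0 -?scaleNr ?opprK ?scale1r ?oppr0 ?scale0r.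
split.
- by rewrite -/nonzero_roots nonzero_rootsE.
- move=> p; rewrite mem_cat => /orP[]; apply: side_root.
    exact: has_root_e.
  exact: has_root_f.
- by move=> p; rewrite mem_cat => /orP[/Hs|/Hf].
Qed.

Definition gbasis : seq g := [seq p.2 | p <- root_vectors] ++ cartan_basis g.

Lemma gbasis_span x : x \in <<gbasis>>%VS.
Proof.
have fr := root_list_free root_vectorsP; rewrite -/gbasis in fr.
have -> : <<gbasis>>%VS = fullv; last exact: memvf.
apply/eqP; rewrite eqEdim subvf /=.
by move/eqP: fr => ->; rewrite D21_dim.
Qed.

Lemma g_lspan (x : g) : lspan (fun y => y \in gbasis) x.
Proof. exact/mem_span_lspan/gbasis_span. Qed.

Lemma gbasis_root y : y \in gbasis ->
  exists2 l, l \in 0 :: nonzero_roots & has_root y l.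
Proof.
rewrite mem_cat => /orP[/mapP[p ps ->]|].
  exists p.1; first by rewrite inE map_f ?orbT.
  by case: root_vectorsP => _ H _; apply: H.
rewrite !inE => /or3P[] /eqP->; exists 0 => //; exact: has_root_h.
Qed.

Lemma root_in_list (x : g) l : has_root x l -> x != 0 -> l \in 0 :: nonzero_roots.
Proof.
move=> wx x0; have := lspan_proj (brk_linearr _) (brk_linearr _) (brk_linearr _) (l := l) _ (g_lspan x) wx.
case/(_ _)/Wrap => [u /gbasis_root[l' _ ?]|]; first by exists l'.
apply: contraPT => ln; move=> H; move/eqP: x0; apply.
apply: (@lspan_min _ _ _ (fun x => x = 0)) H.
  by split=> // c u v -> ->; rewrite scaler0 addr0.
move=> u [/gbasis_root[l' l's wu'] wu]; apply: contrapT => u0.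
by move: ln; rewrite (has_root_uniq wu wu' u0) l's.
Qed.

Lemma notroot0 (x : g) l : has_root x l -> l \notin 0 :: nonzero_roots -> x = 0.
Proof. by move=> wx; apply: contraNeq; apply: root_in_list. Qed.

(** Root spaces are lines: the root vectors and the Cartan subalgebra span g
    by a count of dimensions, and only one of them has the given root. *)
Lemma root_line (x : g) p : p \in root_vectors -> has_root x p.1 ->
  exists c, x = c *: p.2.
Proof.
move=> ps wx; have := lspan_proj (brk_linearr _) (brk_linearr _) (brk_linearr _)
  (l := p.1) _ (g_lspan x) wx.
case/(_ _)/Wrap => [u /gbasis_root[l' _ ?]|]; first by exists l'.
apply: (@lspan_min _ _ _ (fun x => exists c, x = c *: p.2)); first split.
- by exists 0; rewrite scale0r.
- by move=> c u v [a ->] [b ->]; exists (c * a + b); rewrite scalerDl scalerA.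
have [] := root_vectorsP; rewrite cons_uniq => /andP[n0 us] wt nz.
move=> u [ub wu]; have [->|u0] := eqVneq u 0; first by exists 0; rewrite scale0r.
move: ub; rewrite mem_cat => /orP[/mapP[q qs uE]|].
  have := wt _ qs; rewrite -uE => wq; have E := has_root_uniq wu wq (elimN eqP u0).
  by exists 1; rewrite scale1r uE (uniq_map_inj us qs ps (esym E)).
move=> uh; have wh : has_root u 0.
  by move: uh; rewrite !inE => /or3P[] /eqP->; apply: has_root_h.
have E := has_root_uniq wu wh (elimN eqP u0).
by move: n0; rewrite -E map_f.
Qed.

Lemma root0_cartan (x : g) : has_root x 0 -> exists c0 c1 c2,
  x = c0 *: h ord0 + c1 *: h i1 + c2 *: h i2.
Proof.
move=> wx; have := lspan_proj (brk_linearr _) (brk_linearr _) (brk_linearr _)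
  (l := 0) _ (g_lspan x) wx.
case/(_ _)/Wrap => [u /gbasis_root[l' _ ?]|]; first by exists l'.
apply: (@lspan_min _ _ _ (fun x => exists c0 c1 c2,
  x = c0 *: h ord0 + c1 *: h i1 + c2 *: h i2)); first split.
- by exists 0, 0, 0; rewrite !scale0r !addr0.
- move=> c u v [a0 [a1 [a2 ->]]] [b0 [b1 [b2 ->]]].
  exists (c * a0 + b0), (c * a1 + b1), (c * a2 + b2).
  by rewrite !scalerDr !scalerA !scalerDl addrACA; congr (_ + _); rewrite addrACA.
have [] := root_vectorsP; rewrite cons_uniq => /andP[n0 us] wt nz.
move=> u [ub wu]; have [->|u0] := eqVneq u 0.
  by exists 0, 0, 0; rewrite !scale0r !addr0.
move: ub; rewrite mem_cat => /orP[/mapP[q qs uE]|].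
  have := wt _ qs; rewrite -uE => wq; have E := has_root_uniq wu wq (elimN eqP u0).
  by move: n0; rewrite E map_f.
rewrite !inE => /or3P[] /eqP->.
- by exists 1, 0, 0; rewrite !scale0r !addr0 scale1r.
- by exists 0, 1, 0; rewrite !scale0r !addr0 scale1r add0r.
- by exists 0, 0, 1; rewrite !scale0r !add0r scale1r.
Qed.

End Roots.

(** Odd roots are those with an odd coefficient of delta. *)
Definition root_parity (l : weight) := odd `|l.1.1|%N.

Lemma odd_absD (x y : int) : odd (absz (x + y)) = odd (absz x) (+) odd (absz y).
Proof. lia. Qed.

Lemma root_parityD l m : root_parity (l + m) = root_parity l (+) root_parity m.
Proof. exact: odd_absD. Qed.

(** * Generation, parity and the three even triples *)

Section Structure.
Variables (K : numFieldType) (zeta : K) (g : D21 zeta).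
Hypothesis zeta1 : 1 + zeta != 0.
Local Notation e := (@D21_e K zeta g).
Local Notation f := (@D21_f K zeta g).
Local Notation h := (@D21_h K zeta g).
Local Notation part := (ls_part g).
Local Notation hd := (h_2delta g).

Lemma side_part (x : 'I_3 -> g) r p : (forall i, x i \in part (i == ord0)) ->
  (forall i, root_parity (r i) = (i == ord0)) ->
  p \in side x r -> p.2 \in part (root_parity p.1).
Proof.
move=> xp rp.
have x0 : x ord0 \in part true by exact: xp.
have x1 : x i1 \in part false by have := xp i1; rewrite neq10.
have x2 : x i2 \in part false by have := xp i2; rewrite neq20.
have D a b u v : u \in part a -> v \in part b -> brk u v \in part (a (+) b).
  exact: brk_part.
have E10 := D _ _ _ _ x1 x0; have E20 := D _ _ _ _ x2 x0.
have E210 := D _ _ _ _ x2 E10; have E := D _ _ _ _ x0 E210.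
by rewrite !inE; do 6?[case/predU1P => [->|]; first by rewrite /= ?root_parityD !rp ?I3E];
  move/eqP->; rewrite /= ?root_parityD !rp ?I3E.
Qed.

Lemma gbasis_part y : y \in gbasis g ->
  exists l, has_root y l /\ y \in part (root_parity l).
Proof.
rewrite mem_cat => /orP[/mapP[p ps ->]|].
  exists p.1; split; first by have [_ H _] := root_vectorsP g zeta1; apply: H.
  have sp i : root_parity (simple_root i) = (i == ord0).
    by have [->|->|->] := I3_cases i; rewrite ?simple_root1 ?simple_root2 ?I3E.
  move: ps; rewrite mem_cat => /orP[]; apply: side_part => // i.
  - exact: e_part.
  - exact: f_part.
  - by rewrite -sp /neg_simple_root /root_parity /= abszN.
rewrite !inE => /or3P[] /eqP->; exists 0; split;
  by [apply: has_root_h | apply: h_part].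
Qed.

Lemma side_closed (P : g -> Prop) (x : 'I_3 -> g) r p :
  (forall i, x i \in part (i == ord0)) -> (forall i, P (x i)) ->
  (forall a b x y, x \in part a -> y \in part b -> P x -> P y -> P (brk x y)) ->
  p \in side x r -> P p.2.
Proof.
move=> xp Px PP.
have x0 : x ord0 \in part true by exact: xp.
have x1 : x i1 \in part false by have := xp i1; rewrite neq10.
have x2 : x i2 \in part false by have := xp i2; rewrite neq20.
have D a b u v : u \in part a -> v \in part b -> brk u v \in part (a (+) b).
  exact: brk_part.
have E10 := D _ _ _ _ x1 x0; have E20 := D _ _ _ _ x2 x0.
have E210 := D _ _ _ _ x2 E10; have E := D _ _ _ _ x0 E210.
have P10 := PP _ _ _ _ x1 x0 (Px _) (Px _).
have P20 := PP _ _ _ _ x2 x0 (Px _) (Px _).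
have P210 := PP _ _ _ _ x2 E10 (Px _) P10.
have P0 := PP _ _ _ _ x0 E210 (Px _) P210.
by rewrite !inE; do 6?[case/predU1P => [->|]; first exact: Px || by []];
  move/eqP->.
Qed.

(** A property of the generators that passes to brackets of homogeneous
    elements holds on the basis, whose elements are iterated brackets. *)
Lemma gbasis_ind (P : g -> Prop) :
  (forall i, P (e i)) -> (forall i, P (f i)) ->
  (forall a b x y, x \in part a -> y \in part b -> P x -> P y -> P (brk x y)) ->
  forall y, y \in gbasis g -> P y.
Proof.
move=> Pe Pf PP.
have Ph i : P (h i).
  by have := PP _ _ _ _ (e_part g i) (f_part g i) (Pe i) (Pf i); rewrite e_f eqxx.
move=> y; rewrite mem_cat => /orP[/mapP[p ps ->]|].
  move: ps; rewrite mem_cat => /orP[]; apply: side_closed => // i.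
    exact: e_part.
  exact: f_part.
by rewrite !inE => /or3P[] /eqP->.
Qed.

Lemma g_ind (P : g -> Prop) : subspace P ->
  (forall i, P (e i)) -> (forall i, P (f i)) ->
  (forall a b x y, x \in part a -> y \in part b -> P x -> P y -> P (brk x y)) ->
  forall x, P x.
Proof.
move=> PS Pe Pf PP x; apply: lspan_min (g_lspan zeta1 x) => // y.
exact: gbasis_ind.
Qed.

Lemma part_lspan a x : x \in part a ->
  lspan (fun y => (exists2 l, has_root y l & root_parity l = a) /\ y \in part a) x.
Proof.
pose S b y := (exists2 l, has_root y l & root_parity l = b) /\ y \in part b.
move=> xa.
have : exists u v, [/\ lspan (S a) u, lspan (S (~~ a)) v & x = u + v].
  apply: (@lspan_min _ _ _ (fun x => exists u v, [/\ lspan (S a) u, lspan (S (~~ a)) v & x = u + v])) (g_lspan zeta1 x).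
    split; first by exists 0, 0; split; rewrite ?addr0 //; apply: lspan0.
    move=> c y z [u [v [Su Sv ->]]] [u' [v' [Su' Sv' ->]]].
    exists (c *: u + u'), (c *: v + v'); split.
    - by case: (lspan_subspace (S a)) => _; apply.
    - by case: (lspan_subspace (S (~~ a))) => _; apply.
    - by rewrite scalerDr addrACA.
  move=> y /gbasis_part[l [wy py]].
  have [E|E] := eqVneq (root_parity l) a.
    exists y, 0; split; rewrite ?addr0 //; last exact: lspan0.
    by apply: lspan_gen; split; [exists l | rewrite -E].
  have {}E : root_parity l = ~~ a by move/eqP: E; case: (a) (root_parity l) => [] [].
  exists 0, y; split; rewrite ?add0r //; first exact: lspan0.
  by apply: lspan_gen; split; [exists l | rewrite -E].
case=> u [v [Su Sv xE]].
have inpart b w : lspan (S b) w -> w \in part b.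
  apply: (@lspan_min _ _ _ (fun w => w \in part b)); last by move=> w' [].
  by split=> [|c w1 w2 ? ?]; rewrite ?mem0v // memvD // memvZ.
suff v0 : v = 0 by rewrite xE v0 addr0.
have va : v \in part a.
  by rewrite -[v](addKr u) -xE addrC memvB // inpart.
have vna := inpart _ _ Sv.
by apply: (part_cap (g := g)); case: (a) va vna.
Qed.

Lemma root_part (x : g) l : has_root x l -> x \in part (root_parity l).
Proof.
move=> wx; have [->|x0] := eqVneq x 0; first by rewrite mem0v.
have := root_in_list zeta1 wx x0; rewrite in_cons => /orP[/eqP l0|].
  rewrite l0 in wx *.
  have [c0 [c1 [c2 ->]]] := root0_cartan zeta1 wx.
  by rewrite !memvD // memvZ // h_part.
case/mapP => p ps lE; rewrite lE in wx *; have [c ->] := root_line zeta1 ps wx.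
have pb : p.2 \in gbasis g by rewrite mem_cat map_f.
have [l' [wp pp]] := gbasis_part pb.
rewrite memvZ //; have [_ wt nz] := root_vectorsP g zeta1.
by rewrite (has_root_uniq (wt _ ps) wp (elimN eqP (nz _ ps))).
Qed.

Definition coord3 (j : 'I_3) (l : weight) : int := nth 0 [:: l.1.1; l.1.2; l.2] j.
(** Index 0 stands here for the even root 2 delta, while it is the odd simple
    root for the Chevalley generators. *)
Definition H3 (j : 'I_3) : g := nth 0 [:: hd; h i1; h i2] j.
Definition even_root (j : 'I_3) : weight := nth 0 even_pos_roots j.

Lemma H3_root j (x : g) l : has_root x l -> brk (H3 j) x = (coord3 j l)%:~R *: x.
Proof.
move=> [w1 w2 w3]; rewrite /H3 /coord3.
by have [->|->|->] := I3_cases j; rewrite ?val_i1 ?val_i2.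
Qed.

Lemma H3_part j : H3 j \in part false.
Proof.
rewrite /H3; have [->|->|->] := I3_cases j; rewrite ?val_i1 ?val_i2 /=;
  by rewrite ?hd_part ?h_part.
Qed.

Let E := brk (e ord0) (brk (e i2) (brk (e i1) (e ord0))).
Let F := brk (f ord0) (brk (f i2) (brk (f i1) (f ord0))).

Let rE : has_root E (2, 0, 0).
Proof.
have := has_root_brk (has_root_e g zeta1 ord0) (has_root_brk (has_root_e g zeta1 i2)
  (has_root_brk (has_root_e g zeta1 i1) (has_root_e g zeta1 ord0))).
by rewrite simple_root1 simple_root2.
Qed.

Let rF : has_root F (-2, 0, 0).
Proof.
have := has_root_brk (has_root_f g zeta1 ord0) (has_root_brk (has_root_f g zeta1 i2)
  (has_root_brk (has_root_f g zeta1 i1) (has_root_f g zeta1 ord0))).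
by rewrite simple_root1 simple_root2.
Qed.

Let E_in : ((2, 0, 0), E) \in root_vectors g.
Proof.
rewrite mem_cat; apply/orP; left; rewrite /side -/E !inE.
rewrite simple_root1 simple_root2.
by apply/or4P; constructor 4; apply/or4P; constructor 4.
Qed.

Let F_in : ((-2, 0, 0), F) \in root_vectors g.
Proof.
rewrite mem_cat; apply/orP; right; rewrite /side -/F !inE /neg_simple_root.
rewrite simple_root1 simple_root2.
by apply/or4P; constructor 4; apply/or4P; constructor 4.
Qed.

(** Were [E, F] = 0, the invariant form would satisfy
    0 = B([E, F], h) = B(E, [F, h]) = 2 B(E, F), while E is orthogonal to every
    root vector whose root is not - 2 delta; so E would lie in the radical. *)
Let EF_neq0 : brk E F <> 0.
Proof.
move=> EF0; have [_ _ [B [[Br Bl] _ _ Binv Bnd]]] := D21_basic g.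
have B0l y : B 0 y = 0.
  have /eqP := Bl y 1 0 0; rewrite scaler0 addr0 mul1r -subr_eq0 opprD addrA subrr.
  by rewrite sub0r oppr_eq0 => /eqP.
have B0r y : B y 0 = 0.
  have /eqP := Br y 1 0 0; rewrite scaler0 addr0 mul1r -subr_eq0 opprD addrA subrr.
  by rewrite sub0r oppr_eq0 => /eqP.
have BZr c x y : B x (c *: y) = c * B x y by rewrite -[c *: y]addr0 Br B0r addr0.
have BZl c x y : B (c *: x) y = c * B x y by rewrite -[c *: x]addr0 Bl B0l addr0.
have Ep : E \in part false by exact: (root_part rE).
have Fp : F \in part false by exact: (root_part rF).
have BEF : B E F = 0.
  have := Binv E F hd; rewrite EF0 B0l (skewE Fp (hd_part g)) //.
  case: rF => -> _ _; rewrite -scaleNr BZr => /esym/eqP.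
  by rewrite mulf_eq0 oppr_eq0 intr_eq0 /= => /eqP.
have : E = 0.
  apply: Bnd => y; apply: (@lspan_min _ _ _ (fun y => B E y = 0)) (g_lspan zeta1 y).
    by split=> // c u v Bu Bv; rewrite Br Bu Bv mulr0 addr0.
  move=> {}y /(gbasis_root zeta1)[l _ wy].
  have key j : (coord3 j (2, 0, 0) + coord3 j l)%:~R * B E y = 0.
    have := Binv E (H3 j) y; rewrite (skewE Ep (H3_part j)) // (H3_root _ rE).
    rewrite (H3_root _ wy) -scaleNr BZl BZr rmorphD mulrDl => <-.
    by rewrite mulNr addrN.
  have [->//|] := eqVneq (B E y) 0 => By.
  have l0 j : coord3 j (2, 0, 0) + coord3 j l = 0.
    apply/eqP; have /eqP := key j; rewrite mulf_eq0 (negbTE By) orbF.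
    by rewrite intr_eq0.
  have lE : l = (-2, 0, 0).
    move: (l0 ord0) (l0 i1) (l0 i2); rewrite /coord3 val_i1 val_i2.
    case: (l) => [[a b] c] /= A1 B1 C1; congr (_, _, _); lia.
  rewrite lE in wy; have [c yE] := root_line zeta1 F_in wy.
  by move: By; rewrite yE BZr BEF mulr0 eqxx.
by apply/eqP; have [_ _ nz] := root_vectorsP g zeta1; apply: (nz _ E_in).
Qed.

(** [E, F] lies in the Cartan subalgebra and commutes with e_1 and e_2, as
    2 delta plus or minus 2 epsilon_i is not a root; the elements with this property are
    the multiples of h_(2 delta). *)
Let EF_hd : exists2 c, c != 0 & brk E F = c *: hd.
Proof.
have Ep : E \in part false by exact: (root_part rE).
have Fp : F \in part false by exact: (root_part rF).
have w0 := has_root_brk rE rF.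
have [c0 [c1 [c2 EFE]]] := root0_cartan zeta1 w0.
have comm (i : 'I_3) : i != ord0 -> brk (brk E F) (e i) = 0.
  move=> i0; have := jac0 F (e i) Ep.
  have -> : brk F (e i) = 0.
    apply: (notroot0 zeta1 (has_root_brk rF (has_root_e g zeta1 i))).
    by have [E1|E1|E1] := I3_cases i; move: i0;
      rewrite in_cons nonzero_rootsE E1 ?simple_root1 ?simple_root2.
  have -> : brk E (e i) = 0.
    apply: (notroot0 zeta1 (has_root_brk rE (has_root_e g zeta1 i))).
    by have [E1|E1|E1] := I3_cases i; move: i0;
      rewrite in_cons nonzero_rootsE E1 ?simple_root1 ?simple_root2.
  by rewrite !brk0r addr0.
have eq1 : c0 + c1 * 2 = 0.
  have := comm i1; rewrite neq10 => /(_ isT) /eqP.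
  rewrite EFE !brkDl !brkZl !h_e !cartanE ?val_i1 ?val_i2 /= scale0r scaler0 addr0.
  by rewrite !scalerA -scalerDl scaler_eq0 (negbTE (e_neq0 _ _)) orbF mulr1 => /eqP.
have eq2 : c0 * zeta + c2 * 2 = 0.
  have := comm i2; rewrite neq20 => /(_ isT) /eqP.
  rewrite EFE !brkDl !brkZl !h_e !cartanE ?val_i1 ?val_i2 /= scale0r scaler0 addr0.
  by rewrite !scalerA -scalerDl scaler_eq0 (negbTE (e_neq0 _ _)) orbF => /eqP.
have EFE' : brk E F = (c0 * (1 + zeta) / 2) *: hd.
  rewrite EFE h0E // !scalerDr !scalerA -!addrA -[RHS]addr0; congr (_ + _).
    by congr (_ *: _); field.
  rewrite addrA addrACA -!scalerDl.
  have -> : c0 / 2 + c1 = 0 by rewrite -[RHS](mul0r 2^-1) -eq1; field.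
  have -> : c0 / 2 * zeta + c2 = 0 by rewrite -[RHS](mul0r 2^-1) -eq2; field.
  by rewrite !scale0r addr0.
exists (c0 * (1 + zeta) / 2) => //; apply/eqP => c00.
by apply: EF_neq0; rewrite EFE' c00 scale0r.
Qed.

(** For 2 epsilon_1 and 2 epsilon_2 the triples are Chevalley generators; the
    triple of 2 delta is not, and needs the invariant form. *)
Lemma sl2_triples : exists E3 F3 : 'I_3 -> g, forall j,
  [/\ has_root (E3 j) (even_root j), has_root (F3 j) (- even_root j),
      brk (E3 j) (F3 j) = H3 j &
      j != ord0 -> E3 j = e j /\ F3 j = f j].
Proof.
have [c c0 EFE] := EF_hd.
exists (fun j => if j == ord0 then E else e j), (fun j => if j == ord0 then c^-1 *: F else f j).
move=> j; rewrite /H3 /even_root; have [->|->|->] := I3_cases j.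
- rewrite eqxx; split=> //; first exact: (subspaceZ _ (has_root_subspace g _)).
  by rewrite brkZr EFE scalerA mulVf // scale1r.
- rewrite neq10 val_i1 /=; split=> //.
  + by have := has_root_e g zeta1 i1; rewrite simple_root1.
  + by have := has_root_f g zeta1 i1; rewrite simple_root1.
  + by rewrite e_f eqxx.
- rewrite neq20 val_i2 /=; split=> //.
  + by have := has_root_e g zeta1 i2; rewrite simple_root2.
  + by have := has_root_f g zeta1 i2; rewrite simple_root2.
  + by rewrite e_f eqxx.
Qed.

End Structure.

(** * Weight modules and their submodules *)

Section Actions.
Variables (K : fieldType) (g : lieSuperalgebra K) (M : superModule g).
Implicit Types (x y : g) (u v : M).

Lemma act0r x : act x 0 = 0 :> M. Proof. exact: (lin0 (act_linearr x)). Qed.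
Lemma actDr x u v : act x (u + v) = act x u + act x v.
Proof. exact: (linD (act_linearr x)). Qed.
Lemma actNr x u : act x (- u) = - act x u.
Proof. exact: (linN (act_linearr x)). Qed.
Lemma actZr x c u : act x (c *: u) = c *: act x u.
Proof. exact: (linZ (act_linearr x)). Qed.
Lemma act0l u : act 0 u = 0 :> M. Proof. exact: (lin0 (act_linearl u)). Qed.
Lemma actDl x y u : act (x + y) u = act x u + act y u.
Proof. exact: (linD (act_linearl u)). Qed.
Lemma actNl x u : act (- x) u = - act x u.
Proof. exact: (linN (act_linearl u)). Qed.
Lemma actZl c x u : act (c *: x) u = c *: act x u.
Proof. exact: (linZ (act_linearl u)). Qed.

Lemma act_brkE a b x y v : x \in ls_part g a -> y \in ls_part g b -> ~~ (a && b) ->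
  act (brk x y) v = act x (act y v) - act y (act x v).
Proof. by move=> xa yb /negbTE ab; rewrite (act_brk _ xa yb) ab scale1r. Qed.

Lemma act_brk0 x y v : x \in ls_part g false ->
  act (brk x y) v = act x (act y v) - act y (act x v).
Proof.
move=> x0; have [y0 [y1 [p0 p1 ->]]] := part_split y.
rewrite brkDr !actDl (act_brkE _ x0 p0) // (act_brkE _ x0 p1) // actDr opprD.
by rewrite addrACA.
Qed.

Lemma submodule_subspace (U : M -> Prop) : submodule U -> subspace U.
Proof. by case. Qed.

Definition generated u : M -> Prop := fun v => forall U, submodule U -> U u -> U v.

Lemma generated_submodule u : submodule (generated u).
Proof.
split=> [U [U0 _ _] _ //|c v w Gv Gw U UM Uu|x v Gv U UM Uu].
  by case: (UM) => _ US _; apply: US; [apply: Gv|apply: Gw].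
by case: (UM) => _ _; apply; apply: Gv.
Qed.

Lemma generated_self u : generated u u. Proof. by []. Qed.

Lemma part_unique u0 u1 v0 v1 : @sm_part _ _ M false u0 -> sm_part false v0 ->
  sm_part true u1 -> sm_part true v1 -> u0 + u1 = v0 + v1 -> u0 = v0.
Proof.
move=> pu0 pv0 pu1 pv1 E; apply: subr0_eq; apply: sm_part_cap.
  by rewrite -scaleN1r addrC; apply: sm_part_linear.
have -> : u0 - v0 = v1 - u1.
  by apply/eqP; rewrite subr_eq addrAC eq_sym subr_eq eq_sym E addrC.
by rewrite -scaleN1r addrC; apply: sm_part_linear.
Qed.

Lemma part_subspace a : subspace (@sm_part _ _ M a).
Proof. by split; [apply: sm_part0 | apply: sm_part_linear]. Qed.

Lemma lspan_graded (S : M -> Prop) v : (forall u, S u -> exists a, sm_part a u) ->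
  lspan S v -> exists v0 v1, [/\ lspan S v0, lspan S v1, sm_part false v0,
    sm_part true v1 & v = v0 + v1].
Proof.
move=> hS; apply: (@lspan_min _ _ _ (fun v => exists v0 v1, [/\ lspan S v0, lspan S v1, sm_part false v0,
    sm_part true v1 & v = v0 + v1])).
  split; first by exists 0, 0; rewrite addr0; split=> //; (exact: lspan0 || exact: sm_part0).
  move=> c u w [u0 [u1 [Su0 Su1 pu0 pu1 ->]]] [w0 [w1 [Sw0 Sw1 pw0 pw1 ->]]].
  exists (c *: u0 + w0), (c *: u1 + w1); case: (lspan_subspace S) => _ SS.
  by split; rewrite ?scalerDr 1?addrACA //; first [exact: SS | exact: sm_part_linear].
move=> u Su; have [[] pu] := hS _ Su.
  by exists 0, u; split; rewrite ?add0r //; [exact: lspan0 | exact: lspan_gen | exact: sm_part0].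
by exists u, 0; split; rewrite ?addr0 //; [exact: lspan_gen | exact: lspan0 | exact: sm_part0].
Qed.

End Actions.

Definition wsum (w : seq 'I_3) : weight := \sum_(i <- w) simple_root i.
(** A linear form with value 2 on each of the three simple roots. *)
Definition height (l : weight) : int := 4 * l.1.1 + l.1.2 + l.2.

Lemma heightD l m : height (l + m) = height l + height m.
Proof. by rewrite /height /=; ring. Qed.
Lemma heightN l : height (- l) = - height l.
Proof. by rewrite /height /=; ring. Qed.
Lemma height_simple i : height (simple_root i) = 2.
Proof. by have [->|->|->] := I3_cases i; rewrite ?simple_root1 ?simple_root2. Qed.
Lemma height_wsum w : height (wsum w) = 2 * (size w)%:Z.
Proof.
rewrite /wsum; elim: w => [|i w IH]; first by rewrite big_nil.
by rewrite big_cons heightD IH height_simple /=; lia.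
Qed.
Lemma height_pos l : l \in pos_roots -> 0 < height l.
Proof. by rewrite !inE; do 6?[case/predU1P => [->//|]]; move/eqP->. Qed.

Lemma wsum_cons i w : wsum (i :: w) = simple_root i + wsum w.
Proof. by rewrite /wsum big_cons. Qed.

Section WeightModules.
Variables (K : numFieldType) (zeta : K) (g : D21 zeta).
Hypothesis zeta1 : 1 + zeta != 0.
Local Notation e := (@D21_e K zeta g).
Local Notation f := (@D21_f K zeta g).
Local Notation h := (@D21_h K zeta g).
Local Notation part := (ls_part g).
Local Notation hd := (h_2delta g).
Local Notation module := (superModule g).

Lemma has_weight_subspace (M : module) l : subspace (fun v : M => has_weight v l).
Proof. by apply: wtv_subspace; apply: act_linearr. Qed.

Lemma has_weight_uniq (M : module) (v : M) l m :
  has_weight v l -> has_weight v m -> v <> 0 -> l = m.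
Proof. exact: wtv_uniq. Qed.

Lemma act_root (M : module) x (v : M) a l : has_root x a -> has_weight v l ->
  has_weight (act x v) (l + a).
Proof.
move=> [x1 x2 x3] [v1 v2 v3].
have E (k : g) c d : k \in part false -> brk k x = c%:~R *: x ->
    act k v = d%:~R *: v -> act k (act x v) = (d + c)%:~R *: act x v.
  move=> k0 kx kv; have /eqP := act_brk0 x v k0.
  rewrite kx kv actZl actZr eq_sym subr_eq => /eqP->.
  by rewrite -scalerDl -rmorphD addrC.
by split; apply: E => //; [apply: hd_part | apply: h_part | apply: h_part].
Qed.

Lemma act_h_weight (M : module) i (v : M) l : has_weight v l ->
  exists c, act (h i) v = c *: v.
Proof.
move=> [v1 v2 v3]; have [->|->|->] := I3_cases i; last 2 first.
- by exists l.1.2%:~R; rewrite -v2.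
- by exists l.2%:~R; rewrite -v3.
rewrite h0E // actZl !actDl actZl v1 -/(h_2eps1 g) v2 actZl -/(h_2eps2 g) v3.
by rewrite !scalerA -!scalerDl scalerA; eexists.
Qed.

Lemma submodule_ind (M : module) (U : M -> Prop) : subspace U ->
  (forall i v, U v -> U (act (e i) v)) -> (forall i v, U v -> U (act (f i) v)) ->
  submodule U.
Proof.
move=> US Ue Uf; split; [by case: US | by case: US | move=> x].
apply: (@g_ind _ _ g zeta1 (fun x => forall v, U v -> U (act x v))) => //.
  split=> [v Uv|c y z Uy Uz v Uv]; first by rewrite act0l; case: US.
  by rewrite actDl actZl; case: US => _; apply; auto.
move=> a b y z ya zb Uy Uz v Uv; rewrite (act_brk _ ya zb).
by apply: subspaceB => //; [|apply: subspaceZ => //]; auto.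
Qed.

Definition wcomps (M : module) (v : M) s u :=
  comps (act hd) (act (h i1)) (act (h i2)) v s u.

Lemma integral_comps (M : module) (v : M) : integral_weight_module M ->
  exists s u, wcomps v s u.
Proof.
move=> /(_ v)[s sw ->].
have : lspan (fun u : M => exists l, has_weight u l) (\sum_(u <- s) u).
  by apply: subspace_sum_seq => // u /sw; apply: lspan_gen.
move=> Sx; have [//|s' [u [c _]]] := lspan_decomp (act_linearr hd) (act_linearr (h i1))
  (act_linearr (h i2)) _ Sx.
by exists s', u.
Qed.

Lemma submodule_comps (M : module) (U : M -> Prop) v s u :
  submodule U -> wcomps v s u -> U v -> forall l, l \in s -> U (u l).
Proof.
move=> UM [us -> wu] Us; have [_ _ Ua] := UM.
apply: (weight_components (act_linearr hd) (act_linearr (h i1)) (act_linearr (h i2))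
  (submodule_subspace UM) _ us wu Us) => x Ux.
by split; apply: Ua.
Qed.

(** In an integral weight module with this property, every submodule is
    graded. *)
Definition weight_parity (M : module) :=
  exists a, forall (v : M) l, has_weight v l -> sm_part (a (+) root_parity l) v.

Lemma submodule_graded (M : module) (U : M -> Prop) : integral_weight_module M ->
  weight_parity M -> submodule U -> graded_submodule U.
Proof.
move=> Mi [a aP] UM; split=> // v0 v1 p0 p1 Uv.
have [s [u c]] := integral_comps (v0 + v1) Mi.
have Uu := submodule_comps UM c Uv; case: c => us vE wu.
have P b : sm_part b (\sum_(l <- s | a (+) root_parity l == b) u l).
  rewrite big_seq_cond; apply: (subspace_sum _ (part_subspace _ b)) => l.
  by case/andP=> ls /eqP <-; apply: aP; apply: wu.
have E : v0 + v1 = \sum_(l <- s | a (+) root_parity l == false) u l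
                 + \sum_(l <- s | a (+) root_parity l == true) u l.
  rewrite vE (bigID (fun l => a (+) root_parity l == false)) /=; congr (_ + _).
  by apply: eq_bigl => l; case: (a (+) _).
rewrite (part_unique p0 (P false) p1 (P true) E) big_seq_cond.
apply: (subspace_sum _ (submodule_subspace UM)) => l /andP[ls _].
exact: Uu.
Qed.

Definition fw (M : module) (w : seq 'I_3) (v : M) := foldr (fun i => act (f i)) v w.
Lemma fw_weight (M : module) w (v : M) l : has_weight v l ->
  has_weight (fw w v) (l - wsum w).
Proof.
move=> wv; elim: w => [|i w IH]; first by rewrite /wsum big_nil subr0.
by rewrite wsum_cons opprD addrC -addrA addrC [- wsum w + _]addrC;
  apply: act_root IH; apply: has_root_f.
Qed.

Lemma fw_part (M : module) w (v : M) a : sm_part a v ->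
  sm_part (a (+) root_parity (wsum w)) (fw w v).
Proof.
move=> av; elim: w => [|i w IH]; first by rewrite /wsum big_nil addbF.
rewrite wsum_cons root_parityD addbCA.
suff -> : root_parity (simple_root i) = (i == ord0) by apply: act_part IH; apply: f_part.
by have [->|->|->] := I3_cases i; rewrite ?simple_root1 ?simple_root2 ?I3E.
Qed.

Definition hw_span (M : module) (v : M) : M -> Prop :=
  lspan (fun x => exists w, x = fw w v).

Lemma hw_span_fw (M : module) (v : M) w : hw_span v (fw w v).
Proof. by apply: lspan_gen; exists w. Qed.

(** Moving an e_i to the right through the f_j leaves only terms that contain
    an h_i, which acts by a scalar, or e_i applied to the highest weight
    vector. *)
Lemma hw_span_submodule (M : module) (v : M) l : has_weight v l ->
  (forall i, act (e i) v = 0) -> submodule (hw_span v).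
Proof.
move=> wv ev.
have Sf i x : hw_span v x -> hw_span v (act (f i) x).
  apply: (@lspan_min _ _ _ (fun x => hw_span v (act (f i) x))).
    split=> [|c y z Sy Sz]; first by rewrite act0r; apply: lspan0.
    by rewrite actDr actZr; case: (lspan_subspace (fun x => exists w, x = fw w v)) => _; apply.
  by move=> _ [w ->]; apply: (hw_span_fw _ (i :: w)).
apply: submodule_ind => //; first exact: lspan_subspace.
move=> i x.
apply: (@lspan_min _ _ _ (fun x => hw_span v (act (e i) x))).
  split=> [|c y z Sy Sz]; first by rewrite act0r; apply: lspan0.
  by rewrite actDr actZr; case: (lspan_subspace (fun x => exists w, x = fw w v)) => _; apply.
move=> _ [w ->]; elim: w => [|j w IH]; first by rewrite /= ev; apply: lspan0.
have /eqP := act_brk (fw w v) (e_part g i) (f_part g j).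
rewrite eq_sym subr_eq => /eqP /= ->.
have SS := lspan_subspace (fun x => exists w, x = fw w v); rewrite -/(hw_span v) in SS.
apply: subspaceD => //; last by apply: subspaceZ => //; apply: Sf.
rewrite e_f; case: eqP => [_|_]; last by rewrite act0l; apply: lspan0.
have [c ->] := act_h_weight i (fw_weight w wv).
by apply: subspaceZ => //; apply: hw_span_fw.
Qed.

Lemma hw_span_proj (M : module) (v : M) l x m : has_weight v l -> hw_span v x ->
  has_weight x m -> lspan (fun y => exists2 w, y = fw w v & l - wsum w = m) x.
Proof.
move=> wv Sx wx.
have wS (u : M) : (exists w, u = fw w v) -> exists l', has_weight u l'.
  by move=> [w ->]; exists (l - wsum w); apply: fw_weight.
have := lspan_proj (act_linearr _) (act_linearr _) (act_linearr _) (l := m) wS Sx wx.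
apply: lspan_mono => u [[w uE] wu].
have [->|u0] := eqVneq u 0; first exact: lspan0.
apply: lspan_gen; exists w => //; apply: (has_weight_uniq (v := u)) (elimN eqP u0) => //.
by rewrite uE; apply: fw_weight.
Qed.

Lemma lspan_empty (V : lmodType K) (S : V -> Prop) x : (forall u, S u -> u = 0) ->
  lspan S x -> x = 0.
Proof.
move=> S0; apply: (@lspan_min _ _ _ (fun x => x = 0)) => //.
by split=> // c u v -> ->; rewrite scaler0 addr0.
Qed.

Lemma hw_span_high (M : module) (v : M) l x m : has_weight v l -> hw_span v x ->
  has_weight x m -> height l < height m -> x = 0.
Proof.
move=> wv Sx wx lm; apply: lspan_empty (hw_span_proj wv Sx wx) => u [w _ E].
by move: lm; rewrite -E heightD heightN height_wsum; lia.
Qed.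

Lemma hw_span_top (M : module) (v : M) l x : has_weight v l -> hw_span v x ->
  has_weight x l -> exists c, x = c *: v.
Proof.
move=> wv Sx wx; apply: (@lspan_min _ _ _ (fun x => exists c, x = c *: v)) (hw_span_proj wv Sx wx).
  split; first by exists 0; rewrite scale0r.
  by move=> c y z [a ->] [b ->]; exists (c * a + b); rewrite scalerDl scalerA.
move=> u [w -> E]; have := congr1 height E.
rewrite heightD heightN height_wsum => H.
have -> : w = [::] by apply: size0nil; lia.
by exists 1; rewrite scale1r.
Qed.

End WeightModules.

(** * Highest weight vectors and uniqueness of the simple modules *)

Section ProductModule.
Variables (K : fieldType) (g : lieSuperalgebra K) (M N : superModule g).

Definition prod_act (x : g) (p : M * N) : M * N := (act x p.1, act x p.2).
Definition prod_part a (p : M * N) := sm_part a p.1 /\ sm_part a p.2.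

Lemma prod_act_linearr x : linear (prod_act x).
Proof. by move=> c u v; congr (_, _); rewrite /= actDr actZr. Qed.
Lemma prod_act_linearl v : linear (prod_act^~ v).
Proof. by move=> c x y; congr (_, _); rewrite /= actDl actZl. Qed.
Lemma prod_part0 a : prod_part a 0.
Proof. by split; apply: sm_part0. Qed.
Lemma prod_part_linear a c u v : prod_part a u -> prod_part a v ->
  prod_part a (c *: u + v).
Proof. by move=> [? ?] [? ?]; split; apply: sm_part_linear. Qed.
Lemma prod_part_sum v : exists v0 v1,
  [/\ prod_part false v0, prod_part true v1 & v = v0 + v1].
Proof.
case: v => a b; have [a0 [a1 [? ? ->]]] := sm_part_sum a.
have [b0 [b1 [? ? ->]]] := sm_part_sum b.
by exists (a0, b0), (a1, b1).
Qed.
Lemma prod_part_cap v : prod_part false v -> prod_part true v -> v = 0.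
Proof.
by case: v => a b [/= a0 b0] [/= a1 b1]; congr (_, _); apply: sm_part_cap.
Qed.
Lemma prod_act_part a b x v : x \in ls_part g a -> prod_part b v ->
  prod_part (a (+) b) (prod_act x v).
Proof. by move=> xa [? ?]; split; apply: act_part. Qed.
Lemma prod_act_brk a b x y v : x \in ls_part g a -> y \in ls_part g b ->
  prod_act (brk x y) v =
  prod_act x (prod_act y v) - (-1) ^+ (a && b) *: prod_act y (prod_act x v).
Proof. by move=> xa yb; congr (_, _); apply: act_brk. Qed.

Definition prod_module : superModule g :=
  SuperModule prod_act_linearr prod_act_linearl prod_part0 prod_part_linear
    prod_part_sum prod_part_cap prod_act_part prod_act_brk.

End ProductModule.

Section Transfer.
Variables (K : fieldType) (g : lieSuperalgebra K).

Lemma intertwining_image (M N : superModule g) (phi : {linear M -> N}) :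
  intertwining phi -> submodule (fun w => exists v, w = phi v).
Proof.
move=> phiP; split=> [|c u v [a ->] [b ->]|x v [a ->]].
- by exists 0; rewrite linear0.
- by exists (c *: a + b); rewrite linearD linearZ.
- by exists (act x a); rewrite phiP.
Qed.

End Transfer.

Section HighestWeight.
Variables (K : numFieldType) (zeta : K) (g : D21 zeta).
Hypothesis zeta1 : 1 + zeta != 0.
Local Notation e := (@D21_e K zeta g).
Local Notation part := (ls_part g).
Local Notation module := (superModule g).

(** Homogeneity is part of the definition so that the submodule generated by
    the vector is graded. *)
Definition hwv (M : module) (v : M) l :=
  [/\ v <> 0, has_weight v l, exists a, sm_part a v & forall i, act (e i) v = 0].

Lemma hwv_span_submodule (M : module) (v : M) l : hwv v l -> submodule (hw_span v).
Proof. by case=> _ wv _ ev; apply: hw_span_submodule wv ev. Qed.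

Lemma hwv_span_graded (M : module) (v : M) l : hwv v l -> graded_submodule (hw_span v).
Proof.
move=> hv; split; first exact: hwv_span_submodule hv.
move=> v0 v1 p0 p1 Sv; have [_ _ [a av] _] := hv.
have hS (u : M) : (exists w, u = fw w v) -> exists a, sm_part a u.
  by case=> w ->; eexists; apply: fw_part av.
have [u0 [u1 [S0 S1 q0 q1 E]]] := lspan_graded hS Sv.
by rewrite (part_unique p0 q0 p1 q1 E).
Qed.

Lemma irreducible_span (M : module) (v : M) l : irreducible M -> hwv v l ->
  forall x, hw_span v x.
Proof.
move=> [_ irr] hv; have [v0 _ _ _] := hv.
case: (irr _ (hwv_span_graded hv)) => // H; case: v0; apply: H.
exact: (hw_span_fw v [::]).
Qed.

Lemma span_integral (M : module) (v : M) l : hwv v l ->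
  (forall x, hw_span v x) -> integral_weight_module M.
Proof.
move=> [_ wv _ _] Sv x.
have := Sv x; apply: (@lspan_min _ _ _ (fun x => sum_of (fun u : M => exists l, has_weight u l) x)).
  split; first by exists [::]; rewrite ?big_nil.
  move=> c _ _ [s sP ->] [t tP ->]; exists ([seq c *: u | u <- s] ++ t).
    move=> u; rewrite mem_cat => /orP[/mapP[y /sP[l' ?] ->]|/tP//].
    by exists l'; apply: (subspaceZ _ (has_weight_subspace _ _)).
  by rewrite big_cat big_map scaler_sumr.
move=> _ [w ->]; exists [:: fw w v]; last by rewrite big_seq1.
by move=> _ /predU1P[->|//]; exists (l - wsum w); apply: fw_weight.
Qed.

Lemma span_weight_parity (M : module) (v : M) l : hwv v l ->
  (forall x, hw_span v x) -> weight_parity M.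
Proof.
move=> [_ wv [a av] _] Sv; exists (a (+) root_parity l) => x m wx.
apply: (@lspan_min _ _ _ (sm_part _)) (hw_span_proj zeta1 wv (Sv x) wx).
  exact: part_subspace.
move=> _ [w -> <-]; rewrite root_parityD addbA -[_ (+) _ (+) root_parity l]addbA addbb addbF.
have -> : root_parity (- wsum w) = root_parity (wsum w) by rewrite /root_parity /= abszN.
exact: fw_part.
Qed.

Lemma span_nplus (M : module) (v : M) l : hwv v l ->
  (forall x, hw_span v x) -> forall x, in_nplus x -> act x v = 0.
Proof.
move=> [_ wv _ _] Sv x [s sP ->].
have -> : act (\sum_(u <- s) u) v = \sum_(u <- s) act u v.
  by apply: (big_morph (fun x => act x v)) => [y z|]; rewrite ?actDl ?act0l.
rewrite big1_seq // => y /andP[_ /sP[a ap wy]].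
apply: (hw_span_high zeta1 wv (Sv _) (act_root wy wv)).
by rewrite heightD ltrDl height_pos.
Qed.

Lemma in_nplus_e i : in_nplus (e i).
Proof.
exists [:: e i]; last by rewrite big_seq1.
move=> _ /predU1P[->|//]; exists (simple_root i); last exact: has_root_e.
by have [->|->|->] := I3_cases i; rewrite ?simple_root1 ?simple_root2.
Qed.

Lemma hwv_is_L (M : module) (v : M) l : irreducible M -> hwv v (l - rho) -> is_L l M.
Proof.
move=> irr hv; split=> //; exists v; case: (hv) => v0 wv _ _; split=> //.
by apply: (span_nplus hv); apply: (irreducible_span irr hv).
Qed.

(** The Cartan subalgebra is even and the e_i are homogeneous, so both parity
    components of a vector inherit its weight and its annihilation by the
    e_i. *)
Lemma weight_part (M : module) (v : M) l : has_weight v l -> v <> 0 ->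
  exists (a : bool) (v' : M), [/\ v' <> 0, has_weight v' l, sm_part a v' &
    forall i, act (e i) v = 0 -> act (e i) v' = 0].
Proof.
move=> wv v0; have [u0 [u1 [p0 p1 E]]] := sm_part_sum v.
have Z (x : g) b (c : int) : x \in part false ->
    act x v = c%:~R *: v -> act x (if b then u1 else u0) = c%:~R *: (if b then u1 else u0).
  move=> xp xv; rewrite E actDr scalerDr in xv.
  have q0 := act_part xp p0; have q1 := act_part xp p1; rewrite /= in q0 q1.
  have r0 := subspaceZ (c%:~R) (part_subspace M false) p0.
  have r1 := subspaceZ (c%:~R) (part_subspace M true) p1.
  have E0 := part_unique q0 r0 q1 r1 xv; case: b => //.
  by move: xv; rewrite E0 => /addrI.
have W b : has_weight (if b then u1 else u0) l.
  by case: wv => w1 w2 w3; split; apply: Z => //; rewrite ?hd_part ?h_part.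
have P i b : act (e i) v = 0 -> act (e i) (if b then u1 else u0) = 0.
  rewrite E actDr => E0.
  have q0 := act_part (e_part g i) p0; have q1 := act_part (e_part g i) p1.
  have aux (x y : M) : sm_part false x -> sm_part true y -> x + y = 0 -> x = 0 /\ y = 0.
    move=> px py xy; have x0 : x = 0.
      by apply: (part_unique px (sm_part0 M _) py (sm_part0 M _)); rewrite addr0.
    by move: xy; rewrite x0 add0r.
  case: (i == ord0) q0 q1 => /= q0 q1.
    by rewrite addrC in E0; have [? ?] := aux _ _ q1 q0 E0; case: b.
  by have [? ?] := aux _ _ q0 q1 E0; case: b.
have [u00|u00] := eqVneq u0 0.
  exists true, u1; split=> //; last by move=> i; apply: (P i true).
    by move=> u10; apply: v0; rewrite E u00 u10 addr0.
  exact: (W true).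
exists false, u0; split=> //; last by move=> i; apply: (P i false).
  exact/eqP.
exact: (W false).
Qed.

Lemma is_L_hwv (M : module) l : is_L l M -> exists v : M, hwv v (l - rho).
Proof.
move=> [_ [v [v0 wv nv]]]; have [a [v' [v'0 wv' pv' ev']]] := weight_part wv v0.
exists v'; split=> //; first by exists a.
by move=> i; apply: ev'; apply: nv; apply: in_nplus_e.
Qed.

Lemma fw_prod (M N : module) w (v : M) (v' : N) :
  @fw _ _ _ (prod_module M N) w (v, v') = (fw w v, fw w v').
Proof. by elim: w => //= i w ->. Qed.

(** In the product module the vector (v, v') generates the graph of an
    isomorphism: its weight space of weight l is a line, so it contains neither
    (0, v') nor (v, 0), and its intersections with the two factors vanish by
    irreducibility. *)
Lemma irreducible_unique (M N : module) l (v : M) (v' : N) : irreducible M -> irreducible N ->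
  hwv v l -> hwv v' l -> isomorphic M N.
Proof.
move=> iM iN hv hv'.
have SM := irreducible_span iM hv; have SN := irreducible_span iN hv'.
have [v0 wv _ ev] := hv; have [v'0 wv' _ ev'] := hv'.
pose P := prod_module M N; pose p : P := (v, v').
have wp : has_weight p l.
  by case: wv wv' => a1 a2 a3 [b1 b2 b3]; split; congr (_, _).
have ep i : act (e i) p = 0 by congr (_, _).
have GM := hw_span_submodule zeta1 wp ep.
pose R (a : M) (b : N) := hw_span (M := P) p (a, b).
have Rlin c a b a' b' : R a b -> R a' b' -> R (c *: a + a') (c *: b + b').
  by case: GM => _ GL _ Rab Ra'b'; apply: (GL c (a, b) (a', b')).
have Ract x a b : R a b -> R (act x a) (act x b).
  by case: GM => _ _ GA Rab; apply: (GA x (a, b)).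
have R00 : R 0 0 by case: GM.
have Rtot a : exists b, R a b.
  have := SM a; apply: (@lspan_min _ _ _ (fun a => exists b, R a b)).
    split; first by exists 0.
    by move=> c x y [b Rb] [b' Rb']; exists (c *: b + b'); apply: Rlin.
  by move=> _ [w ->]; exists (fw w v'); rewrite /R -fw_prod; apply: hw_span_fw.
have Rsurj b : exists a, R a b.
  have := SN b; apply: (@lspan_min _ _ _ (fun b => exists a, R a b)).
    split; first by exists 0.
    by move=> c x y [a Ra] [a' Ra']; exists (c *: a + a'); apply: Rlin.
  by move=> _ [w ->]; exists (fw w v); rewrite /R -fw_prod; apply: hw_span_fw.
have R0l b : R 0 b -> b = 0.
  have UM : submodule (R 0).
    split=> // [c x y Rx Ry|x y Rx].
      by have := Rlin c _ _ _ _ Rx Ry; rewrite scaler0 addr0.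
    by have := Ract x _ _ Rx; rewrite act0r.
  have := submodule_graded (span_integral hv' SN) (span_weight_parity hv' SN) UM.
  case/(iN.2) => [H|H]; first exact: H.
  have w0 : has_weight ((0, v') : P) l.
    by case: wv' => b1 b2 b3; split; congr (_, _); rewrite //= act0r scaler0.
  have [c [c1 c2]] := hw_span_top zeta1 wp (H v') w0.
  case: v'0; rewrite c2; move/esym/eqP: c1; rewrite scaler_eq0.
  by case/orP=> /eqP // ->; rewrite scale0r.
have R0r a : R a 0 -> a = 0.
  have UM : submodule (R^~ 0).
    split=> // [c x y Rx Ry|x y Rx].
      by have := Rlin c _ _ _ _ Rx Ry; rewrite scaler0 addr0.
    by have := Ract x _ _ Rx; rewrite act0r.
  have := submodule_graded (span_integral hv SM) (span_weight_parity hv SM) UM.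
  case/(iM.2) => [H|H]; first exact: H.
  have w0 : has_weight ((v, 0) : P) l.
    by case: wv => b1 b2 b3; split; congr (_, _); rewrite //= act0r scaler0.
  have [c [c1 c2]] := hw_span_top zeta1 wp (H v) w0.
  case: v0; rewrite c1; move/esym/eqP: c2; rewrite scaler_eq0.
  by case/orP=> /eqP // ->; rewrite scale0r.
have Rfun a b b' : R a b -> R a b' -> b = b'.
  move=> Rb Rb'; apply/esym/subr0_eq/R0l; have := Rlin (-1) _ _ _ _ Rb Rb'.
  by rewrite !scaleN1r addNr addrC.
have Rinj a a' b : R a b -> R a' b -> a = a'.
  move=> Ra Ra'; apply/esym/subr0_eq/R0r; have := Rlin (-1) _ _ _ _ Ra Ra'.
  by rewrite !scaleN1r addNr addrC.
have [phi phiP] := choice Rtot.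
have [psi psiP] := choice Rsurj.
have phil : linear phi.
  by move=> c a a'; apply: Rfun (phiP _) _; apply: Rlin.
pose L := GRing.isLinear.Build _ _ _ _ phi phil.
pose phiL : {linear M -> N} := HB.pack phi L.
exists phiL; first by move=> x a; apply: Rfun (phiP _) _; apply: Ract.
exists psi => a; first exact: Rinj (psiP _) (phiP a).
exact: Rfun (phiP _) (psiP a).
Qed.

Lemma is_L_unique (M N : module) l : is_L l M -> is_L l N -> isomorphic M N.
Proof.
move=> LM LN; have [v hv] := is_L_hwv LM; have [v' hv'] := is_L_hwv LN.
by apply: irreducible_unique hv hv'; [case: LM | case: LN].
Qed.

End HighestWeight.

(** * Simple objects of the category O *)

Section Spans.
Variables (K : fieldType) (V : lmodType K).
Implicit Types (s : seq V) (v : V).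

Lemma in_span_subspace s : subspace (in_span s).
Proof.
split; first by exists (fun=> 0); rewrite big1 // => i _; rewrite scale0r.
move=> c _ _ [a ->] [b ->]; exists (fun i => c * a i + b i).
by rewrite scaler_sumr -big_split; apply: eq_bigr => i _; rewrite scalerDl scalerA.
Qed.

Lemma in_spanP s v : in_span s v <-> lspan (fun u => u \in s) v.
Proof.
split=> [[c ->]|].
  apply: (subspace_sum _ (lspan_subspace _)) => i _.
  by apply: subspaceZ => //; apply: lspan_gen; apply: mem_nth.
apply: lspan_min; first exact: in_span_subspace.
move=> u us; exists (fun i => (i == index u s)%:R).
have i0 : (index u s < size s)%N by rewrite index_mem.
rewrite (bigD1 (Ordinal i0)) //= eqxx scale1r nth_index // big1 ?addr0 // => i.
by rewrite -val_eqE /= => /negbTE->; rewrite scale0r.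
Qed.

Lemma span_dependent s (x : nat -> V) : (forall i, in_span s (x i)) ->
  exists d : 'rV[K]_(size s).+1, d != 0 /\ \sum_i d 0 i *: x i = 0.
Proof.
move=> /choice[c xE]; set n := size s.
pose C : 'M[K]_(n.+1, n) := \matrix_(i, j) c i j.
have kC : kermx C != 0.
  by rewrite kermx_eq0 -row_leq_rank -ltnNge ltnS rank_leq_col.
exists (nz_row (kermx C)); rewrite nz_row_eq0; split=> //.
have : (nz_row (kermx C) <= kermx C)%MS by rewrite nz_row_sub.
move/sub_kermxP; set d := nz_row _ => dC.
under eq_bigr do rewrite xE scaler_sumr.
rewrite exchange_big big1 // => j _.
under eq_bigr do rewrite scalerA.
rewrite -scaler_suml; have := congr1 (fun A : 'rV_n => A 0 j) dC; rewrite !mxE.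
under eq_bigr do rewrite mxE.
by move=> ->; rewrite scale0r.
Qed.

End Spans.

Lemma in_span_map (K : fieldType) (V W : lmodType K) (phi : {linear V -> W}) s w :
  in_span (map phi s) w <-> exists2 v, in_span s v & w = phi v.
Proof.
rewrite in_spanP; split=> [|[v /in_spanP vs ->]].
  apply: (@lspan_min _ _ _ (fun w => exists2 v, in_span s v & w = phi v)).
    split; first by exists 0; [case: (in_span_subspace s) | rewrite linear0].
    move=> c _ _ [a sa ->] [b sb ->]; exists (c *: a + b); last by rewrite linearD linearZ.
    by case: (in_span_subspace s) => _; apply.
  by move=> _ /mapP[v vs ->]; exists v => //; apply/in_spanP/lspan_gen.
apply: (@lspan_min _ _ _ (fun v => lspan _ (phi v))) vs.
  split; first by rewrite linear0; apply: lspan0.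
  move=> c a b sa sb; rewrite linearD linearZ.
  by case: (lspan_subspace (fun u => u \in map phi s)) => _; apply.
by move=> u us; apply: lspan_gen; apply: map_f.
Qed.

Section CategoryO.
Variables (K : numFieldType) (zeta : K) (g : D21 zeta).
Hypothesis zeta1 : 1 + zeta != 0.
Local Notation e := (@D21_e K zeta g).
Local Notation h := (@D21_h K zeta g).
Local Notation module := (superModule g).

Lemma intertwining_weight (M N : module) (phi : {linear M -> N}) v l :
  intertwining phi -> has_weight v l -> has_weight (phi v) l.
Proof.
by move=> phiP [w1 w2 w3]; split; rewrite -phiP ?w1 ?w2 ?w3 linearZ.
Qed.

Lemma surjective_fg (M N : module) (phi : {linear M -> N}) : intertwining phi ->
  (forall w, exists v, phi v = w) -> finitely_generated M -> finitely_generated N.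
Proof.
move=> phiP sur [s sP]; exists (map phi s) => U UM Us w.
have [v <-] := sur w; apply: (sP (fun v => U (phi v))) => [|u us].
  case: UM => U0 UL UA; split=> [|c a b Ua Ub|x a Ua]; first by rewrite linear0.
    by rewrite linearD linearZ; apply: UL.
  by rewrite phiP; apply: UA.
by apply: Us; apply: map_f.
Qed.

Lemma surjective_integral (M N : module) (phi : {linear M -> N}) : intertwining phi ->
  (forall w, exists v, phi v = w) -> integral_weight_module M -> integral_weight_module N.
Proof.
move=> phiP sur Mi w; have [v <-] := sur w; have [s sP ->] := Mi v.
exists (map phi s); last by rewrite linear_sum big_map.
by move=> _ /mapP[u /sP[l wu] ->]; exists l; apply: intertwining_weight.
Qed.

Lemma surjective_locally_finite (M N : module) (phi : {linear M -> N}) : intertwining phi ->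
  (forall w, exists v, phi v = w) -> locally_finite_nplus M -> locally_finite_nplus N.
Proof.
move=> phiP sur Ml w; have [v <-] := sur w; have [s sv sP] := Ml v.
exists (map phi s); first by apply/in_span_map; exists v.
move=> x u xn /in_span_map[a sa ->]; apply/in_span_map.
by exists (act x a); [apply: sP | rewrite phiP].
Qed.

Lemma surjective_in_O (M N : module) (phi : {linear M -> N}) : intertwining phi ->
  (forall w, exists v, phi v = w) -> in_O M -> in_O N.
Proof.
move=> phiP sur [a b c]; split.
- exact: surjective_fg phiP sur a.
- exact: surjective_integral phiP sur b.
- exact: surjective_locally_finite phiP sur c.
Qed.

Lemma isomorphic_in_O (M N : module) : isomorphic M N -> in_O M -> in_O N.
Proof.
move=> [phi phiP [psi _ psiK]]; apply: surjective_in_O phiP _ => w.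
by exists (psi w).
Qed.

(** Any submodule of L is graded, hence trivial, so an irreducible
    subquotient of L inherits its highest weight vector. *)
Lemma is_L_subquotient (L S : module) l : is_L l L -> irreducible S ->
  subquotient S L -> is_L l S.
Proof.
move=> Ll [S0 Sirr] [N [iota [pi [iotaP piP iinj psur]]]].
have [v hv] := is_L_hwv zeta1 Ll; have [Lirr _] := Ll.
have SL := irreducible_span zeta1 Lirr hv.
have gr (U : L -> Prop) := submodule_graded (span_integral zeta1 hv SL)
  (span_weight_parity zeta1 hv SL) (U := U).
have S_nontriv (P : Prop) : (forall w : S, w = 0) -> P by move=> Z; case: S0 => w []; apply: Z.
have isur u : exists n, u = iota n.
  case: (Lirr.2 _ (gr _ (intertwining_image iotaP))) => [H|]; last exact.
  apply: S_nontriv => w; have [n <-] := psur w.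
  suff -> : n = 0 by rewrite linear0.
  by apply: iinj; rewrite linear0; apply: H; exists n.
have UM : submodule (fun u => exists n, u = iota n /\ pi n = 0).
  split=> [|c _ _ [a [-> a0]] [b [-> b0]]|x _ [a [-> a0]]].
  - by exists 0; rewrite !linear0.
  - by exists (c *: a + b); rewrite !linearD !linearZ a0 b0 /= scaler0 addr0.
  - by exists (act x a); rewrite iotaP piP a0 act0r.
have [n nE] := isur v; have [v0 wv [a av] ev] := hv.
have wn : has_weight n (l - rho).
  case: wv => w1 w2 w3; split; apply: iinj; rewrite linearZ iotaP -nE //.
split=> //; exists (pi n); split; last 1 first.
- move=> x xn; rewrite -piP.
  suff -> : act x n = 0 by rewrite linear0.
  by apply: iinj; rewrite iotaP -nE linear0; apply: (span_nplus zeta1 hv).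
- case: (Lirr.2 _ (gr _ UM)) => H p0.
    by apply: v0; apply: H; exists n.
  apply: S_nontriv => w; have [m <-] := psur w.
  by have [k [/iinj -> ->]] := H (iota m).
exact: intertwining_weight.
Qed.

Definition ew (M : module) (w : seq 'I_3) (v : M) := foldr (fun i => act (e i)) v w.

Lemma ew_weight (M : module) w (v : M) l : has_weight v l ->
  has_weight (ew w v) (l + wsum w).
Proof.
move=> wv; elim: w => [|i w IH]; first by rewrite /wsum big_nil addr0.
by rewrite wsum_cons [simple_root i + _]addrC addrA; apply: act_root IH; apply: has_root_e.
Qed.

Lemma ew_part (M : module) w (v : M) a : sm_part a v -> exists b, sm_part b (ew w v).
Proof.
move=> av; elim: w => [|i w [b IH]]; first by exists a.
by eexists; apply: act_part IH; apply: e_part.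
Qed.

Lemma distinct_weights_free (M : module) n (x : 'I_n -> M) (l : 'I_n -> weight)
    (d : 'I_n -> K) : injective l -> (forall i, has_weight (x i) (l i)) ->
  \sum_i d i *: x i = 0 -> forall i, d i *: x i = 0.
Proof.
move=> linj wx dx0 i.
pose u m := \sum_(j | l j == m) d j *: x j.
have uE j : u (l j) = d j *: x j.
  rewrite /u (bigD1 j) //= big1 ?addr0 // => k /andP[/eqP /linj ->].
  by rewrite eqxx.
rewrite -uE; apply: (weight_components (act_linearr (h_2delta g)) (act_linearr (h i1))
  (act_linearr (h i2)) (U := fun v => v = 0) (s := map l (enum 'I_n))) => //.
- by split=> // c a b -> ->; rewrite scaler0 addr0.
- by move=> _ ->; rewrite !act0r.
- by rewrite map_inj_uniq ?enum_uniq.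
- move=> _ /mapP[j _ ->]; rewrite uE; apply: (subspaceZ _ (has_weight_subspace _ _)).
  exact: wx.
- by rewrite big_map big_enum /= (eq_bigr (fun j => d j *: x j)).
- by apply: map_f; rewrite mem_enum.
Qed.

(** Words in the e_i raise the height, so the nonzero values of such words of
    different lengths on a weight vector are independent; local finiteness
    bounds the length, and a longest nonzero value is killed by all e_i. *)
Lemma simple_in_O_hwv (L : module) : simple_in_O L ->
  exists (v : L) l, hwv v l.
Proof.
move=> [[_ Li Ll] [[v1 v1n0] Lirr]].
have [u [l [u0 wu]]] : exists (u : L) l, u <> 0 /\ has_weight u l.
  apply: contrapT => H; apply: v1n0; have [s sP ->] := Li v1.
  rewrite big1_seq // => u /andP[_ us]; apply: contrapT => u0.
  by have [l wu] := sP _ us; apply: H; exists u, l.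
have [a [v [v0 wv av _]]] := weight_part wu u0.
have [s vs sP] := Ll v.
have ews w : in_span s (ew w v).
  by elim: w => //= i w IH; apply: sP => //; apply: in_nplus_e.
pose P m := exists w, size w = m /\ ew w v <> 0.
have Plow m : P m.+1 -> P m.
  case=> [[|i w] [//= [wm] w0]]; exists w; split=> // E.
  by apply: w0; rewrite E act0r.
have nP : ~ P (size s).
  move=> Ps; have Pall m : (m <= size s)%N -> P m.
    move=> ms; have -> : m = (size s - (size s - m))%N by rewrite subKn.
    elim: (size s - m)%N => [|k IH]; first by rewrite subn0.
    have [sk|sk] := leqP (size s) k; first by rewrite (_ : (size s - k.+1 = size s - k)%N) //; lia.
    by apply: Plow; rewrite (_ : ((size s - k.+1).+1 = size s - k)%N) //; lia.
  have /choice[w wP] : forall m, exists w, (m <= size s)%N -> size w = m /\ ew w v <> 0.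
    move=> m; have [ms|ms] := leqP m (size s); last by exists [::].
    by have [w ?] := Pall m ms; exists w.
  have [d [d0 dE]] := span_dependent (fun i => ews (w i)).
  have := distinct_weights_free (l := fun i : 'I_(size s).+1 => l + wsum (w i)) _ _ dE.
  case/(_ _ _)/Wrap => [i j /addrI E|i|H].
  - have := congr1 height E; rewrite !height_wsum.
    have [-> _] := wP i (ltn_ord i); have [-> _] := wP j (ltn_ord j).
    by move=> E'; apply: val_inj => /=; lia.
  - exact: ew_weight.
  - move/eqP: d0; apply; apply/rowP => i; rewrite mxE.
    have /eqP := H i; rewrite scaler_eq0 => /orP[/eqP //|/eqP].
    by have [_ ?] := wP i (ltn_ord i).
have [m [[w [wm w0]] nm]] : exists m, P m /\ ~ P m.+1.
  apply: contrapT => H; apply: nP; elim: (size s) => [|k IH]; first by exists [::].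
  by apply: contrapT => nk; apply: H; exists k.
exists (ew w v), (l + wsum w); split=> //.
- exact: ew_weight.
- exact: ew_part av.
- move=> i; apply: contrapT => wi; apply: nm; exists (i :: w).
  by rewrite /= wm.
Qed.

Lemma simple_in_O_is_L (L : module) : simple_in_O L -> exists l, is_L l L.
Proof.
move=> LO; have [v [l hv]] := simple_in_O_hwv LO; exists (l + rho).
by case: LO => _ Lirr; apply: (hwv_is_L zeta1 (v := v)) => //; rewrite addrK.
Qed.

End CategoryO.

(** * Submodules and quotient modules *)

Section SubSpace.
Variables (K : fieldType) (V : lmodType K) (P : V -> Prop).

Definition sub_pred of subspace P : {pred V} := fun x => `[< P x >].

Variable PS : subspace P.

Fact sub_pred_submod : submod_closed (sub_pred PS).
Proof.
case: (PS) => P0 PL; split=> [|c u v /asboolP Pu /asboolP Pv]; apply/asboolP => //.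
exact: PL.
Qed.
HB.instance Definition _ := GRing.isSubmodClosed.Build K V (sub_pred PS) sub_pred_submod.

Record sub_space := SubSpace {sub_val :> V; sub_valP : sub_val \in sub_pred PS}.

HB.instance Definition _ := [isSub for sub_val].
HB.instance Definition _ := [Choice of sub_space by <:].
HB.instance Definition _ := [SubChoice_isSubLmodule of sub_space by <:].

Lemma sub_val_linear : linear sub_val.
Proof. by []. Qed.
HB.instance Definition _ := GRing.isLinear.Build K sub_space V _ sub_val sub_val_linear.

Lemma sub_valPP (x : sub_space) : P (sub_val x).
Proof. exact/asboolP/(sub_valP x). Qed.

Lemma sub_val_inj : injective sub_val.
Proof. exact: val_inj. Qed.

Definition mk_sub x (Px : P x) : sub_space := SubSpace (asboolT Px : x \in sub_pred PS).
End SubSpace.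

Section SubModule.
Variables (K : fieldType) (g : lieSuperalgebra K) (M : superModule g) (P : M -> Prop).
Hypothesis PM : graded_submodule P.
Let PS : subspace P := submodule_subspace PM.1.
Let T := sub_space PS.

Fact sub_act_stable x (v : T) : P (act x (sub_val v)).
Proof. by case: PM => [[_ _ Pa] _]; apply/Pa/sub_valPP. Qed.

Definition sub_act (x : g) (v : T) : T := mk_sub PS (sub_act_stable x v).
Definition sub_part a (v : T) := sm_part a (sub_val v).

Lemma sub_act_linearr x : linear (sub_act x).
Proof. by move=> c u v; apply: sub_val_inj; rewrite linearP /= actDr actZr. Qed.
Lemma sub_act_linearl v : linear (sub_act^~ v).
Proof. by move=> c x y; apply: sub_val_inj; rewrite linearP /= actDl actZl. Qed.
Lemma sub_part0 a : sub_part a 0.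
Proof. by rewrite /sub_part linear0; apply: sm_part0. Qed.
Lemma sub_part_linear a c u v : sub_part a u -> sub_part a v ->
  sub_part a (c *: u + v).
Proof. by rewrite /sub_part linearP /=; apply: sm_part_linear. Qed.
Lemma sub_part_sum v : exists v0 v1,
  [/\ sub_part false v0, sub_part true v1 & v = v0 + v1].
Proof.
have [u0 [u1 [p0 p1 E]]] := sm_part_sum (sub_val v).
have Pv := sub_valPP v; rewrite E in Pv.
have P0 := PM.2 _ _ p0 p1 Pv.
have P1 : P u1 by have := subspaceB PS Pv P0; rewrite addrC addKr.
exists (mk_sub PS P0), (mk_sub PS P1); split=> //.
by apply: sub_val_inj; rewrite linearD /= E.
Qed.
Lemma sub_part_cap v : sub_part false v -> sub_part true v -> v = 0.
Proof. by move=> v0 v1; apply: sub_val_inj; rewrite linear0; apply: sm_part_cap. Qed.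
Lemma sub_act_part a b x v : x \in ls_part g a -> sub_part b v ->
  sub_part (a (+) b) (sub_act x v).
Proof. exact: act_part. Qed.
Lemma sub_act_brk a b x y v : x \in ls_part g a -> y \in ls_part g b ->
  sub_act (brk x y) v =
  sub_act x (sub_act y v) - (-1) ^+ (a && b) *: sub_act y (sub_act x v).
Proof.
move=> xa yb; apply: sub_val_inj; rewrite linearB linearZ /=.
by rewrite (act_brk _ xa yb) scalerN.
Qed.

Definition sub_module : superModule g :=
  SuperModule sub_act_linearr sub_act_linearl sub_part0 sub_part_linear
    sub_part_sum sub_part_cap sub_act_part sub_act_brk.

Definition sub_incl : {linear sub_module -> M} := @sub_val K M P PS.

Lemma sub_incl_intertwining : intertwining sub_incl.
Proof. by []. Qed.
Lemma sub_incl_inj : injective sub_incl.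
Proof. exact: sub_val_inj. Qed.
Lemma sub_inclP v : P (sub_incl v).
Proof. exact: sub_valPP. Qed.
Lemma sub_incl_onto v : P v -> exists u, sub_incl u = v.
Proof. by move=> Pv; exists (mk_sub PS Pv). Qed.

End SubModule.

Section QuotientSpace.
Local Open Scope quotient_scope.
Variables (K : fieldType) (V : lmodType K) (P : V -> Prop) (PS : subspace P).

Definition quo_space := Quotient.quot (sub_pred PS : zmodClosed V).
HB.instance Definition _ := GRing.Zmodule.on quo_space.

Definition quo_pi (v : V) : quo_space := \pi_(Quotient.quot (sub_pred PS : zmodClosed V)) v.

Lemma quo_pi_eq u v : quo_pi u = quo_pi v <-> P (u - v).
Proof.
split=> [/eqP|].
  rewrite /quo_pi -Quotient.idealrBE => /asboolP; exact.
by move=> /asboolP H; apply/eqP; rewrite /quo_pi -Quotient.idealrBE.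
Qed.

Lemma quo_pi_onto q : exists v, quo_pi v = q.
Proof. by exists (repr q); rewrite /quo_pi reprK. Qed.

Lemma quo_piD u v : quo_pi (u + v) = quo_pi u + quo_pi v.
Proof. exact: raddfD. Qed.

Definition quo_scale (c : K) (q : quo_space) : quo_space := quo_pi (c *: repr q).

Lemma quo_piZ c v : quo_pi (c *: v) = quo_scale c (quo_pi v).
Proof.
apply/quo_pi_eq; rewrite -scalerBr; apply: subspaceZ => //.
by apply/quo_pi_eq; rewrite /quo_pi reprK.
Qed.

Fact quo_scaleA a b v : quo_scale a (quo_scale b v) = quo_scale (a * b) v.
Proof.
by have [u <-] := quo_pi_onto v; rewrite -!quo_piZ scalerA.
Qed.
Fact quo_scale1 : left_id 1 quo_scale.
Proof. by move=> v; have [u <-] := quo_pi_onto v; rewrite -!quo_piZ scale1r. Qed.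
Fact quo_scaleDr : right_distributive quo_scale +%R.
Proof.
move=> c v w; have [u <-] := quo_pi_onto v; have [t <-] := quo_pi_onto w.
by rewrite -quo_piD -!quo_piZ scalerDr quo_piD.
Qed.
Fact quo_scaleDl v : {morph quo_scale^~ v : a b / a + b}.
Proof.
by move=> a b; have [u <-] := quo_pi_onto v; rewrite -!quo_piZ scalerDl quo_piD.
Qed.
HB.instance Definition _ := GRing.Zmodule_isLmodule.Build K quo_space
  quo_scaleA quo_scale1 quo_scaleDr quo_scaleDl.

Lemma quo_pi_linear : linear quo_pi.
Proof. by move=> c u v; rewrite quo_piD quo_piZ. Qed.
HB.instance Definition _ := GRing.isLinear.Build K V quo_space _ quo_pi quo_pi_linear.

End QuotientSpace.

Section QuotientModule.
Variables (K : fieldType) (g : lieSuperalgebra K) (M : superModule g) (P : M -> Prop).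
Hypothesis PM : graded_submodule P.
Let PS : subspace P := submodule_subspace PM.1.
Let Q := quo_space PS.
Local Notation pi := (@quo_pi K M P PS).

Definition quo_act (x : g) (q : Q) : Q := pi (act x (repr q)).
Definition quo_part a (q : Q) := exists2 v, sm_part a v & q = pi v.

Lemma quo_pi_act x v : quo_act x (pi v) = pi (act x v).
Proof.
apply/quo_pi_eq; rewrite -actNr -actDr; case: PM => [[_ _ Pa] _]; apply: Pa.
by apply/(quo_pi_eq PS); rewrite /quo_pi reprK.
Qed.

Lemma quo_act_linearr x : linear (quo_act x).
Proof.
move=> c u v; have [a <-] := quo_pi_onto u; have [b <-] := quo_pi_onto v.
by rewrite -linearP !quo_pi_act actDr actZr linearP.
Qed.
Lemma quo_act_linearl v : linear (quo_act^~ v).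
Proof.
move=> c x y; have [a <-] := quo_pi_onto v.
by rewrite !quo_pi_act actDl actZl linearP.
Qed.
Lemma quo_part0 a : quo_part a 0.
Proof. by exists 0; [apply: sm_part0 | rewrite linear0]. Qed.
Lemma quo_part_linear a c u v : quo_part a u -> quo_part a v ->
  quo_part a (c *: u + v).
Proof.
move=> [x px ->] [y py ->]; exists (c *: x + y); first exact: sm_part_linear.
by rewrite linearP.
Qed.
Lemma quo_part_sum v : exists v0 v1,
  [/\ quo_part false v0, quo_part true v1 & v = v0 + v1].
Proof.
have [u <-] := quo_pi_onto v; have [u0 [u1 [p0 p1 ->]]] := sm_part_sum u.
by exists (pi u0), (pi u1); split; [exists u0 | exists u1 | rewrite linearD].
Qed.
Lemma quo_part_cap v : quo_part false v -> quo_part true v -> v = 0.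
Proof.
move=> [u p0 ->] [w p1 /quo_pi_eq Puw]; rewrite -(linear0 pi); apply/quo_pi_eq.
rewrite subr0; apply: (PM.2 u (- w) p0 _ Puw).
by apply: (subspaceN (part_subspace M true)).
Qed.
Lemma quo_act_part a b x v : x \in ls_part g a -> quo_part b v ->
  quo_part (a (+) b) (quo_act x v).
Proof.
move=> xa [u pu ->]; exists (act x u); first exact: act_part.
exact: quo_pi_act.
Qed.
Lemma quo_act_brk a b x y v : x \in ls_part g a -> y \in ls_part g b ->
  quo_act (brk x y) v =
  quo_act x (quo_act y v) - (-1) ^+ (a && b) *: quo_act y (quo_act x v).
Proof.
move=> xa yb; have [u <-] := quo_pi_onto v.
by rewrite !quo_pi_act (act_brk _ xa yb) linearB linearZ.
Qed.

Definition quo_module : superModule g :=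
  SuperModule quo_act_linearr quo_act_linearl quo_part0 quo_part_linear
    quo_part_sum quo_part_cap quo_act_part quo_act_brk.

Definition quo_proj : {linear M -> quo_module} := pi.

Lemma quo_proj_intertwining : intertwining quo_proj.
Proof. by move=> x v; rewrite /= -quo_pi_act. Qed.
Lemma quo_proj_onto q : exists v, quo_proj v = q.
Proof. exact: quo_pi_onto. Qed.
Lemma quo_proj_eq u v : quo_proj u = quo_proj v <-> P (u - v).
Proof. exact: quo_pi_eq. Qed.
Lemma quo_proj0 u : quo_proj u = 0 <-> P u.
Proof. by rewrite -(linear0 quo_proj) quo_proj_eq subr0. Qed.

End QuotientModule.

(** * Operators on functions of words *)

Section Cofree.
Variables (K : numFieldType) (zeta : K) (g : D21 zeta).
Hypothesis zeta1 : 1 + zeta != 0.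
Local Notation e := (@D21_e K zeta g).
Local Notation f := (@D21_f K zeta g).
Local Notation h := (@D21_h K zeta g).
Local Notation part := (ls_part g).
Local Notation A := (D21_cartan_matrix zeta).
Variable l : weight.

(** The value of the weight m on the Cartan generator h_j. *)
Definition hval (j : 'I_3) (m : weight) : K :=
  nth 0 [:: 2^-1 * ((1 + zeta) * m.1.1%:~R + m.1.2%:~R + zeta * m.2%:~R);
            m.1.2%:~R; m.2%:~R] j.

Lemma hvalD j m n : hval j (m + n) = hval j m + hval j n.
Proof.
rewrite /hval; have [->|->|->] := I3_cases j; rewrite ?val_i1 ?val_i2 /= ?rmorphD //=.
by ring.
Qed.

Lemma hvalN j m : hval j (- m) = - hval j m.
Proof.
rewrite /hval; have [->|->|->] := I3_cases j; rewrite ?val_i1 ?val_i2 /= ?rmorphN //=.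
by ring.
Qed.

Lemma hval_simple j i : hval j (simple_root i) = A j i.
Proof.
rewrite cartanE /hval.
have [->|->|->] := I3_cases j; have [->|->|->] := I3_cases i;
  rewrite ?simple_root1 ?simple_root2 ?val_i1 ?val_i2 /=; try by field.
Qed.

Lemma h_root j (x : g) m : has_root x m -> brk (h j) x = hval j m *: x.
Proof.
move=> [w1 w2 w3]; rewrite /hval; have [->|->|->] := I3_cases j; last 2 first.
- by rewrite val_i1.
- by rewrite val_i2.
rewrite /= h0E // brkZl brkDl brkDl (brkZl (1 + zeta) x (h_2delta g)) (brkZl zeta).
rewrite w1 -/(h_2eps1 g) w2 -/(h_2eps2 g) w3.
by rewrite !scalerA -!scalerDl scalerA.
Qed.

Local Notation fn := (seq 'I_3 -> K^o).
Implicit Types (phi : fn) (T : fn -> fn).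

Definition Hop j phi : fn := fun w => hval j (l - wsum w) * phi w.
Definition Eop i phi : fn := fun w => phi (i :: w).
Definition sgn (i j : 'I_3) : K := (-1) ^+ ((i == ord0) && (j == ord0)).
(** Forced by (e_j (f_i phi))(w) = (f_i phi)(j w) and the commutation rule of
    e_j and f_i.  The value at the empty word is 0 since this word has weight l,
    and no function has the weight l + alpha_i that f_i would lower to l. *)
Fixpoint Fop i phi (w : seq 'I_3) {struct w} : K^o :=
  if w is j :: w' then
    sgn i j * Fop i (Eop j phi) w' + (i == j)%:R * Hop i phi w'
  else 0.

Lemma addE phi psi w : (phi + psi) w = phi w + psi w. Proof. by []. Qed.
Lemma oppE phi w : (- phi) w = - phi w. Proof. by []. Qed.
Lemma scaleE c phi w : (c *: phi) w = c * phi w. Proof. by []. Qed.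
Definition fnE := (addE, oppE, scaleE).

Lemma Hop_linear j : linear (Hop j).
Proof. by move=> c u v; apply/funext => w; rewrite /Hop !fnE; ring. Qed.
Lemma Eop_linear j : linear (Eop j).
Proof. by move=> c u v; apply/funext => w; rewrite /Eop !fnE. Qed.
Lemma Fop_linear j : linear (Fop j).
Proof.
move=> c u v; apply/funext => w; elim: w u v => [|k w IH] u v.
  by rewrite !fnE /=; ring.
by rewrite !fnE /= Eop_linear IH Hop_linear !fnE; ring.
Qed.

Lemma HE_comm j i phi : Hop j (Eop i phi) - Eop i (Hop j phi) = A j i *: Eop i phi.
Proof.
apply/funext => w; rewrite !fnE /Hop /Eop wsum_cons !(hvalD, hvalN) hval_simple.
by ring.
Qed.

Lemma HF_comm j i phi : Hop j (Fop i phi) - Fop i (Hop j phi) = - A j i *: Fop i phi.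
Proof.
apply/funext => w; elim: w phi => [|k w IH] phi.
  by rewrite !fnE /Hop /=; ring.
have -> : (Hop j (Fop i phi) - Fop i (Hop j phi)) (k :: w) =
   Hop j (Fop i phi) (k :: w) - Fop i (Hop j phi) (k :: w) by [].
have := IH (Eop k phi); rewrite !fnE /Hop /= -/(Hop j phi).
have -> : Eop k (Hop j phi) = Hop j (Eop k phi) - A j k *: Eop k phi.
  by rewrite -HE_comm opprB addrC subrK.
rewrite (linB (Fop_linear i)) (linZ (Fop_linear i)) !fnE /Hop.
rewrite wsum_cons !(hvalD, hvalN) !hval_simple.
set X := Fop i (Eop k phi) w; set Y := Fop i (fun w => _) w => E.
have {E}-> : Y = hval j l * X - hval j (wsum w) * X + A j i * X.
  by rewrite -[LHS](subrK ((hval j l - hval j (wsum w)) * X)) -[Y - _]opprB E; ring.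
by have [->|_] := eqVneq i k => /=; ring.
Qed.

Lemma EF_comm i j phi : Eop i (Fop j phi) - sgn i j *: Fop j (Eop i phi) =
  if i == j then Hop i phi else 0.
Proof.
have sC : sgn j i = sgn i j by rewrite /sgn andbC.
apply/funext => w; rewrite !fnE {1}/Eop /= sC addrC addKr eq_sym.
by case: eqP => [->|_]; rewrite ?mul1r ?mul0r.
Qed.

Local Notation pair := (g * (fn -> fn))%type.
Implicit Types (P Q S : pair).

(** Brackets are computed at once in g and among the operators on functions:
    the pairs (x, T) record which operators arise from x by the same bracket
    expression in the generators. *)
Definition pbr (a b : bool) P Q : pair :=
  (brk P.1 Q.1, fun phi => P.2 (Q.2 phi) - (-1) ^+ (a && b) *: Q.2 (P.2 phi)).

Lemma pair2E c P Q phi : (c *: P + Q).2 phi = c *: P.2 phi + Q.2 phi.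
Proof. by []. Qed.
Lemma pair1E c P Q : (c *: P + Q).1 = c *: P.1 + Q.1.
Proof. by []. Qed.

Lemma pairZ2E c P phi : (c *: P).2 phi = c *: P.2 phi.
Proof. by []. Qed.
Lemma pairZ1E c P : (c *: P).1 = c *: P.1.
Proof. by []. Qed.
Lemma pbr1E a b P Q : (pbr a b P Q).1 = brk P.1 Q.1. Proof. by []. Qed.
Lemma pbr2E a b P Q phi :
  (pbr a b P Q).2 phi = P.2 (Q.2 phi) - (-1) ^+ (a && b) *: Q.2 (P.2 phi).
Proof. by []. Qed.

Lemma pair_ext P Q : P.1 = Q.1 -> (forall phi, P.2 phi = Q.2 phi) -> P = Q.
Proof. by case: P Q => [x T] [y T'] /= -> H; congr (_, _); apply/funext. Qed.

Definition eP i : pair := (e i, Eop i).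
Definition fP i : pair := (f i, Fop i).
Definition hP i : pair := (h i, Hop i).

(** x has root m and T shifts weights by m. *)
Definition homog (m : weight) P :=
  [/\ has_root P.1 m, linear P.2 & forall j phi,
      Hop j (P.2 phi) - P.2 (Hop j phi) = hval j m *: P.2 phi].

Lemma homog_part m P : homog m P -> P.1 \in part (root_parity m).
Proof. by case=> w _ _; apply: root_part. Qed.

Lemma homog_e i : homog (simple_root i) (eP i).
Proof.
split; [exact: has_root_e | exact: Eop_linear | move=> j phi].
by rewrite HE_comm hval_simple.
Qed.
Lemma homog_f i : homog (- simple_root i) (fP i).
Proof.
split; [exact: has_root_f | exact: Fop_linear | move=> j phi].
by rewrite HF_comm hvalN hval_simple.
Qed.
Lemma homog_h i : homog 0 (hP i).
Proof.
split; [exact: has_root_h | exact: Hop_linear | move=> j phi].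
apply/funext => w; rewrite !fnE /= /Hop.
have -> : hval j 0 = 0 by apply: (addrI (hval j 0)); rewrite -hvalD !addr0.
by ring.
Qed.

Lemma homog_subspace m : subspace (homog m).
Proof.
split.
  split=> [|c u v|j phi]; first by case: (has_root_subspace g m).
    by rewrite /= scaler0 addr0.
  have Z psi v : ((0 : pair).2 psi) v = 0 by [].
  by apply/funext => w; rewrite !fnE /Hop !Z; ring.
move=> c P Q [rP lP hP'] [rQ lQ hQ]; split.
- by case: (has_root_subspace g m) => _; apply.
- move=> d u v; apply/funext => w; rewrite !pair2E lP lQ.
  by rewrite !fnE; ring.
move=> j phi; rewrite !pair2E.
rewrite scalerDr [hval j m *: (c *: _)]scalerA mulrC -scalerA -hP' -hQ.
rewrite (linD (Hop_linear j)) (linZ (Hop_linear j)).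
by apply/funext => w; rewrite !fnE; ring.
Qed.

Lemma homog_pbr m n P Q : homog m P -> homog n Q ->
  homog (m + n) (pbr (root_parity m) (root_parity n) P Q).
Proof.
move=> [rP lP HP] [rQ lQ HQ]; split; first exact: has_root_brk.
  move=> c u v; rewrite /= lQ lP lP lQ.
  by apply/funext => w; rewrite !fnE; ring.
move=> j phi; rewrite /= (linB (Hop_linear j)) (linZ (Hop_linear j)).
have E R k psi : homog k R -> Hop j (R.2 psi) = R.2 (Hop j psi) + hval j k *: R.2 psi.
  by case=> _ _ HR; rewrite -HR addrC subrK.
rewrite (E P m) // (E Q n) // (E Q n) // (E P m) //.
rewrite (linD lP) (linZ lP) (linD lQ) (linZ lQ) hvalD.
by apply/funext => w; rewrite !fnE; ring.
Qed.

Lemma pbr_linearr a b m P : homog m P -> linear (pbr a b P).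
Proof.
move=> [_ lP _] c Q S; apply: pair_ext => [|phi].
  by rewrite pair1E !pbr1E pair1E brkDr brkZr.
rewrite pair2E !pbr2E !pair2E lP.
by apply/funext => w; rewrite !fnE; ring.
Qed.

Lemma pbr_linearl a b n Q : homog n Q -> linear (fun P => pbr a b P Q).
Proof.
move=> [_ lQ _] c P S; apply: pair_ext => [|phi].
  by rewrite pair1E !pbr1E pair1E brkDl brkZl.
rewrite pair2E !pbr2E !pair2E lQ.
by apply/funext => w; rewrite !fnE; ring.
Qed.

Lemma pbr_jacobi m n k P Q S (a := root_parity m) (b := root_parity n) (c := root_parity k) :
  homog m P -> homog n Q -> homog k S ->
  pbr a (b (+) c) P (pbr b c Q S) =
  pbr (a (+) b) c (pbr a b P Q) S +
  (-1) ^+ (a && b) *: pbr b (a (+) c) Q (pbr a c P S).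
Proof.
move=> hP' hQ hS; have pP := homog_part hP'; have pQ := homog_part hQ.
rewrite addrC; apply: pair_ext => [|phi].
  by rewrite pair1E !pbr1E (brk_jacobi _ pP pQ) addrC.
case: hP' hQ hS => _ lP _ [_ lQ _] [_ lS _].
rewrite pair2E !pbr2E.
rewrite !(linB lP) !(linB lQ) !(linB lS) !(linZ lP) !(linZ lQ) !(linZ lS).
by apply/funext => w; rewrite !fnE; move: a b c => [] [] [] /=; ring.
Qed.

Lemma pbr_skew m n P Q (a := root_parity m) (b := root_parity n) :
  homog m P -> homog n Q -> pbr a b P Q = - (-1) ^+ (a && b) *: pbr b a Q P.
Proof.
move=> hP' hQ; have pP := homog_part hP'; have pQ := homog_part hQ.
apply: pair_ext => [|phi]; first by rewrite pairZ1E !pbr1E (brk_skew pP pQ) scaleNr.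
rewrite pairZ2E !pbr2E.
by apply/funext => w; rewrite !fnE; move: a b => [] [] /=; ring.
Qed.

Lemma pbr_h j m P : homog m P -> pbr false (root_parity m) (hP j) P = hval j m *: P.
Proof.
case=> rP _ HP; apply: pair_ext => [|phi]; first exact: h_root.
by rewrite pbr2E pairZ2E /= expr0 scale1r HP.
Qed.

Lemma par_simple i : root_parity (simple_root i) = (i == ord0).
Proof. by have [->|->|->] := I3_cases i; rewrite ?simple_root1 ?simple_root2 ?I3E. Qed.
Lemma root_parityN m : root_parity (- m) = root_parity m.
Proof. by rewrite /root_parity /= abszN. Qed.

Lemma pbr_ef i j : pbr (i == ord0) (j == ord0) (eP i) (fP j) = if i == j then hP i else 0.
Proof.
rewrite /pbr /= e_f; case: eqP (EF_comm i j) => [->|_] E.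
  by congr (_, _); apply/funext => phi; have := E phi; rewrite /sgn.
by congr (_, _); apply/funext => phi; have := E phi; rewrite /sgn.
Qed.

End Cofree.

(** * Triangular decomposition of the bracket expressions *)

Section Triangular.
Variables (K : numFieldType) (zeta : K) (g : D21 zeta).
Hypothesis zeta1 : 1 + zeta != 0.
Variable l : weight.
Local Notation fn := (seq 'I_3 -> K^o).
Local Notation pair := (g * (fn -> fn))%type.
Local Notation hP := (hP g l).
Local Notation eP := (eP g).
Local Notation fP := (fP g l).
Local Notation homog := (homog l).
Implicit Types (P Q S : pair) (phi : fn).

Section OneSide.
Variables (x y : 'I_3 -> pair) (rx ry : 'I_3 -> weight).
Hypotheses (hx : forall i, homog (rx i) (x i)) (hy : forall i, homog (ry i) (y i))
  (px : forall i, root_parity (rx i) = (i == ord0))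
  (py : forall i, root_parity (ry i) = (i == ord0))
  (xy0 : forall i j, i != j -> pbr (i == ord0) (j == ord0) (x i) (y j) = 0)
  (xyh : forall i, exists c, pbr (i == ord0) (i == ord0) (x i) (y i) = c *: hP i)
  (rxy : forall i, rx i + ry i = 0).

Definition ysum (w : seq 'I_3) : weight := \sum_(i <- w) ry i.
Fixpoint nest (w : seq 'I_3) : pair :=
  match w with
  | [::] => 0
  | [:: j] => y j
  | j :: w' => pbr (j == ord0) (root_parity (ysum w')) (y j) (nest w')
  end.

Lemma ysum_cons i w : ysum (i :: w) = ry i + ysum w.
Proof. by rewrite /ysum big_cons. Qed.

Lemma homog_nest w : homog (ysum w) (nest w).
Proof.
elim: w => [|j [|k w] IH]; first by case: (homog_subspace g l (ysum [::])).
  by rewrite ysum_cons {1}/ysum big_nil addr0; apply: hy.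
by rewrite ysum_cons /= -py; apply: homog_pbr.
Qed.

(** Iterated brackets of the y_j and the Cartan generators: one half of the
    triangular decomposition. *)
Definition low_gen m P := (exists w, [/\ w <> [::], ysum w = m & P = nest w]) \/
  (m = 0 /\ exists i, P = hP i).
Definition low m := lspan (low_gen m).

Lemma low_homog m P : low m P -> homog m P.
Proof.
apply: lspan_min; first exact: homog_subspace.
move=> Q [[w [_ <- ->]]|[-> [i ->]]]; first exact: homog_nest.
exact: homog_h.
Qed.

Lemma low_y j m Q : low m Q -> low (ry j + m) (pbr (j == ord0) (root_parity m) (y j) Q).
Proof.
have L := pbr_linearr (j == ord0) (root_parity m) (hy j).
apply: (@lspan_min _ _ _ (fun Q => low (ry j + m) (pbr (j == ord0) (root_parity m) (y j) Q))).
  split; first by rewrite (lin0 L); apply: lspan0.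
  by move=> c u v Lu Lv; rewrite L; case: (lspan_subspace (low_gen (ry j + m))) => _; apply.
move=> S [[w [w0 <- ->]]|[-> [i ->]]].
  apply: lspan_gen; left; exists (j :: w); split=> //; first by rewrite ysum_cons.
  by case: w w0.
have := pbr_skew zeta1 (hy j) (homog_h g l i); rewrite py => ->.
rewrite andbF; have := pbr_h zeta1 i (hy j); rewrite py => ->.
apply: subspaceZ; first exact: lspan_subspace.
apply: subspaceZ; first exact: lspan_subspace.
apply: lspan_gen; left; exists [:: j]; split=> //.
by rewrite /ysum big_seq1 addr0.
Qed.

(** Bracketing with x_i either shortens the iterated bracket or falls into the
    Cartan generators, by the Jacobi identity and the relation between x_i and
    the y_j. *)
Lemma low_x i w : w <> [::] ->
  low (rx i + ysum w) (pbr (i == ord0) (root_parity (ysum w)) (x i) (nest w)).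
Proof.
elim: w => [//|j w IH] _; case: w IH => [|k w] IH.
  rewrite [nest _]/= /ysum big_seq1 py.
  have [->|ij] := eqVneq i j; last by rewrite (xy0 ij); apply: lspan0.
  have [c ->] := xyh j; apply: subspaceZ; first exact: lspan_subspace.
  by apply: lspan_gen; right; split; [rewrite rxy | exists j].
set w' := k :: w; rewrite -/w' in IH; have w'0 : w' <> [::] by [].
have {}IH := IH w'0.
have -> : nest (j :: w') = pbr (j == ord0) (root_parity (ysum w')) (y j) (nest w') by [].
have := pbr_jacobi zeta1 (hx i) (hy j) (homog_nest w').
rewrite px py ysum_cons root_parityD py => ->.
apply: subspaceD; first exact: lspan_subspace; last first.
  apply: subspaceZ; first exact: lspan_subspace.
  by have := low_y j IH; rewrite root_parityD px addrCA.
have [->|ij] := eqVneq i j; last first.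
  rewrite (xy0 ij) (lin0 (pbr_linearl _ _ (homog_nest w'))); exact: lspan0.
have [c ->] := xyh j; rewrite (linZ (pbr_linearl _ _ (homog_nest w'))).
rewrite addbb (pbr_h zeta1 j (homog_nest w')) addrA rxy add0r.
apply: subspaceZ; first exact: lspan_subspace.
apply: subspaceZ; first exact: lspan_subspace.
by apply: lspan_gen; left; exists w'.
Qed.

End OneSide.

(** The pairs (x, T) of weight m obtained from the generators (e_i, E_i),
    (f_i, F_i).  Several operators T may belong to the same x, as the operators
    E_i satisfy no relations. *)
Inductive oprel : weight -> pair -> Prop :=
| rel_e i : oprel (simple_root i) (eP i)
| rel_f i : oprel (- simple_root i) (fP i)
| rel_0 m : oprel m 0
| rel_lin c m P Q : oprel m P -> oprel m Q -> oprel m (c *: P + Q)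
| rel_br m n P Q : oprel m P -> oprel n Q ->
    oprel (m + n) (pbr (root_parity m) (root_parity n) P Q).

Lemma rel_homog m P : oprel m P -> homog m P.
Proof.
elim=> {m P} [i|i|m|c m P Q _ IP _ IQ|m n P Q _ IP _ IQ].
- exact: homog_e.
- exact: homog_f.
- by case: (homog_subspace g l m).
- by case: (homog_subspace g l m) => _; apply.
- exact: homog_pbr.
Qed.

Lemma rel_h i : oprel 0 (hP i).
Proof.
have := rel_br (rel_e i) (rel_f i); rewrite root_parityN par_simple pbr_ef.
by rewrite eqxx subrr.
Qed.

Local Notation low_e := (low eP simple_root).
Local Notation low_f := (low fP (fun i => - simple_root i)).

Definition tri_gen m P := low_gen eP simple_root m P \/
  low_gen fP (fun i => - simple_root i) m P.
Definition tri m := lspan (tri_gen m).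

Lemma tri_homog m P : tri m P -> homog m P.
Proof.
apply: lspan_min; first exact: homog_subspace.
move=> Q [] H; [apply: (low_homog (y := eP) (ry := simple_root)) |
  apply: (low_homog (y := fP) (ry := fun i => - simple_root i))]; try exact: lspan_gen.
- exact: homog_e.
- exact: par_simple.
- exact: homog_f.
- by move=> i; rewrite root_parityN par_simple.
Qed.

Lemma low_e_tri m P : low_e m P -> tri m P.
Proof. by apply: lspan_mono => Q H; apply: lspan_gen; left. Qed.
Lemma low_f_tri m P : low_f m P -> tri m P.
Proof. by apply: lspan_mono => Q H; apply: lspan_gen; right. Qed.

Lemma pbr_fe i j : pbr (i == ord0) (j == ord0) (fP i) (eP j) =
  if i == j then - (-1) ^+ (i == ord0) *: hP i else 0.
Proof.
have := pbr_skew zeta1 (homog_f g zeta1 l i) (homog_e g zeta1 l j).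
rewrite root_parityN !par_simple => ->; rewrite pbr_ef [j == i]eq_sym.
by have [->|_] := eqVneq i j; rewrite ?andbb // scaler0.
Qed.

(** P belongs to the normalizer of the triangular subspace. *)
Definition normalizes m P := homog m P /\ forall n Q, tri n Q ->
  tri (m + n) (pbr (root_parity m) (root_parity n) P Q).

Lemma normalizes_e i : normalizes (simple_root i) (eP i).
Proof.
split=> [|n Q]; first exact: homog_e; rewrite par_simple.
apply: lspan_linear => [||S [H|[[w [w0 <- ->]]|[-> [k ->]]]]].
- exact: pbr_linearr (homog_e g zeta1 l i).
- exact: lspan_subspace.
- apply: low_e_tri; apply: low_y (lspan_gen H).
  + exact: homog_e.
  + exact: par_simple.
- apply: low_f_tri; apply: low_x => //.
  + exact: homog_e.
  + exact: homog_f.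
  + exact: par_simple.
  + by move=> j; rewrite root_parityN par_simple.
  + by move=> j k /negbTE jk; rewrite pbr_ef jk.
  + by move=> j; exists 1; rewrite pbr_ef eqxx scale1r.
  + by move=> j; rewrite subrr.
- apply: low_e_tri; apply: low_y.
  + exact: homog_e.
  + exact: par_simple.
  + by apply: lspan_gen; right; split=> //; exists k.
Qed.

Lemma normalizes_f i : normalizes (- simple_root i) (fP i).
Proof.
split=> [|n Q]; first exact: homog_f; rewrite root_parityN par_simple.
apply: lspan_linear => [||S [[[w [w0 <- ->]]|[-> [k ->]]]|H]].
- exact: pbr_linearr (homog_f g zeta1 l i).
- exact: lspan_subspace.
- apply: low_e_tri; apply: (low_x (rx := fun i => - simple_root i)) => //.
  + exact: homog_f.
  + exact: homog_e.
  + by move=> j; rewrite root_parityN par_simple.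
  + exact: par_simple.
  + by move=> j k /negbTE jk; rewrite pbr_fe jk.
  + by move=> j; exists (- (-1) ^+ (j == ord0)); rewrite pbr_fe eqxx.
  + by move=> j; rewrite addNr.
- apply: low_f_tri; apply: (low_y (ry := fun i => - simple_root i)).
  + exact: homog_f.
  + by move=> j; rewrite root_parityN par_simple.
  + by apply: lspan_gen; right; split=> //; exists k.
- apply: low_f_tri; apply: (low_y (ry := fun i => - simple_root i)) (lspan_gen H).
  + exact: homog_f.
  + by move=> j; rewrite root_parityN par_simple.
Qed.

Lemma rel_normalizes m P : oprel m P -> normalizes m P.
Proof.
move=> rP; split; first exact: rel_homog.
elim: rP => {m P} [i|i|m|c m P Q rP IP rQ IQ|m n P Q rP IP rQ IQ] k S tS.
- by case: (normalizes_e i) => _; apply.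
- by case: (normalizes_f i) => _; apply.
- by rewrite (lin0 (pbr_linearl _ _ (tri_homog tS))); apply: lspan0.
- rewrite (pbr_linearl _ _ (tri_homog tS)).
  by case: (lspan_subspace (tri_gen (m + k))) => _; apply; [apply: IP | apply: IQ].
have := pbr_jacobi zeta1 (rel_homog rP) (rel_homog rQ) (tri_homog tS).
move/eqP; rewrite -subr_eq -!root_parityD => /eqP <-.
apply: subspaceB; first exact: lspan_subspace.
  by rewrite -addrA; apply: IP; apply: IQ.
apply: subspaceZ; first exact: lspan_subspace.
by rewrite [m + n]addrC -addrA; apply: IQ; apply: IP.
Qed.

(** Every bracket expression is a combination of brackets in the e_i only, in
    the f_i only, and of Cartan elements: the space of these is stable under
    the generators, hence under all bracket expressions by the Jacobi
    identity. *)
Lemma rel_tri m P : oprel m P -> tri m P.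
Proof.
elim=> {m P} [i|i|m|c m P Q rP IP rQ IQ|m n P Q rP IP rQ IQ].
- apply: lspan_gen; left; left; exists [:: i]; split=> //.
  by rewrite /ysum big_seq1.
- apply: lspan_gen; right; left; exists [:: i]; split=> //.
  by rewrite /ysum big_seq1.
- exact: lspan0.
- by case: (lspan_subspace (tri_gen m)) => _; apply.
- by case: (rel_normalizes rP) => _; apply.
Qed.

End Triangular.

Lemma wsum1 w : (wsum w).1.1 = (count_mem ord0 w)%:Z.
Proof.
elim: w => [|k w IH]; first by rewrite /wsum big_nil.
rewrite wsum_cons /= IH.
by have [->|->|->] := I3_cases k; rewrite ?simple_root1 ?simple_root2 ?eqxx ?I3E /=; lia.
Qed.
Lemma wsum2 w : (wsum w).1.2 = 2 * (count_mem i1 w)%:Z - (count_mem ord0 w)%:Z.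
Proof.
elim: w => [|k w IH]; first by rewrite /wsum big_nil.
rewrite wsum_cons /= IH.
by have [->|->|->] := I3_cases k; rewrite ?simple_root1 ?simple_root2 ?eqxx ?I3E /=; lia.
Qed.
Lemma wsum3 w : (wsum w).2 = 2 * (count_mem i2 w)%:Z - (count_mem ord0 w)%:Z.
Proof.
elim: w => [|k w IH]; first by rewrite /wsum big_nil.
rewrite wsum_cons /= IH.
by have [->|->|->] := I3_cases k; rewrite ?simple_root1 ?simple_root2 ?eqxx ?I3E /=; lia.
Qed.

Lemma size_count3 (w : seq 'I_3) :
  size w = (count_mem ord0 w + count_mem i1 w + count_mem i2 w)%N.
Proof.
elim: w => //= k w ->.
by have [->|->|->] := I3_cases k; rewrite ?eqxx ?I3E /=; lia.
Qed.

(** Simple roots are linearly independent, so m alpha_i is the sum of the word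
    i^m only. *)
Lemma wsum_nseq w i j : wsum w = wsum (nseq j i) -> w = nseq j i.
Proof.
move=> E; have sz : size w = j.
  by have := congr1 height E; rewrite !height_wsum size_nseq; lia.
have c : count_mem i w = size w.
  rewrite sz -[RHS](size_nseq j i) size_count3.
  have := congr1 (fun l : weight => l.1.1) E.
  have := congr1 (fun l : weight => l.1.2) E.
  have := congr1 (fun l : weight => l.2) E.
  rewrite !wsum1 !wsum2 !wsum3 !count_nseq.
  by have [->|->|->] := I3_cases i; rewrite /= ?eqxx ?I3E /=; lia.
by move: c => /eqP; rewrite -all_count => /all_pred1P ->; rewrite sz.
Qed.

Section Delta.
Variables (K : numFieldType) (zeta : K) (g : D21 zeta).
Hypothesis zeta1 : 1 + zeta != 0.
Variable l : weight.
Local Notation e := (@D21_e K zeta g).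
Local Notation h := (@D21_h K zeta g).
Local Notation fn := (seq 'I_3 -> K^o).
Local Notation pair := (g * (fn -> fn))%type.
Local Notation hP := (hP g l).
Local Notation eP := (eP g).
Local Notation oprel := (@oprel K zeta g l).
Implicit Types (P Q S : pair) (phi : fn).

(** Projection onto the weights selected by p. *)
Definition res (p : weight -> bool) phi : fn :=
  fun w => if p (l - wsum w) then phi w else 0.

Lemma res_linear p : linear (res p).
Proof.
move=> c u v; apply/funext => w; rewrite !fnE /res.
by case: ifP => _; rewrite ?fnE ?mulr0 ?addr0.
Qed.

Lemma Eop_res i p phi : Eop i (res p phi) = res (fun s => p (s - simple_root i)) (Eop i phi).
Proof.
apply/funext => w; rewrite /Eop /res wsum_cons opprD addrA.
by rewrite addrAC.
Qed.

Lemma Hop_res i p phi : Hop zeta l i (res p phi) = res p (Hop zeta l i phi).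
Proof.
by apply/funext => w; rewrite /Hop /res; case: ifP; rewrite ?mulr0.
Qed.

Lemma Fop_res i p phi : Fop zeta l i (res p phi) =
  res (fun s => p (s + simple_root i)) (Fop zeta l i phi).
Proof.
apply/funext => w; elim: w p phi => [|k w IH] p phi; first by rewrite /res if_same.
rewrite [LHS]/= Eop_res IH Hop_res /res wsum_cons.
have -> : l - (simple_root k + wsum w) + simple_root i =
    l - wsum w + simple_root i - simple_root k.
  by rewrite opprD addrA [RHS]addrAC; congr (_ + _); rewrite addrAC.
rewrite /=; have [->|_] := eqVneq i k.
  by rewrite addrK /=; case: ifP => _; rewrite ?mulr0 ?addr0.
by case: ifP => _ /=; rewrite !mul0r ?addr0 ?mulr0.
Qed.

Lemma rel_res m P : oprel m P -> forall p phi,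
  P.2 (res p phi) = res (fun s => p (s - m)) (P.2 phi).
Proof.
elim=> {m P} [i|i|m|c m P Q rP IP rQ IQ|m n P Q rP IP rQ IQ] p phi.
- exact: Eop_res.
- rewrite [LHS]Fop_res; congr res; apply/funext => s; by rewrite opprK.
- by apply/funext => w; rewrite /res; case: ifP.
- by rewrite !pair2E IP IQ (res_linear _ c).
have L := res_linear (fun s => p (s - (m + n))).
rewrite !pbr2E (linB L) (linZ L) IQ IP IP IQ.
congr (res _ _ - _ *: res _ _); apply/funext => s; congr (p _).
  by rewrite opprD addrA.
by rewrite opprD addrA addrAC.
Qed.

Definition delta (w0 : seq 'I_3) : fn := fun w => (w == w0)%:R.

Lemma delta_res w0 : res (pred1 (l - wsum w0)) (delta w0) = delta w0.
Proof.
apply/funext => w; rewrite /res /delta /=.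
by have [->|_] := eqVneq w w0; rewrite ?eqxx // if_same.
Qed.

Lemma Eop_delta k i j : Eop k (delta (nseq j i)) =
  if (k == i) && (0 < j)%N then delta (nseq j.-1 i) else 0.
Proof.
apply/funext => w; rewrite /Eop /delta; case: j => [|j] /=.
  by rewrite andbF.
by rewrite eqseq_cons andbT; case: eqP.
Qed.

(** By the triangular decomposition, an expression of weight j alpha_i is a
    combination of Cartan elements if j = 0, a multiple of e_i if j = 1, and a
    multiple of an iterated bracket of e_i with itself otherwise, which vanishes
    when e_i is even; so no relation of g occurs in this weight.  For the odd
    e_0 the bracket [e_0, e_0] is nonzero among the operators, whence the bound
    on j. *)
Lemma rel_simple_multiple i j P : i != ord0 \/ (j <= 1)%N ->
  oprel (wsum (nseq j i)) P -> P.1 = 0 -> P = 0.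
Proof.
move=> ij rP; have tP := rel_tri zeta1 rP.
have Wne w : w <> [::] -> ysum simple_root w = wsum (nseq j i) -> w = nseq j i.
  by move=> _ E; apply: wsum_nseq.
have Fno w : w <> [::] -> ysum (fun i => - simple_root i) w <> wsum (nseq j i).
  move=> w0 E; have := congr1 height E.
  have -> : ysum (fun i => - simple_root i) w = - wsum w.
    by rewrite /ysum /wsum sumrN.
  rewrite heightN !height_wsum size_nseq; case: (w) w0 => //= a b _; lia.
case: j ij rP tP Wne Fno => [|j] ij rP tP Wne Fno.
  have : exists c0 c1 c2, P = c0 *: hP ord0 + c1 *: hP i1 + c2 *: hP i2.
    apply: (@lspan_min _ _ _ (fun P => exists c0 c1 c2, P = c0 *: hP ord0 + c1 *: hP i1 + c2 *: hP i2)) tP.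
      split; first by exists 0, 0, 0; rewrite !scale0r !addr0.
      move=> c u v [a0 [a1 [a2 ->]]] [b0 [b1 [b2 ->]]].
      exists (c * a0 + b0), (c * a1 + b1), (c * a2 + b2).
      by rewrite !scalerDr !scalerA !scalerDl addrACA; congr (_ + _); rewrite addrACA.
    have hin k : exists c0 c1 c2, hP k = c0 *: hP ord0 + c1 *: hP i1 + c2 *: hP i2.
      have [->|->|->] := I3_cases k.
      - by exists 1, 0, 0; rewrite !scale0r !addr0 scale1r.
      - by exists 0, 1, 0; rewrite !scale0r !addr0 scale1r add0r.
      - by exists 0, 0, 1; rewrite !scale0r !add0r scale1r.
    move=> Q [[[w [w0 E _]]|[_ [k ->]]]|[[w [w0 E _]]|[_ [k ->]]]] //.
      by case: (w0); apply: (Wne w).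
    by case: (Fno w w0).
  case=> c0 [c1 [c2 ->]] E.
  have fr := cartan_free g; have := fr; rewrite /cartan_basis => fr'.
  have {E} : c0 *: h ord0 + c1 *: h i1 + c2 *: h i2 = 0 by [].
  move=> E; have /freeP := fr; move=> /(_ (fun k : 'I_3 => nth 0 [:: c0; c1; c2] k)).
  rewrite !big_ord_recl big_ord0 /= addr0 addrA => /(_ E) H.
  have := H ord0; have := H (lift ord0 ord0); have := H (lift ord0 (lift ord0 ord0)).
  by move=> /= -> -> ->; rewrite !scale0r !addr0.
have h0 : (0 : weight) <> wsum (nseq j.+1 i).
  move=> E; have := congr1 height E; rewrite height_wsum size_nseq.
  by rewrite (_ : height 0 = 0) //; lia.
have : exists c, P = c *: nest eP simple_root (nseq j.+1 i).
  apply: (@lspan_min _ _ _ (fun P => exists c, P = c *: nest eP simple_root (nseq j.+1 i))) tP.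
    split; first by exists 0; rewrite scale0r.
    by move=> c u v [a ->] [b ->]; exists (c * a + b); rewrite scalerDl scalerA.
  move=> Q [[[w [w0 E ->]]|[E _]]|[[w [w0 E _]]|[E _]]].
  - by exists 1; rewrite scale1r (Wne w).
  - by case: h0.
  - by case: (Fno w w0).
  - by case: h0.
case=> c ->; case: j {rP tP Wne Fno h0} ij => [|j] ij.
  move=> E; have /eqP : c *: e i = 0 by [].
  by rewrite scaler_eq0 (negbTE (e_neq0 _ _)) orbF => /eqP ->; rewrite scale0r.
have ie : i != ord0 by case: ij.
suff -> : nest eP simple_root (nseq j.+2 i) = 0 :> pair by rewrite scaler0.
elim: j {ij} => [|j IH].
  rewrite /= /ysum big_seq1 par_simple (negbTE ie); apply: pair_ext => [|phi].
    have ep := e_part g i; rewrite (negbTE ie) in ep.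
    have /eqP := skewE ep ep isT; rewrite pbr1E -addr_eq0 -mulr2n -scaler_nat.
    by rewrite scaler_eq0 pnatr_eq0 => /eqP.
  by rewrite pbr2E expr0 scale1r subrr.
rewrite [nest _ _ _](_ : _ = pbr (i == ord0) (root_parity (ysum simple_root (nseq j.+2 i)))
  (eP i) (nest eP simple_root (nseq j.+2 i))) //.
by rewrite IH (lin0 (pbr_linearr _ _ (homog_e g zeta1 l i))).
Qed.

(** The value at a word k w is the value at w of e_k P phi.  Commuting e_k with
    P gives another relation and a term P (e_k phi), where e_k phi is an
    indicator of the same kind or 0.  At the empty word, weights reduce the
    claim to the weights j alpha_i. *)
Lemma rel0_delta i j m P : i != ord0 \/ (j <= 1)%N -> oprel m P -> P.1 = 0 ->
  P.2 (delta (nseq j i)) = 0.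
Proof.
move=> ij rP P0; apply/funext => w; elim: w j m P ij rP P0 => [|k w IH] j m P ij rP P0.
  have [mE|mE] := eqVneq m (wsum (nseq j i)).
    by rewrite mE in rP; rewrite (rel_simple_multiple ij rP P0).
  rewrite -delta_res (rel_res rP) /res /= /wsum big_nil subr0.
  case: eqP => // E; move: mE; rewrite -/(wsum _) in E.
  by move/eqP: E; rewrite (inj_eq (addrI l)) eqr_opp => ->.
have := IH j (simple_root k + m) (pbr (root_parity (simple_root k)) (root_parity m) (eP k) P) ij.
have rk := rel_br (rel_e g l k) rP.
rewrite pbr1E P0 brk0r => /(_ rk erefl); rewrite pbr2E fnE oppE scaleE.
have -> : P.2 ((eP k).2 (delta (nseq j i))) w = 0.
  rewrite /= Eop_delta; case: ifP => [_|_].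
    by apply: (IH _ m) => //; case: ij => [->|j1]; [left | right; case: (j) j1 => // [[]]].
  have [_ lP _] := rel_homog zeta1 rP.
  by rewrite (lin0 lP).
by rewrite mulr0 subr0.
Qed.

End Delta.

(** * The cofree module *)

Section CofreeModule.
Variables (K : numFieldType) (zeta : K) (g : D21 zeta).
Hypothesis zeta1 : 1 + zeta != 0.
Variable l : weight.
Local Notation f := (@D21_f K zeta g).
Local Notation part := (ls_part g).
Local Notation fn := (seq 'I_3 -> K^o).
Local Notation pair := (g * (fn -> fn))%type.
Local Notation oprel := (@oprel K zeta g l).
Local Notation res := (@res K l).
Implicit Types (P Q S : pair) (phi : fn).

Lemma gbasis_op y : y \in gbasis g -> exists T m, oprel m (y, T).
Proof.
apply: (@gbasis_ind _ _ g (fun y => exists T m, oprel m (y, T))) => [i|i|].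
- by exists (@Eop K i), (simple_root i); apply: (rel_e g l i).
- by exists (@Fop K zeta l i), (- simple_root i); apply: (rel_f g l i).
move=> a b x z _ _ [T [m xT]] [S [n zS]].
by exists (pbr (root_parity m) (root_parity n) (x, T) (z, S)).2, (m + n); apply: (rel_br xT zS).
Qed.

(** An operator is chosen for each basis element of g and extended linearly;
    root components of x use only basis elements of the same root. *)
Lemma exists_op : exists cofree_op : g -> fn -> fn, (forall phi, linear (cofree_op^~ phi)) /\
  forall m x, has_root x m -> oprel m (x, cofree_op x).
Proof.
set b := in_tuple (gbasis g).
have : forall i : 'I_(size (gbasis g)), exists T m, oprel m ((gbasis g)`_i, T).
  by move=> i; apply: gbasis_op; apply: mem_nth.
case/choice => T /choice[m Tm].
exists (fun x phi => \sum_i coord b i x *: T i phi); split.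
  move=> phi c x y; rewrite scaler_sumr -big_split; apply: eq_bigr => i _.
  by rewrite linearP scalerDl scalerA.
have fr := root_list_free (root_vectorsP g zeta1).
move=> n x nx.
pose cofree_op x phi := \sum_i coord b i x *: T i phi.
have TRlin phi c y z : cofree_op (c *: y + z) phi = c *: cofree_op y phi + cofree_op z phi.
  rewrite scaler_sumr -big_split; apply: eq_bigr => i _.
  by rewrite linearP scalerDl scalerA.
rewrite -[X in oprel n X]/(x, cofree_op x).
have H := lspan_proj (brk_linearr _) (brk_linearr _) (brk_linearr _) (l := n) _ (g_lspan zeta1 x) nx.
move: H; case/(_ _)/Wrap => [u /(gbasis_root zeta1)[l' _ ?]|]; first by exists l'.
apply: (@lspan_min _ _ _ (fun x => oprel n (x, cofree_op x))).
  split.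
    have -> : (0, cofree_op 0) = 0 :> pair.
      apply: pair_ext => // phi; exact: (lin0 (f := cofree_op^~ phi) (TRlin phi)).
    exact: rel_0.
  move=> c u v ru rv; have -> : (c *: u + v, cofree_op (c *: u + v)) = c *: (u, cofree_op u) + (v, cofree_op v) :> pair.
    by apply: pair_ext => // phi; rewrite pair2E; apply: TRlin.
  exact: rel_lin.
move=> y [yb ny]; have /(nthP 0)[i isz yE] := yb.
have TRy : cofree_op y = T (Ordinal isz).
  apply/funext => phi; rewrite /cofree_op (bigD1 (Ordinal isz)) //= -yE.
  rewrite (coord_free (X := b) (Ordinal isz) (Ordinal isz)) // eqxx scale1r.
  rewrite big1 ?addr0 // => j ji; rewrite (coord_free (X := b) (Ordinal isz) j) //.
  by rewrite eq_sym (negbTE ji) scale0r.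
have r := Tm (Ordinal isz); rewrite /= yE in r; rewrite TRy.
have [ry _ _] := rel_homog zeta1 r.
have y0 : y <> 0 by apply/eqP; apply: free_not0 fr yb.
by rewrite (has_root_uniq ny ry y0).
Qed.

Definition cofree_op : g -> fn -> fn := projT1 (cid exists_op).

Lemma cofree_op_linearl phi : linear (cofree_op^~ phi).
Proof. by rewrite /cofree_op; case: cid => T []. Qed.

Lemma cofree_op_rel m x : has_root x m -> oprel m (x, cofree_op x).
Proof. by rewrite /cofree_op; case: cid => T []; auto. Qed.

Lemma cofree_op_linear x : linear (cofree_op x).
Proof.
apply: (@lspan_min _ _ _ (fun x => linear (cofree_op x))) (g_lspan zeta1 x).
  split=> [c u v|c y z ly lz d u v].
    by rewrite !(lin0 (cofree_op_linearl _)) scaler0 addr0.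
  rewrite !cofree_op_linearl ly lz; apply/funext => w; rewrite !fnE; ring.
move=> y /(gbasis_root zeta1)[m _ ym] c u v.
by have [_ L _] := rel_homog zeta1 (cofree_op_rel ym); apply: L.
Qed.

Definition fin_supp phi := exists n, forall w, (n <= size w)%N -> phi w = 0.
(** The functions killed by the relations of g, that is by the operators T
    with (0, T) a bracket expression.  On them the operator of x depends on x
    only, which makes them a g-module. *)
Definition rel_invariant phi := forall m P, oprel m P -> P.1 = 0 -> P.2 phi = 0.
Definition in_cofree phi := fin_supp phi /\ rel_invariant phi.

Lemma fin_supp_subspace : subspace fin_supp.
Proof.
split; first by exists 0.
move=> c u v [n nu] [m mv]; exists (maxn n m) => w; rewrite geq_max => /andP[nw mw].
by rewrite !fnE nu // mv // mulr0 addr0.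
Qed.

Lemma Fop_bound i n phi : (forall w, (n <= size w)%N -> phi w = 0) ->
  forall w, (n.+1 <= size w)%N -> Fop zeta l i phi w = 0.
Proof.
move=> H w; elim: w n phi H => [|k w IH] n phi H //=; rewrite ltnS => nw.
rewrite /Hop (H w) // !mulr0 addr0.
case: n H nw => [|n] H nw.
  have -> : Eop k phi = 0 by apply/funext => v; rewrite /Eop H.
  by rewrite (lin0 (Fop_linear zeta l i)) mulr0.
by rewrite (IH n) ?mulr0 // => v nv; rewrite /Eop H.
Qed.

Lemma rel_fin_supp m P phi : oprel m P -> fin_supp phi -> fin_supp (P.2 phi).
Proof.
move=> rP; elim: rP phi => {m P} [i|i|m|c m P Q _ IP _ IQ|m n P Q _ IP _ IQ] phi fphi.
- case: fphi => n H; exists n => w nw; apply: H => /=; exact: leqW.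
- by case: fphi => n H; exists n.+1; apply: Fop_bound.
- by case: fin_supp_subspace.
- by rewrite pair2E; case: fin_supp_subspace => _; apply; auto.
- rewrite pbr2E; apply: (subspaceB fin_supp_subspace); first by auto.
  by apply: (subspaceZ _ fin_supp_subspace); auto.
Qed.

Lemma rel_invariant_subspace : subspace rel_invariant.
Proof.
split=> [m P rP _|c u v Hu Hv m P rP P0]; have [_ L _] := rel_homog zeta1 rP.
  exact: lin0 L.
by rewrite L (Hu m) // (Hv m) // scaler0 addr0.
Qed.

(** The operators (0, T) form an ideal, as brackets with 0 vanish in g. *)
Lemma rel_rel_invariant m P phi : oprel m P -> rel_invariant phi -> rel_invariant (P.2 phi).
Proof.
move=> rP H n Q rQ Q0.
have := H _ _ (rel_br rQ rP); rewrite pbr1E Q0 brk0l => /(_ erefl).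
rewrite pbr2E (H _ _ rQ Q0); have [_ L _] := rel_homog zeta1 rP.
by rewrite (lin0 L) scaler0 subr0.
Qed.

Lemma in_cofree_subspace : subspace in_cofree.
Proof. exact: subspaceI fin_supp_subspace rel_invariant_subspace. Qed.

Lemma cofree_op_cofree x phi : in_cofree phi -> in_cofree (cofree_op x phi).
Proof.
move=> [fphi rphi].
apply: (@lspan_min _ _ _ (fun x => in_cofree (cofree_op x phi))) (g_lspan zeta1 x).
  split=> [|c y z cy cz]; first by rewrite (lin0 (cofree_op_linearl _)); case: in_cofree_subspace.
  by rewrite cofree_op_linearl; case: in_cofree_subspace => _; apply.
move=> y /(gbasis_root zeta1)[m _ ym]; have r := cofree_op_rel ym.
by split; [apply: (rel_fin_supp r) | apply: (rel_rel_invariant r)].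
Qed.

(** Two operators that belong to the same x differ by a relation. *)
Lemma cofree_op_E m x T phi : oprel m (x, T) -> in_cofree phi -> cofree_op x phi = T phi.
Proof.
move=> r [_ inv]; have [rx _ _] := rel_homog zeta1 r.
have := inv _ _ (rel_lin (-1) r (cofree_op_rel rx)); rewrite pair1E pair2E /= !scaleN1r.
by rewrite addNr => /(_ erefl) /eqP; rewrite addrC subr_eq0 => /eqP.
Qed.

Lemma cofree_op_brk a b x y phi : x \in part a -> y \in part b -> in_cofree phi ->
  cofree_op (brk x y) phi = cofree_op x (cofree_op y phi) - (-1) ^+ (a && b) *: cofree_op y (cofree_op x phi).
Proof.
move=> /(part_lspan zeta1) xa /(part_lspan zeta1) yb cphi.
apply: (@lspan_min _ _ _ (fun x => cofree_op (brk x y) phi =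
  cofree_op x (cofree_op y phi) - (-1) ^+ (a && b) *: cofree_op y (cofree_op x phi))) xa.
  split=> [|c u v Eu Ev].
    by rewrite brk0l !(lin0 (cofree_op_linearl _)) (lin0 (cofree_op_linear _)) scaler0 subr0.
  rewrite brkDl brkZl !cofree_op_linearl Eu Ev (cofree_op_linear _ c).
  by apply/funext => w; rewrite !fnE; ring.
move=> {}x [[m xm mE] _].
apply: (@lspan_min _ _ _ (fun y => cofree_op (brk x y) phi =
  cofree_op x (cofree_op y phi) - (-1) ^+ (a && b) *: cofree_op y (cofree_op x phi))) yb.
  split=> [|c u v Eu Ev].
    by rewrite brk0r !(lin0 (cofree_op_linearl _)) (lin0 (cofree_op_linear _)) scaler0 subr0.
  rewrite brkDr brkZr !cofree_op_linearl Eu Ev (cofree_op_linear _ c).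
  by apply/funext => w; rewrite !fnE; ring.
move=> {}y [[n yn nE] _].
by have := cofree_op_E (rel_br (cofree_op_rel xm) (cofree_op_rel yn)) cphi; rewrite mE nE.
Qed.

Lemma cofree_op_res x m p phi : has_root x m ->
  cofree_op x (res p phi) = res (fun s => p (s - m)) (cofree_op x phi).
Proof. by move=> xm; apply: (rel_res (cofree_op_rel xm)). Qed.

Lemma res_cofree p phi : in_cofree phi -> in_cofree (res p phi).
Proof.
move=> [[n nphi] inv]; split.
  by exists n => w nw; rewrite /res nphi // if_same.
move=> m P rP P0; rewrite (rel_res rP) (inv _ _ rP P0).
exact: lin0 (res_linear _ _).
Qed.

Definition cofree_space := sub_space in_cofree_subspace.
HB.instance Definition _ := GRing.Lmodule.on cofree_space.
Implicit Types u v : cofree_space.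

Lemma cofreeP v : in_cofree (sub_val v). Proof. exact: sub_valPP. Qed.

Definition cofree_act x v : cofree_space :=
  mk_sub in_cofree_subspace (cofree_op_cofree x (cofreeP v)).

(** The parity of a function is read off its weights, the vacuum being even. *)
Definition parity_weights a : weight -> bool :=
  fun s => root_parity s == root_parity l (+) a.
Definition cofree_part a v := res (parity_weights a) (sub_val v) = sub_val v.

Lemma cofree_eq u v : (forall w, sub_val u w = sub_val v w) -> u = v.
Proof. by move=> H; apply: sub_val_inj; apply/funext. Qed.

Lemma cofree_act_linearr x : linear (cofree_act x).
Proof. by move=> c u v; apply: sub_val_inj; rewrite linearP /= cofree_op_linear. Qed.
Lemma cofree_act_linearl v : linear (cofree_act^~ v).
Proof. by move=> c x y; apply: sub_val_inj; rewrite linearP /= cofree_op_linearl. Qed.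
Lemma cofree_part0 a : cofree_part a 0.
Proof. by rewrite /cofree_part linear0 (lin0 (res_linear _ _)). Qed.
Lemma cofree_part_linear a c u v : cofree_part a u -> cofree_part a v ->
  cofree_part a (c *: u + v).
Proof. by rewrite /cofree_part linearP /= (res_linear _ _ c) => -> ->. Qed.

Lemma parity_weightsN a s : parity_weights (~~ a) s = ~~ parity_weights a s.
Proof.
by rewrite /parity_weights; case: (root_parity s); case: (root_parity l); case: a.
Qed.

Lemma res_res p q phi : res p (res q phi) = res (fun s => p s && q s) phi.
Proof. by apply/funext => w; rewrite /res; case: (p _). Qed.
Lemma res_eq p q phi : p =1 q -> res p phi = res q phi.
Proof. by move=> pq; apply/funext => w; rewrite /res pq. Qed.

Lemma cofree_part_sum v : exists v0 v1,
  [/\ cofree_part false v0, cofree_part true v1 & v = v0 + v1].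
Proof.
exists (mk_sub in_cofree_subspace (res_cofree (parity_weights false) (cofreeP v))).
exists (mk_sub in_cofree_subspace (res_cofree (parity_weights true) (cofreeP v))).
split; rewrite /cofree_part /=.
- by rewrite res_res; apply: res_eq => s; rewrite andbb.
- by rewrite res_res; apply: res_eq => s; rewrite andbb.
apply: cofree_eq => w; rewrite linearD /= fnE /res.
by rewrite -[true]/(~~ false) parity_weightsN; case: (parity_weights _ _); rewrite ?addr0 ?add0r.
Qed.
Lemma cofree_part_cap v : cofree_part false v -> cofree_part true v -> v = 0.
Proof.
rewrite /cofree_part => v0 v1; apply: sub_val_inj; rewrite linear0 -v0 -v1 res_res.
apply/funext => w; rewrite /res -[true]/(~~ false) parity_weightsN.
by case: (parity_weights _ _).
Qed.
Lemma cofree_act_part a b x v : x \in part a -> cofree_part b v ->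
  cofree_part (a (+) b) (cofree_act x v).
Proof.
move=> /(part_lspan zeta1) xa; rewrite /cofree_part /= => vb.
apply: (@lspan_min _ _ _ (fun x => res (parity_weights (a (+) b)) (cofree_op x (sub_val v)) =
  cofree_op x (sub_val v))) xa.
  split=> [|c y z Ey Ez]; first by rewrite (lin0 (cofree_op_linearl _)) (lin0 (res_linear _ _)).
  by rewrite cofree_op_linearl (res_linear _ _ c) Ey Ez.
move=> y [[m ym mE] _]; rewrite -{2}vb (cofree_op_res _ _ ym); apply: res_eq => s.
rewrite /parity_weights root_parityD root_parityN mE.
by case: (root_parity s); case: (root_parity l); case: (a); case: (b).
Qed.
Lemma cofree_act_brk a b x y v : x \in part a -> y \in part b ->
  cofree_act (brk x y) v =
  cofree_act x (cofree_act y v) - (-1) ^+ (a && b) *: cofree_act y (cofree_act x v).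
Proof.
move=> xa yb; apply: sub_val_inj; rewrite linearB linearZ /=.
by rewrite (cofree_op_brk xa yb (cofreeP v)) scalerN.
Qed.

Definition cofree : superModule g :=
  SuperModule cofree_act_linearr cofree_act_linearl cofree_part0 cofree_part_linear
    cofree_part_sum cofree_part_cap cofree_act_part cofree_act_brk.

End CofreeModule.

Lemma nat_max_exists (P : nat -> Prop) b : (exists n, P n) ->
  (forall n, P n -> (n <= b)%N) -> exists n, P n /\ forall m, P m -> (m <= n)%N.
Proof.
move=> exP bP.
have ex : exists n, `[< P n >] by have [n Pn] := exP; exists n; apply/asboolP.
have bd n : `[< P n >] -> (n <= b)%N by move/asboolP; apply: bP.
case: (ex_maxnP ex bd) => n /asboolP Pn nP; exists n; split=> // m Pm.
by apply: nP; apply/asboolP.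
Qed.

Lemma nat_min_exists (P : nat -> Prop) : (exists n, P n) ->
  exists n, P n /\ forall m, P m -> (n <= m)%N.
Proof.
move=> exP.
have ex : exists n, `[< P n >] by have [n Pn] := exP; exists n; apply/asboolP.
case: (ex_minnP ex) => n /asboolP Pn nP; exists n; split=> // m Pm.
by apply: nP; apply/asboolP.
Qed.

Lemma prop_vspace (K : fieldType) (rT : vectType K) (U : rT -> Prop) : subspace U ->
  exists X : {vspace rT}, forall r, r \in X <-> U r.
Proof.
move=> US.
have [n [[s [fs <- sU]] nmax]] : exists n, (exists s, [/\ free s, size s = n &
    forall r, r \in s -> U r]) /\ forall m, (exists s, [/\ free s, size s = m &
    forall r, r \in s -> U r]) -> (m <= n)%N.
  apply: (nat_max_exists (b := \dim {:rT})).
    by exists 0%N, [::]; rewrite nil_free.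
  move=> m [s [/eqP fs <- _]]; rewrite -fs; exact/dimvS/subvf.
exists <<s>>%VS => r; split=> [/mem_span_lspan|Ur]; first exact: lspan_min.
apply: contrapT => /negP rs; have /negP := negbT (ltnn (size s)); apply; apply: nmax.
exists (r :: s); split=> //; first by rewrite free_cons rs.
by move=> u; rewrite inE => /predU1P[->//|]; apply: sU.
Qed.

Lemma finite_span (K : fieldType) (V : lmodType K) (rT : vectType K) (P : V -> Prop)
    (ev : {linear V -> rT}) : subspace P ->
  (forall u, P u -> ev u = 0 -> u = 0) ->
  exists s : seq V, (forall u, u \in s -> P u) /\ forall u, P u -> in_span s u.
Proof.
move=> PS inj; have [|X XP] := @prop_vspace K rT (fun r => exists2 u, P u & ev u = r).
  split; first by exists 0; [case: PS | rewrite linear0].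
  move=> c _ _ [u Pu <-] [v Pv <-]; exists (c *: u + v); last by rewrite linearP.
  by case: PS => _; apply.
have /choice[pre preP] : forall r, exists u, r \in X -> P u /\ ev u = r.
  move=> r; have [/XP[u Pu uE]|_] := boolP (r \in X); first by exists u.
  by exists 0.
exists (map pre (vbasis X)); split=> [_ /mapP[r rX ->]|u Pu].
  by case: (preP r) => //; apply: vbasis_mem.
have uX : ev u \in X by apply/XP; exists u.
have uE : u = \sum_i coord (vbasis X) i (ev u) *: pre (vbasis X)`_i.
  have inX (i : 'I_(\dim X)) : (vbasis X)`_i \in X by apply: vbasis_mem; apply: mem_nth; rewrite size_tuple.
  apply: subr0_eq; apply: inj.
    apply: subspaceB => //; apply: subspace_sum => // i _; apply: subspaceZ => //.
    by case: (preP (vbasis X)`_i) => //; apply: inX.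
  rewrite linearB linear_sum {1}(coord_vbasis uX).
  apply/eqP; rewrite subr_eq0; apply/eqP; apply: eq_bigr => i _; rewrite linearZ; congr (_ *: _).
  by case: (preP (vbasis X)`_i) => //; apply: inX.
rewrite uE; apply: (subspace_sum _ (in_span_subspace _)) => i _.
apply: (subspaceZ _ (in_span_subspace _)); apply/in_spanP/lspan_gen/map_f.
by apply: mem_nth; rewrite size_tuple.
Qed.

Fixpoint words n : seq (seq 'I_3) :=
  if n is n'.+1 then [::] :: [seq i :: w | i <- enum 'I_3, w <- words n'] else [::].

Lemma mem_words n w : (w \in words n) = (size w < n)%N.
Proof.
elim: n w => [|n IH] [|k w] //=; rewrite inE /= ltnS -IH.
apply/allpairsP/idP => [[[i v] [/= _ vn [_ ->]]]//|wn].
by exists (k, w); rewrite mem_enum.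
Qed.

(** * Submodules of the cofree module *)

Section CofreeTheory.
Variables (K : numFieldType) (zeta : K) (g : D21 zeta).
Hypothesis zeta1 : 1 + zeta != 0.
Variable l : weight.
Local Notation e := (@D21_e K zeta g).
Local Notation f := (@D21_f K zeta g).
Local Notation h := (@D21_h K zeta g).
Local Notation fn := (seq 'I_3 -> K^o).
Local Notation res := (@res K l).
Local Notation N := (cofree g zeta1 l).
Local Notation module := (superModule g).
Local Notation val := (@sub_val K fn _ (in_cofree_subspace g zeta1 l)).
Implicit Types (u v : N) (w : seq 'I_3).

Lemma act_eE i v w : val (act (e i) v) w = val v (i :: w).
Proof.
by rewrite /= (cofree_op_E zeta1 (rel_e g l i) (cofreeP v)).
Qed.
Lemma act_fE i v : val (act (f i) v) = Fop zeta l i (val v).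
Proof. by rewrite /= (cofree_op_E zeta1 (rel_f g l i) (cofreeP v)). Qed.
Lemma act_hE i v w : val (act (h i) v) w = hval zeta i (l - wsum w) * val v w.
Proof. by rewrite /= (cofree_op_E zeta1 (rel_h g l i) (cofreeP v)). Qed.

Lemma has_weight_h (M : module) (v : M) s :
  has_weight v s <-> forall j, act (h j) v = hval zeta j s *: v.
Proof.
split=> [[w1 w2 w3] j|H].
  rewrite /hval; have [->|->|->] := I3_cases j; last 2 first.
  - by rewrite val_i1.
  - by rewrite val_i2.
  rewrite /= h0E // actZl actDl actDl (actZl (1 + zeta) (h_2delta g)) (actZl zeta).
  rewrite w1 -/(h_2eps1 g) w2 -/(h_2eps2 g) w3.
  by rewrite !scalerA -!scalerDl scalerA.
have H1 := H i1; have H2 := H i2; have H0 := H ord0.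
rewrite /hval ?val_i1 ?val_i2 /= in H0 H1 H2.
split=> //; rewrite /h_2delta /h_2eps1 /h_2eps2 inord0 -/i1 -/i2.
rewrite actZl !actDl !actNl !actZl H0 H1 H2 -!scaleNr !scalerA -!scalerDl scalerA.
by congr (_ *: _); field.
Qed.

Lemma hval_inj s t : (forall j, hval zeta j s = hval zeta j t) -> s = t.
Proof.
move=> H; have := H i1; have := H i2; have := H ord0.
rewrite /hval val_i1 val_i2 /= => H0 /eqP; rewrite eqr_int => /eqP H2 /eqP.
rewrite eqr_int => /eqP H1; move: H0; rewrite H1 H2.
move/(mulfI (invr_neq0 (_ : (2 : K) != 0))); rewrite pnatr_eq0 => /(_ isT).
move=> /addIr/addIr/(mulfI zeta1)/eqP; rewrite eqr_int => /eqP.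
by case: s t H1 H2 {H} => [[a b] c] [[a' b'] c'] /= -> -> ->.
Qed.

Lemma cofree_weightP v s : has_weight v s <-> res (pred1 s) (val v) = val v.
Proof.
rewrite has_weight_h; split=> [H|H j].
  apply/funext => w; rewrite /res /=; case: eqP => // sw.
  apply/esym/eqP; apply: contra_notT sw => vw; apply: hval_inj => j.
  have := congr1 (fun u => val u w) (H j); rewrite act_hE linearZ /= scaleE => /eqP.
  by rewrite -subr_eq0 -mulrBl mulf_eq0 (negbTE vw) orbF subr_eq0 => /eqP.
apply: cofree_eq => w; rewrite act_hE linearZ /= scaleE -H /res /=.
by case: eqP => [->|]; rewrite ?mulr0.
Qed.

Lemma cofree_weight_support v s w : has_weight v s -> val v w != 0 -> l - wsum w = s.
Proof.
move=> /cofree_weightP => <-; rewrite /res /=.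
by case: (l - wsum w =P s) => // _; rewrite eqxx.
Qed.

Lemma cofree_parity : weight_parity N.
Proof.
exists (root_parity l) => v s /cofree_weightP vs; rewrite /sm_part /= /cofree_part -vs res_res.
apply: res_eq => t /=; rewrite /parity_weights.
by case: (t =P s) => [->|_]; rewrite ?andbF // addbA addbb eqxx.
Qed.

Lemma cofree_bound v : exists n, forall w, (n <= size w)%N -> val v w = 0.
Proof. by have [] := cofreeP v. Qed.

Lemma cofree_integral : integral_weight_module N.
Proof.
move=> v; have [n vn] := cofree_bound v.
pose S := undup [seq l - wsum w | w <- words n].
pose c s : N := mk_sub (in_cofree_subspace g zeta1 l) (res_cofree (pred1 s) (cofreeP v)).
exists [seq c s | s <- S].
  move=> _ /mapP[s _ ->]; exists s; apply/cofree_weightP.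
  by rewrite /= res_res; apply: res_eq => t; rewrite andbb.
apply: cofree_eq => w; rewrite big_map linear_sum /=.
have E (r : seq weight) (F : weight -> fn) : (\sum_(s <- r) F s) w = \sum_(s <- r) F s w.
  by elim/big_ind2: _ => // a b a' b' <- <-.
rewrite E; have [wn|wn] := ltnP (size w) n; last first.
  by rewrite vn // big1 // => s _; rewrite /res vn // if_same.
have wS : l - wsum w \in S by rewrite mem_undup; apply/mapP; exists w => //; rewrite mem_words.
rewrite (big_rem _ wS) /= {1}/res /= eqxx big1_seq ?addr0 // => s /andP[_].
rewrite mem_rem_uniq ?undup_uniq // inE => /andP[sw _].
by rewrite /res /= eq_sym (negbTE sw).
Qed.

Lemma delta_cofree i j : i != ord0 \/ (j <= 1)%N ->
  in_cofree g l (delta K (nseq j i)).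
Proof.
move=> ij; split; last by move=> m P; apply: rel0_delta.
exists j.+1 => w wj; rewrite /delta; case: eqP => // wE.
by rewrite wE size_nseq ltnn in wj.
Qed.

Definition dvec i j (ij : i != ord0 \/ (j <= 1)%N) : N :=
  mk_sub (in_cofree_subspace g zeta1 l) (delta_cofree ij).

Definition vac : N := @dvec ord0 0 (or_intror isT).

Lemma vacE w : val vac w = (w == [::])%:R. Proof. by []. Qed.
Lemma dvecE i j ij w : val (@dvec i j ij) w = (w == nseq j i)%:R. Proof. by []. Qed.

Lemma dvec_weight i j ij : has_weight (@dvec i j ij) (l - wsum (nseq j i)).
Proof. by apply/cofree_weightP; rewrite /= delta_res. Qed.

Lemma vac_weight : has_weight vac l.
Proof. by have := @dvec_weight ord0 0 (or_intror isT); rewrite /wsum big_nil subr0. Qed.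

Lemma vac_neq0 : vac <> 0.
Proof.
move=> E; have /eqP := congr1 (fun u => val u [::]) E; rewrite vacE linear0 eqxx.
by rewrite (negbTE (oner_neq0 _)).
Qed.

(** (e_i v)(w) = v(i w), so a vector killed by all e_i is supported at the
    empty word. *)
Lemma singular_vac v : (forall i, act (e i) v = 0) -> v = val v [::] *: vac.
Proof.
move=> ev; apply: cofree_eq => -[|i w]; rewrite linearZ /= scaleE /delta /= ?mulr1 //.
by rewrite mulr0 -act_eE ev linear0.
Qed.

(** Applying to v the e_i along a longest word of its support leaves a multiple
    of the indicator of the empty word. *)
Lemma submodule_vac (U : N -> Prop) v : submodule U -> U v -> v <> 0 -> U vac.
Proof.
move=> UM Uv v0; have [n vn] := cofree_bound v.
have [w [vw wmax]] : exists w, val v w <> 0 /\ forall t : seq 'I_3, val v t <> 0 -> (size t <= size w)%N.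
  have ex : exists k, exists w, val v w <> 0 /\ size w = k.
    apply: contrapT => H; apply: v0; apply: cofree_eq => w; rewrite linear0.
    by apply: contrapT => vw; apply: H; exists (size w), w.
  have [|k [[w [vw <-]] wmax]] := nat_max_exists (b := n) ex.
    move=> k [w [vw <-]]; rewrite leqNgt; apply/negP => nw; apply: vw; apply: vn; exact: ltnW.
  by exists w; split=> // u vu; apply: wmax; exists u.
have [_ _ Ua] := UM.
have [u Uu uE] : exists2 u, U u & forall t, val u t = val v (w ++ t).
  elim: (w) v Uv {v0 vn vw wmax} => [|k t IH] v Uv; first by exists v.
  have [u Uu uE] := IH _ (Ua (e k) _ Uv); exists u => // r.
  by rewrite uE act_eE.
have u_vac : u = val v w *: vac.
  apply: cofree_eq => -[|k t]; rewrite uE linearZ /= scaleE /delta /=.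
    by rewrite cats0 mulr1.
  rewrite mulr0; apply: contrapT => /wmax; rewrite size_cat /=; lia.
have -> : vac = (val v w)^-1 *: u.
  by rewrite u_vac scalerA mulVf ?scale1r //; apply/eqP.
by apply: subspaceZ => //; apply: submodule_subspace.
Qed.

Definition bounded n v := forall w, (n <= size w)%N -> val v w = 0.

(** Elements of n_+ raise weights, so they do not lengthen the words in the
    support; hence the bounded functions form a finite dimensional n_+-stable
    space. *)
Lemma bounded_nplus n x v : in_nplus x -> bounded n v -> bounded n (act x v).
Proof.
move=> [s sP ->] vn w wn.
have -> : act (\sum_(u <- s) u) v = \sum_(u <- s) act u v.
  by apply: (big_morph (fun x => act x v)) => [y z|]; rewrite ?actDl ?act0l.
rewrite linear_sum (_ : (\sum_(i <- s) _) w = \sum_(i <- s) val (act i v) w); last first.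
  by elim/big_ind2: _ => // a b a' b' <- <-.
rewrite big1_seq // => y /andP[_ /sP[a ap ya]] /=.
pose p := pred1 (l - wsum w - a).
have -> : cofree_op zeta1 l y (val v) w = res (fun s => p (s - a)) (cofree_op zeta1 l y (val v)) w.
  by rewrite /res /= eqxx.
rewrite -cofree_op_res //; have -> : res p (val v) = 0.
  apply/funext => t; rewrite /res /=; case: eqP => // E; apply: vn.
  have := congr1 height E; rewrite !heightD !heightN !height_wsum => ht.
  have := height_pos ap; move: ht wn; lia.
by rewrite (lin0 (cofree_op_linear zeta1 l y)).
Qed.

Variables (M : module) (iota : {linear M -> N}).
Hypotheses (iotaP : intertwining iota) (iinj : injective iota).

Lemma embedded_weight (v : M) s : has_weight (iota v) s -> has_weight v s.
Proof. by case=> w1 w2 w3; split; apply: iinj; rewrite linearZ iotaP. Qed.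

Lemma embedded_integral : integral_weight_module M.
Proof.
move=> v; have [s [u c]] := integral_comps (iota v) cofree_integral.
have IM := intertwining_image iotaP.
have Iu := submodule_comps IM c (ex_intro _ v erefl).
have [us vE wu] := c.
have /choice[t tP] : forall m, exists x, m \in s -> u m = iota x.
  move=> m; have [/Iu[x xE]|_] := boolP (m \in s); first by exists x.
  by exists 0.
exists (map t s).
  move=> _ /mapP[m ms ->]; exists m; apply: embedded_weight; rewrite -tP //.
  exact: wu.
apply: iinj; rewrite big_map linear_sum vE; apply: eq_big_seq => m ms.
exact: tP.
Qed.

Lemma embedded_locally_finite : locally_finite_nplus M.
Proof.
move=> v; have [n vn] := cofree_bound (iota v).
pose P (u : M) := bounded n (iota u).
have PS : subspace P.
  split=> [|c a b Pa Pb] w wn; first by rewrite !linear0.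
  by rewrite !linearP /= fnE scaleE Pa // Pb // mulr0 addr0.
pose ev0 (u : M) : 'rV[K]_(size (words n)) := \row_j val (iota u) (nth [::] (words n) j).
have ev_lin : linear ev0.
  by move=> c a b; apply/rowP => j; rewrite !mxE !linearP.
pose L := GRing.isLinear.Build _ _ _ _ ev0 ev_lin.
pose ev : {linear M -> 'rV[K]_(size (words n))} := HB.pack ev0 L.
have [|s [sP Ps]] := @finite_span K M _ P ev PS.
  move=> u Pu u0; apply: iinj; rewrite linear0; apply: cofree_eq => w; rewrite linear0.
  have [wn|/Pu//] := ltnP (size w) n.
  have wi : (index w (words n) < size (words n))%N by rewrite index_mem mem_words.
  have := congr1 (fun A : 'rV[K]_(size (words n)) => A 0 (Ordinal wi)) u0; rewrite !mxE /=.
  by rewrite nth_index // mem_words.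
exists s; first exact: Ps.
move=> x u xn us; apply: Ps; rewrite /P iotaP; apply: bounded_nplus => //.
by move/in_spanP: us; apply: (@lspan_min _ _ _ P).
Qed.

End CofreeTheory.

(** * Casimir operators of the even triples *)

Section Casimir.
Variables (K : numFieldType) (zeta : K) (g : D21 zeta).
Hypothesis zeta1 : 1 + zeta != 0.
Local Notation part := (ls_part g).
Variables (E3 F3 : 'I_3 -> g).
Hypothesis sl2 : forall j, [/\ has_root (E3 j) (even_root j),
  has_root (F3 j) (- even_root j) & brk (E3 j) (F3 j) = H3 g j].
Variables (M : superModule g) (j : 'I_3).
Local Notation E := (E3 j).
Local Notation F := (F3 j).
Local Notation H := (H3 g j).
Implicit Types (u v a b : M) (x y z : g).

Lemma H3_neq0 k : H3 g k != 0.
Proof.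
apply/eqP => H0; have := H3_root k (has_root_e g zeta1 k).
rewrite H0 brk0l => /esym/eqP; rewrite scaler_eq0 (negbTE (e_neq0 _ _)) orbF intr_eq0.
by rewrite /coord3; have [->|->|->] := I3_cases k; rewrite ?val_i1 ?val_i2 ?simple_root1 ?simple_root2.
Qed.

Lemma line_of x y s : has_root x s -> has_root y s -> y != 0 -> s != 0 ->
  exists c, x = c *: y.
Proof.
move=> xs ys y0 s0; have := root_in_list zeta1 ys y0; rewrite in_cons (negbTE s0) /=.
case/mapP => p ps sE; rewrite sE in xs ys.
have [c ->] := root_line zeta1 ps xs; have [d yE] := root_line zeta1 ps ys.
have d0 : d != 0 by apply: contraNneq y0 => d0; rewrite yE d0 scale0r.
by exists (c / d); rewrite yE scalerA divfK.
Qed.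

Lemma E3_line k x : has_root x (even_root k) -> exists c, x = c *: E3 k.
Proof.
have [rE rF EFH] := sl2 k; move=> xs; apply: line_of xs rE _ _.
  by apply: contraNneq (H3_neq0 k) => E0; rewrite -EFH E0 brk0l.
by rewrite /even_root; have [->|->|->] := I3_cases k; rewrite ?val_i1 ?val_i2.
Qed.

Lemma F3_line k x : has_root x (- even_root k) -> exists c, x = c *: F3 k.
Proof.
have [rE rF EFH] := sl2 k; move=> xs; apply: line_of xs rF _ _.
  by apply: contraNneq (H3_neq0 k) => E0; rewrite -EFH E0 brk0r.
by rewrite /even_root; have [->|->|->] := I3_cases k; rewrite ?val_i1 ?val_i2.
Qed.

Lemma even_root_sum k (b1 b2 : bool) : j != k ->
  (if b1 then even_root j else - even_root j) + (if b2 then even_root k else - even_root k)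
    \notin 0 :: nonzero_roots g.
Proof.
rewrite in_cons nonzero_rootsE /even_root.
by case: b1 b2 => [] []; have [->|->|->] := I3_cases j; have [->|->|->] := I3_cases k;
  rewrite ?val_i1 ?val_i2 ?eqxx.
Qed.

Lemma coord3_even k : coord3 j (even_root k) = if j == k then 2 else 0.
Proof.
rewrite /coord3 /even_root; have [->|->|->] := I3_cases j; have [->|->|->] := I3_cases k;
  by rewrite ?val_i1 ?val_i2 ?eqxx ?I3E.
Qed.

Lemma coord3N s : coord3 j (- s) = - coord3 j s.
Proof. by rewrite /coord3; have [->|->|->] := I3_cases j; rewrite ?val_i1 ?val_i2. Qed.
Lemma coord3D s t : coord3 j (s + t) = coord3 j s + coord3 j t.
Proof. by rewrite /coord3; have [->|->|->] := I3_cases j; rewrite ?val_i1 ?val_i2. Qed.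

Lemma even_root_parity k : root_parity (even_root k) = false.
Proof. by rewrite /even_root; have [->|->|->] := I3_cases k; rewrite ?val_i1 ?val_i2. Qed.

Let Ep : E \in part false.
Proof. by have [r _ _] := sl2 j; rewrite -(even_root_parity j); apply: root_part. Qed.
Let Fp : F \in part false.
Proof.
by have [_ r _] := sl2 j; have := root_part zeta1 r; rewrite /root_parity /= abszN -/(root_parity _) even_root_parity.
Qed.
Let Hp : H \in part false. Proof. exact: H3_part. Qed.

Lemma act_swap x y v : x \in part false ->
  act x (act y v) = act y (act x v) + act (brk x y) v.
Proof. by move=> xp; rewrite (act_brk0 _ _ xp) addrC subrK. Qed.

Lemma act_H x s v : has_root x s ->
  act H (act x v) = act x (act H v) + (coord3 j s)%:~R *: act x v.
Proof. by move=> xs; rewrite (act_swap _ _ Hp) (H3_root j xs) actZl. Qed.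

Let HE v : act H (act E v) = act E (act H v) + 2 *: act E v.
Proof. by have [r _ _] := sl2 j; rewrite (act_H _ r) coord3_even eqxx. Qed.
Let HF v : act H (act F v) = act F (act H v) - 2 *: act F v.
Proof. by have [_ r _] := sl2 j; rewrite (act_H _ r) coord3N coord3_even eqxx scaleNr. Qed.
Let EF v : act E (act F v) = act F (act E v) + act H v.
Proof. by have [_ _ r] := sl2 j; rewrite (act_swap _ _ Ep) r. Qed.

(** (H + 1)^2 + 4 F E, which is 1 plus twice the Casimir element in its
    usual normalization; on a highest weight vector of weight s it is (s + 1)^2. *)
Definition cas v : M :=
  act H (act H v) + 2 *: act H v + v + 4 *: act F (act E v).

Lemma cas_linear : linear cas.
Proof.
by move=> c u v; rewrite /cas !(actDr, actZr); module_over K.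
Qed.

(** [cas] commutes with its own sl2, and the other even roots are orthogonal
    to this one: neither their sum nor their difference is a root. *)
Lemma cas_even_root x s v : has_root x s -> root_parity s = false ->
  cas (act x v) = act x (cas v).
Proof.
move=> xs s0; have xp : x \in part false by rewrite -s0; apply: root_part.
have [rE rF EFH] := sl2 j.
have expand : cas (act x v) = act x (cas v) + (2 * (coord3 j s)%:~R) *: act x (act H v)
    + ((coord3 j s)%:~R ^+ 2 + 2 * (coord3 j s)%:~R) *: act x v
    + 4 *: (act (brk F x) (act E v) + act (brk E x) (act F v) + act (brk F (brk E x)) v).
  have bp : brk E x \in part false by have := brk_part Ep xp.
  rewrite /cas !(act_H _ xs, actDr, actZr) (act_swap x _ Ep).
  rewrite !(actDr, actZr) (act_swap x _ Fp) (act_swap (brk E x) _ Fp).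
  by module_over K.
rewrite expand; have [->|x0] := eqVneq x 0.
  by rewrite !brk0r !act0l; module_over K.
have := root_in_list zeta1 xs x0; rewrite in_cons => /orP[/eqP sE|sl].
  rewrite sE in xs *.
  have -> : coord3 j 0 = 0 by rewrite /coord3; have [->|->|->] := I3_cases j; rewrite ?val_i1 ?val_i2.
  have [c0 [c1 [c2 xE]]] := root0_cartan zeta1 xs.
  have [d dE] : exists d, brk x E = d *: E /\ brk x F = - (d *: F).
    exists (c0 * hval zeta ord0 (even_root j) + c1 * hval zeta i1 (even_root j)
      + c2 * hval zeta i2 (even_root j)).
    rewrite xE !brkDl !brkZl !(h_root zeta1 _ rE) !(h_root zeta1 _ rF) !hvalN.
    by split; module_over K.
  rewrite (skewE Ep xp) // (skewE Fp xp) // dE.1 dE.2 opprK brkNr brkZr.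
  rewrite (skewE Fp Ep) // EFH.
  by rewrite !(actNl, actZl) EF; module_over K.
have cases : exists k, s = even_root k \/ s = - even_root k.
  move: sl s0; rewrite nonzero_rootsE !inE.
  by do 13?[case/orP => [/eqP-> //|]]; [
    exists i1; left; rewrite /even_root val_i1 |
    exists i2; left; rewrite /even_root val_i2 |
    exists ord0; left | exists i1; right; rewrite /even_root val_i1 |
    exists i2; right; rewrite /even_root val_i2 |
    move/eqP->; exists ord0; right ].
have {cases} [k sk] := cases.
have [jk|jk] := eqVneq j k; last first.
  have c0 : coord3 j s = 0.
    by case: sk => ->; rewrite ?coord3N coord3_even (negbTE jk) ?oppr0.
  have z1 : brk F x = 0.
    apply: (notroot0 zeta1 (has_root_brk rF xs)).
    by case: sk => ->; [apply: (even_root_sum false true) | apply: (even_root_sum false false)].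
  have z2 : brk E x = 0.
    apply: (notroot0 zeta1 (has_root_brk rE xs)).
    by case: sk => ->; [apply: (even_root_sum true true) | apply: (even_root_sum true false)].
  by rewrite z1 z2 brk0r !act0l c0; module_over K.
rewrite -jk in sk; have EE : brk E E = 0.
  have /eqP := skewE Ep Ep isT; rewrite -addr_eq0 -mulr2n -scaler_nat scaler_eq0.
  by rewrite pnatr_eq0 => /eqP.
have FF : brk F F = 0.
  have /eqP := skewE Fp Fp isT; rewrite -addr_eq0 -mulr2n -scaler_nat scaler_eq0.
  by rewrite pnatr_eq0 => /eqP.
have FE : brk F E = - H by rewrite (skewE Fp Ep) // EFH.
case: sk => sE; rewrite sE in xs *.
  have [c ->] := E3_line xs.
  rewrite !brkZr EE FE coord3_even eqxx scaler0 brk0r !(act0l, actZl, actNl) HE.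
  by module_over K.
have [c ->] := F3_line xs.
rewrite !brkZr EFH FF (skewE Fp Hp) // (H3_root j rF).
rewrite coord3N coord3_even eqxx scaler0 !(act0l, actZl, actNl) HF.
by module_over K.
Qed.

Lemma cas_even x v : x \in part false -> cas (act x v) = act x (cas v).
Proof.
move=> /(part_lspan zeta1); apply: (@lspan_min _ _ _ (fun x => cas (act x v) = act x (cas v))).
  split; first by rewrite !act0l (lin0 cas_linear).
  by move=> c a b Ea Eb; rewrite !actDl !actZl cas_linear Ea Eb.
by move=> y [[s ys s0] _]; apply: (cas_even_root _ ys s0).
Qed.

Section Doublet.
Variables (yp ym : g).
Hypotheses (Hyp : brk H yp = yp) (Hym : brk H ym = - ym)
  (Eyp : brk E yp = 0) (Eym : brk E ym = yp) (Fyp : brk F yp = ym) (Fym : brk F ym = 0).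

Definition doublet_map (p : M * M) : M := act yp p.1 + act ym p.2.
(** With y+ and y- spanning a doublet V of the sl2, [doublet_map] is the map
    from V tensor M to M, and [Om] is the mixed part of the Casimir element of
    V tensor M. *)
Definition Om (p : M * M) : M * M :=
  (act H p.1 + 2 *: act F p.2, 2 *: act E p.1 - act H p.2).
Definition Omc (c : K) (p : M * M) : M * M := Om p + c *: p.

(** On V tensor M the Casimir operator is the square of Om + 2, and that of M
    is the square of Om + 1 by [Om_cas].  So where the latter is m^2, Om + 1 is
    m or - m, and the former is (m + 1)^2 or (m - 1)^2. *)
Lemma doublet_map_cas p : cas (doublet_map p) = doublet_map (Omc 2 (Omc 2 p)).
Proof.
case: p => a b; rewrite /doublet_map /Omc /Om /cas /=.
rewrite !(actDr, actNr, actZr).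
rewrite !(act_swap yp _ Hp, act_swap ym _ Hp, act_swap yp _ Ep, act_swap ym _ Ep).
rewrite Hyp Hym Eyp Eym !(actDr, actNr, actZr, actNl, act0l, act0r).
rewrite !(act_swap yp _ Hp, act_swap ym _ Hp, act_swap yp _ Fp, act_swap ym _ Fp).
rewrite Hyp Hym Fyp Fym !(actDr, actNr, actZr, actNl, act0l, act0r).
rewrite HE HF EF !(actDr, actNr, actZr).
by module_over K.
Qed.

Lemma Om_cas p : Omc 1 (Omc 1 p) = (cas p.1, cas p.2).
Proof.
case: p => a b; congr (_, _); rewrite /Omc /Om /cas /=;
  rewrite !(actDr, actNr, actZr) ?HE ?HF ?EF; module_over K.
Qed.

Lemma Om_linear : linear Om.
Proof.
move=> c [a b] [a' b']; congr (_, _); rewrite /= !(actDr, actZr); module_over K.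
Qed.

Lemma OmcC c d p : Omc c (Omc d p) = Omc d (Omc c p).
Proof.
rewrite /Omc !(linD Om_linear) !(linZ Om_linear); module_over K.
Qed.

Lemma OmcM c d p : Omc (c - d) (Omc (c + d) p) = Omc c (Omc c p) - (d ^+ 2) *: p.
Proof.
rewrite /Omc !(linD Om_linear) !(linZ Om_linear); module_over K.
Qed.

Definition cas_sub (m : int) v : M := cas v - (m%:~R ^+ 2) *: v.

Lemma doublet_map_linear : linear doublet_map.
Proof. by move=> c p q; rewrite /doublet_map /= !(actDr, actZr); module_over K. Qed.

Lemma doublet_map_cas_sub m p : cas_sub m (doublet_map p) = doublet_map (Omc (2 - m%:~R) (Omc (2 + m%:~R) p)).
Proof.
by rewrite OmcM (linB doublet_map_linear) (linZ doublet_map_linear) /cas_sub doublet_map_cas.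
Qed.

(** The polynomial form of this statement, without eigenvectors: both sides
    are products of factors Om + c, which commute. *)
Lemma doublet_map_cas_sub2 m p : cas_sub (m + 1) (cas_sub (m - 1) (doublet_map p)) =
  doublet_map (Omc (3 - m%:~R) (Omc (3 + m%:~R) (cas_sub m p.1, cas_sub m p.2))).
Proof.
have -> : (cas_sub m p.1, cas_sub m p.2) = Omc (1 - m%:~R) (Omc (1 + m%:~R) p).
  by rewrite OmcM Om_cas.
rewrite !doublet_map_cas_sub !rmorphD !rmorphN /=.
have -> : 2 - (m%:~R + 1%:~R) = 1 - m%:~R :> K by ring.
have -> : 2 + (m%:~R + 1%:~R) = 3 + m%:~R :> K by ring.
have -> : 2 - (m%:~R - 1%:~R) = 3 - m%:~R :> K by ring.
have -> : 2 + (m%:~R - 1%:~R) = 1 + m%:~R :> K by ring.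
congr doublet_map; rewrite [Omc (1 - _) _]OmcC; rewrite (OmcC (1 - _) (3 - _)).
by rewrite (OmcC (3 + _) (3 - _)).
Qed.

End Doublet.

End Casimir.

(** * Polynomial identities for the Casimir operators *)

Section Filtration.
Variables (K : numFieldType) (zeta : K) (g : D21 zeta).
Hypothesis zeta1 : 1 + zeta != 0.
Local Notation part := (ls_part g).
Variables (M : superModule g) (u0 : M).
Implicit Types (u v a b : M) (x y z : g).

(** The module over the even part generated by u0. *)
Definition even_gen v := forall U : M -> Prop, subspace U ->
  (forall x u, x \in part false -> U u -> U (act x u)) -> U u0 -> U v.

Fixpoint filt (n : nat) : M -> Prop :=
  if n is n'.+1 then
    lspan (fun v => filt n' v \/ exists z a, [/\ z \in part true, filt n' a & v = act z a])
  else even_gen.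

Lemma filt_subspace n : subspace (filt n).
Proof.
case: n => [|n]; last exact: lspan_subspace.
split=> [U [] //|c u v Gu Gv U US Ue U0].
by case: (US) => _; apply; [apply: Gu | apply: Gv].
Qed.

Lemma filtS n v : filt n v -> filt n.+1 v.
Proof. by move=> H; apply: lspan_gen; left. Qed.
Lemma filt_le m n v : (m <= n)%N -> filt m v -> filt n v.
Proof.
move=> /subnK <-; elim: (n - m)%N => // k IH H; rewrite addSn; apply: filtS; exact: IH.
Qed.
Lemma filt_odd n z v : z \in part true -> filt n v -> filt n.+1 (act z v).
Proof. by move=> zp H; apply: lspan_gen; right; exists z, v. Qed.

Lemma filt_even n x v : x \in part false -> filt n v -> filt n (act x v).
Proof.
elim: n x v => [|n IH] x v xp; first by move=> G U US Ue U0; apply: (Ue) => //; apply: G.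
apply: (@lspan_min _ _ _ (fun v => filt n.+1 (act x v))).
  split=> [|c a b Fa Fb]; first by rewrite act0r; case: (filt_subspace n.+1).
  by rewrite actDr actZr; case: (filt_subspace n.+1) => _; apply.
move=> u [Fu|[z [a [zp Fa ->]]]]; first by apply: filtS; apply: IH.
rewrite act_swap //; apply: (subspaceD (filt_subspace n.+1)).
  by apply: filt_odd => //; apply: IH.
by apply: filt_odd => //; have := brk_part xp zp.
Qed.

Local Notation d := (\dim (part true)).
Let ob (i : 'I_d) : g := (vbasis (part true))`_i.

Let obp i : ob i \in part true.
Proof. by apply: vbasis_mem; apply: mem_nth; rewrite size_tuple. Qed.

Definition odd_word (s : seq 'I_d) (a : M) : M := foldr (fun i => act (ob i)) a s.

Lemma odd_word_filt s a : filt 0 a -> filt (size s) (odd_word s a).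
Proof. by move=> Fa; elim: s => //= i s IH; apply: filt_odd. Qed.

Lemma filt_odd_words n v : filt n v ->
  lspan (fun u => exists s a, [/\ (size s <= n)%N, filt 0 a & u = odd_word s a]) v.
Proof.
elim: n v => [|n IH] v; first by move=> Fv; apply: lspan_gen; exists [::], v.
apply: lspan_mono => {}v [/IH|[x [a [xp Fa ->]]]].
  by apply: lspan_mono => u [s [a [sn Fa ->]]]; apply: lspan_gen; exists s, a; split=> //; apply: leqW.
rewrite (coord_vbasis xp).
have -> : act (\sum_i coord (vbasis (part true)) i x *: (vbasis (part true))`_i) a =
    \sum_i coord (vbasis (part true)) i x *: act (ob i) a.
  rewrite (big_morph (fun y => act y a) (id1 := 0) (op1 := +%R)).
  - by apply: eq_bigr => i _; rewrite actZl.
  - by move=> y y'; rewrite actDl.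
  - by rewrite act0l.
apply: (subspace_sum _ (lspan_subspace _)) => i _; apply: subspaceZ; first exact: lspan_subspace.
have := IH _ Fa; apply: (lspan_linear (f := act (ob i))).
- exact: act_linearr.
- exact: lspan_subspace.
- by move=> _ [s [b [sn Fb ->]]]; apply: lspan_gen; exists (i :: s), b.
Qed.

(** Odd elements anticommute up to even ones, which stay in the same step of
    the filtration. *)
Lemma odd_word_swap (i : 'I_d) s a : filt 0 a -> i \in s ->
  exists (c : K) b, filt (size s).-1 b /\
    filt (size s).-1 (odd_word s a - c *: act (ob i) b).
Proof.
move=> Fa; elim: s => // j s IH; rewrite inE; have [-> _|ij /= is_] := eqVneq i j.
  exists 1, (odd_word s a); rewrite scale1r subrr; split; first exact: odd_word_filt.
  by case: (filt_subspace (size s)).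
have [c [b [Fb Fr]]] := IH is_.
have s0 : (size s).-1.+1 = size s by case: (s) is_.
exists (- c), (act (ob j) b); split; first by rewrite -s0; apply: filt_odd.
have -> : act (ob j) (odd_word s a) - - c *: act (ob i) (act (ob j) b) =
   act (ob j) (odd_word s a - c *: act (ob i) b) + c *: act (brk (ob j) (ob i)) b.
  rewrite (act_brk _ (obp j) (obp i)) /= expr1 !(actDr, actNr, actZr).
  by module_over K.
apply: (subspaceD (filt_subspace _)); first by rewrite -s0; apply: filt_odd.
apply: (subspaceZ _ (filt_subspace _)); apply: filt_even.
  by have := brk_part (obp j) (obp i).
by apply: filt_le Fb; rewrite leq_pred.
Qed.

(** After bringing the two equal letters together, z z is half of [z, z],
    which is even. *)
Lemma odd_word_repeat s a : filt 0 a -> ~~ uniq s -> filt (size s).-1 (odd_word s a).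
Proof.
move=> Fa; elim: s => // i s IH; rewrite /= negb_and negbK.
have s0 j : j \in s -> (size s).-1.+1 = size s by case: (s).
case/orP=> [is_|/[dup] us /IH H]; last first.
  have s1 : (size s).-1.+1 = size s by case: (s) us.
  by rewrite -s1; apply: filt_odd.
have [c [b [Fb Fr]]] := odd_word_swap Fa is_.
have -> : act (ob i) (odd_word s a) = act (ob i) (odd_word s a - c *: act (ob i) b) +
    (c / 2) *: act (brk (ob i) (ob i)) b.
  rewrite (act_brk _ (obp i) (obp i)) /= expr1 !(actDr, actNr, actZr).
  by module_over K; field.
apply: (subspaceD (filt_subspace _)).
  by rewrite -(s0 _ is_); apply: filt_odd.
apply: (subspaceZ _ (filt_subspace _)); apply: filt_even.
  by have := brk_part (obp i) (obp i).
by apply: filt_le Fb; rewrite leq_pred.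
Qed.

(** A word of more than dim g_1 basis elements of the odd part has a repeated
    letter. *)
Lemma filt_stable v : filt d.+1 v -> filt d v.
Proof.
move/filt_odd_words; apply: (@lspan_min _ _ _ (filt d)); first exact: filt_subspace.
move=> _ [s [a [sd Fa ->]]]; move: sd; rewrite leq_eqVlt => /orP[/eqP sd|sd].
  have -> : d = (size s).-1 by rewrite sd.
  apply: odd_word_repeat => //; apply/negP => /card_uniqP us.
  by have := max_card (mem s); rewrite us card_ord sd ltnn.
by apply: filt_le (odd_word_filt s Fa).
Qed.

Lemma filt_generated v : generated u0 v -> filt d v.
Proof.
apply; last by apply: (filt_le (leq0n _)) => U.
have [F0 FL] := filt_subspace d; split=> // x u Fu.
have [x0 [x1 [p0 p1 ->]]] := part_split x; rewrite actDl.
apply: (subspaceD (filt_subspace d)); first exact: filt_even.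
by apply: filt_stable; apply: filt_odd.
Qed.

Variables (E3 F3 : 'I_3 -> g).
Hypothesis sl2 : forall j, [/\ has_root (E3 j) (even_root j),
  has_root (F3 j) (- even_root j) & brk (E3 j) (F3 j) = H3 g j].
Variable j : 'I_3.
Local Notation E := (E3 j).
Local Notation F := (F3 j).
Local Notation H := (H3 g j).
Local Notation cas := (cas E3 F3 (M := M) j).
Local Notation cas_sub := (cas_sub E3 F3 (M := M) j).

(** The product of the operators cas - m^2 over the list. *)
Definition cas_prod (ms : seq int) v : M := foldr cas_sub v ms.

Lemma cas_sub_linear m : linear (cas_sub m).
Proof.
by move=> c u v; rewrite /cas_sub (cas_linear E3 F3 j c u v); module_over K.
Qed.

Lemma cas_prod_linear ms : linear (cas_prod ms).
Proof. by move=> c u v; elim: ms => //= m ms ->; apply: cas_sub_linear. Qed.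

Lemma cas_sub_even m x v : x \in part false -> cas_sub m (act x v) = act x (cas_sub m v).
Proof.
by move=> xp; rewrite /cas_sub (cas_even zeta1 sl2) // !(actDr, actNr, actZr).
Qed.

Lemma cas_prod_even ms x v : x \in part false ->
  cas_prod ms (act x v) = act x (cas_prod ms v).
Proof. by move=> xp; elim: ms => //= m ms ->; rewrite cas_sub_even. Qed.

Lemma cas_subC m n v : cas_sub m (cas_sub n v) = cas_sub n (cas_sub m v).
Proof.
rewrite /cas_sub; have L := cas_linear E3 F3 (M := M) j.
by rewrite !(linB L) !(linZ L); module_over K.
Qed.

Lemma cas_prod_sub ms m v : cas_prod ms (cas_sub m v) = cas_sub m (cas_prod ms v).
Proof. by elim: ms => //= n ms ->; rewrite cas_subC. Qed.

Lemma cas_prod_cat ms ns v : cas_prod (ms ++ ns) v = cas_prod ms (cas_prod ns v).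
Proof. by rewrite /cas_prod foldr_cat. Qed.

Lemma cas_prodC ms ns v : cas_prod ms (cas_prod ns v) = cas_prod ns (cas_prod ms v).
Proof. by elim: ms => //= m ms ->; rewrite cas_prod_sub. Qed.

Definition spread (ms : seq int) : seq int := flatten [seq [:: m + 1; m - 1] | m <- ms].

Let Ep : E \in part false.
Proof. by have [r _ _] := sl2 j; rewrite -(even_root_parity j); apply: root_part. Qed.
Let Fp : F \in part false.
Proof.
by have [_ r _] := sl2 j; rewrite -(even_root_parity j) -root_parityN; apply: root_part.
Qed.
Let Hp : H \in part false. Proof. exact: H3_part. Qed.

Lemma cas_prod_doublet yp ym ms a b :
  brk H yp = yp -> brk H ym = - ym -> brk E yp = 0 -> brk E ym = yp ->
  brk F yp = ym -> brk F ym = 0 ->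
  cas_prod ms a = 0 -> cas_prod ms b = 0 ->
  cas_prod (spread ms) (act yp a + act ym b) = 0.
Proof.
move=> h1 h2 h3 h4 h5 h6; elim: ms a b => [|m ms IH] a b /= Za Zb.
  by rewrite Za Zb !act0r addr0.
pose Z v := cas_prod ms v = 0.
have ZS : subspace Z.
  have L := cas_prod_linear ms; split; first exact: (lin0 L).
  by move=> c u v Zu Zv; rewrite /Z L Zu Zv scaler0 addr0.
have Ze x v : x \in part false -> Z v -> Z (act x v).
  by move=> xp Zv; rewrite /Z cas_prod_even // Zv act0r.
have ZOm c p : Z p.1 -> Z p.2 -> Z (Omc E3 F3 j c p).1 /\ Z (Omc E3 F3 j c p).2.
  case: p => u v /= Zu Zv; split.
    apply: (subspaceD ZS); last exact: (subspaceZ _ ZS).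
    by apply: (subspaceD ZS); [apply: Ze | apply: (subspaceZ _ ZS); apply: Ze].
  apply: (subspaceD ZS); last exact: (subspaceZ _ ZS).
  by apply: (subspaceB ZS); [apply: (subspaceZ _ ZS); apply: Ze | apply: Ze].
have := doublet_map_cas_sub2 zeta1 sl2 h1 h2 h3 h4 h5 h6 m (a, b).
rewrite -[doublet_map _ _ _]/(act yp a + act ym b) -!cas_prod_sub => ->.
set p := (_, _); have [q1 q2] : Z p.1 /\ Z p.2 by rewrite /Z /p /= !cas_prod_sub.
have [{}q1 {}q2] := ZOm (3 + m%:~R) p q1 q2.
have [{}q1 {}q2] := ZOm (3 - m%:~R) _ q1 q2.
exact: IH.
Qed.

Lemma odd_root_doublet x s : has_root x s -> root_parity s -> x != 0 ->
  coord3 j s = 1 \/ coord3 j s = -1.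
Proof.
move=> xs sp x0; have := root_in_list zeta1 xs x0; rewrite in_cons => /orP[/eqP sE|].
  by rewrite sE in sp.
move: sp; rewrite nonzero_rootsE !inE => sp.
by do 13?[case/orP => [/eqP sE|]]; [..|move/eqP => sE]; move: sp; rewrite sE //;
  rewrite /coord3; have [->|->|->] := I3_cases j; rewrite ?val_i1 ?val_i2 /=; auto.
Qed.

Lemma root_too_far x s : has_root x s -> (3 <= `|coord3 j s|)%R -> x = 0.
Proof.
move=> xs H3; apply: (notroot0 zeta1 xs); apply: contraTN H3 => H; rewrite -ltNge.
move: H; rewrite in_cons nonzero_rootsE !inE.
by do 14?[case/orP => [/eqP ->|]]; [..|move/eqP ->]; rewrite /coord3;
  have [->|->|->] := I3_cases j; rewrite ?val_i1 ?val_i2.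
Qed.

(** An odd root vector has weight 1 or -1 for H, so it belongs to a doublet
    together with its bracket with F or E. *)
Lemma cas_prod_odd z ms a : z \in part true -> cas_prod ms a = 0 ->
  cas_prod (spread ms) (act z a) = 0.
Proof.
move=> /(part_lspan zeta1) zp' Za; have L := cas_prod_linear (spread ms).
apply: (@lspan_min _ _ _ (fun z => cas_prod (spread ms) (act z a) = 0)) zp'.
  split; first by rewrite act0l (lin0 L).
  by move=> c x y Zx Zy; rewrite actDl actZl L Zx Zy scaler0 addr0.
move=> x [[s xs sp] _]; have [->|x0] := eqVneq x 0; first by rewrite act0l (lin0 L).
have [rE rF EFH] := sl2 j; have Z0 : cas_prod ms 0 = 0 by rewrite (lin0 (cas_prod_linear ms)).
have Hx := H3_root j xs.
have ce : coord3 j (even_root j) = 2 by rewrite coord3_even eqxx.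
have [s1|s1] := odd_root_doublet xs sp x0; rewrite s1 ?scale1r in Hx.
  have Ex : brk E x = 0.
    apply: (root_too_far (has_root_brk rE xs)).
    by rewrite coord3D ce s1.
  have := @cas_prod_doublet x (brk F x) ms a 0 Hx _ Ex _ erefl _ Za Z0.
  rewrite act0r addr0; apply.
  - by rewrite (H3_root j (has_root_brk rF xs)) coord3D coord3N ce s1 scaleN1r.
  - by rewrite (jac0 _ _ Ep) EFH Hx Ex brk0r addr0.
  - apply: (root_too_far (has_root_brk rF (has_root_brk rF xs))).
    by rewrite !coord3D coord3N ce s1.
have {}Hx : brk H x = - x by rewrite Hx scaleN1r.
have Fx : brk F x = 0.
  apply: (root_too_far (has_root_brk rF xs)).
  by rewrite coord3D coord3N ce s1.
have := @cas_prod_doublet (brk E x) x ms 0 a _ Hx _ erefl _ Fx Z0 Za.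
rewrite act0r add0r; apply.
- by rewrite (H3_root j (has_root_brk rE xs)) coord3D ce s1 scale1r.
- apply: (root_too_far (has_root_brk rE (has_root_brk rE xs))).
  by rewrite !coord3D ce s1.
- by rewrite (jac0 _ _ Fp) (skewE Fp Ep) // EFH brkNl Hx opprK Fx brk0r addr0.
Qed.

Fixpoint spectrum (m0 : int) n : seq int :=
  if n is n'.+1 then spectrum m0 n' ++ spread (spectrum m0 n') else [:: m0].

Lemma spectrum_bound m0 n m : m \in spectrum m0 n -> (`|m| <= `|m0| + n%:Z)%R.
Proof.
elim: n m => [|n IH] m /=; first by rewrite inE => /eqP->; rewrite addr0.
rewrite mem_cat => /orP[/IH|]; first by lia.
by case/flattenP => _ /mapP[k /IH kn ->]; rewrite !inE => /orP[] /eqP->; lia.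
Qed.

Lemma filt_cas m0 n v : cas u0 = (m0%:~R ^+ 2) *: u0 -> filt n v ->
  cas_prod (spectrum m0 n) v = 0.
Proof.
move=> cu0; elim: n v => [|n IH] v.
  move=> G; apply: (G (fun v => cas_prod [:: m0] v = 0)) => /=.
  - split; first exact: (lin0 (cas_sub_linear m0)).
    by move=> c a b Ea Eb; rewrite cas_sub_linear Ea Eb scaler0 addr0.
  - by move=> x u xp Eu; rewrite cas_sub_even // Eu act0r.
  - by rewrite /cas_sub cu0 subrr.
have L := cas_prod_linear (spectrum m0 n.+1).
apply: (@lspan_min _ _ _ (fun v => cas_prod (spectrum m0 n.+1) v = 0)).
  split; first exact: (lin0 L).
  by move=> c a b Ea Eb; rewrite L Ea Eb scaler0 addr0.
move=> {}v [/IH Fv|[x [a [xp /IH Fa ->]]]]; rewrite [spectrum _ _]/= cas_prod_cat.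
  by rewrite cas_prodC Fv (lin0 (cas_prod_linear _)).
by rewrite cas_prod_odd // (lin0 (cas_prod_linear _)).
Qed.

(** Modulo U, E kills v, so [cas] acts on v by (s + 1)^2, where s is the
    H-weight of v; this number must be the square of an element of the
    spectrum. *)
Lemma cas_singular (U : M -> Prop) m0 v s : cas u0 = (m0%:~R ^+ 2) *: u0 ->
  submodule U -> generated u0 v -> has_weight v s -> ~ U v -> U (act E v) ->
  (`|coord3 j s + 1| <= `|m0| + d%:Z)%R.
Proof.
move=> cu0 UM Gv vs nUv UEv; have US := submodule_subspace UM; have [_ _ Ua] := UM.
have Hv : act H v = (coord3 j s)%:~R *: v.
  case: vs; rewrite /H3 /coord3 /h_2eps1 /h_2eps2 -/i1 -/i2.
  by have [->|->|->] := I3_cases j; rewrite ?val_i1 ?val_i2.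
have cas_mod m : U (cas_sub m v - ((coord3 j s + 1)%:~R ^+ 2 - m%:~R ^+ 2) *: v).
  have -> : cas_sub m v - ((coord3 j s + 1)%:~R ^+ 2 - m%:~R ^+ 2) *: v = 4 *: act F (act E v).
    by rewrite /cas_sub /cas Hv actZr Hv rmorphD /=; module_over K.
  by apply: subspaceZ => //; apply: Ua.
have Ucas m (w : M) : U w -> U (cas_sub m w).
  move=> Uw; apply: subspaceB => //; last exact: subspaceZ.
  apply: subspaceD => //; last by apply: subspaceZ => //; apply: (Ua); apply: (Ua).
  apply: subspaceD => //; apply: subspaceD => //; first by apply: (Ua); apply: (Ua).
  by apply: subspaceZ => //; apply: Ua.
have prodU ms : U (cas_prod ms v - (\prod_(m <- ms) ((coord3 j s + 1)%:~R ^+ 2 - m%:~R ^+ 2)) *: v).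
  elim: ms => [|m ms IH] /=.
    by rewrite big_nil scale1r subrr; case: US.
  rewrite big_cons; set c := \prod_(_ <- _) _.
  have -> : cas_sub m (cas_prod ms v) - (((coord3 j s + 1)%:~R ^+ 2 - m%:~R ^+ 2) * c) *: v =
     cas_sub m (cas_prod ms v - c *: v) +
     c *: (cas_sub m v - ((coord3 j s + 1)%:~R ^+ 2 - m%:~R ^+ 2) *: v).
    rewrite (linB (cas_sub_linear m)) (linZ (cas_sub_linear m)); module_over K.
  by apply: subspaceD => //; [apply: Ucas | apply: subspaceZ].
have := prodU (spectrum m0 d); rewrite (filt_cas cu0 (filt_generated Gv)) sub0r -scaleNr => Uc.
have : \prod_(m <- spectrum m0 d) ((coord3 j s + 1)%:~R ^+ 2 - m%:~R ^+ 2) == 0 :> K.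
  apply: contra_notT nUv => c0; rewrite -oppr_eq0 in c0.
  by have := subspaceZ (- \prod_(m <- spectrum m0 d) ((coord3 j s + 1)%:~R ^+ 2 - m%:~R ^+ 2))^-1 US Uc;
     rewrite scalerA mulVf // scale1r.
rewrite prodf_seq_eq0 => /hasP[m /spectrum_bound mb]; rewrite /= -!rmorphXn -rmorphB /= intr_eq0.
rewrite subr_eq0 eqf_sqr => /orP[] /eqP ->; rewrite ?normrN //.
Qed.

End Filtration.

(** * Subquotients of the cofree module *)

Section InducedMaps.
Variables (K : fieldType) (g : lieSuperalgebra K).

Lemma induced_map (M N : superModule g) (P : M -> Prop) (Q : N -> Prop)
    (PM : graded_submodule P) (QN : graded_submodule Q) (phi : {linear M -> N}) :
  intertwining phi -> (forall x, P x -> Q (phi x)) ->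
  exists psi : {linear quo_module PM -> quo_module QN}, intertwining psi /\
    forall x, psi (quo_proj PM x) = quo_proj QN (phi x).
Proof.
move=> phiP PQ; have /choice[r rP] := quo_proj_onto (PM := PM).
pose psi0 q := quo_proj QN (phi (r q)).
have psiE x : psi0 (quo_proj PM x) = quo_proj QN (phi x).
  apply/quo_proj_eq; rewrite -linearB; apply: PQ; apply/(quo_proj_eq PM).
  exact: rP.
have psi_lin : linear psi0.
  move=> c q q'; rewrite -[q]rP -[q']rP -linearP !psiE.
  by rewrite !linearP.
pose L := GRing.isLinear.Build _ _ _ _ psi0 psi_lin.
pose psi : {linear quo_module PM -> quo_module QN} := HB.pack psi0 L.
exists psi; split=> // x q; rewrite -[q]rP -quo_proj_intertwining.
by rewrite -[psi _]/(psi0 _) -[psi (quo_proj _ _)]/(psi0 _) !psiE phiP quo_proj_intertwining.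
Qed.

Lemma sub_inclusion (M : superModule g) (P Q : M -> Prop) (PM : graded_submodule P)
    (QM : graded_submodule Q) : (forall x, P x -> Q x) ->
  exists phi : {linear sub_module PM -> sub_module QM}, intertwining phi /\
    forall x, sub_incl QM (phi x) = sub_incl PM x.
Proof.
move=> PQ.
have /choice[phi0 phi0P] : forall x : sub_module PM, exists y, sub_incl QM y = sub_incl PM x.
  by move=> x; apply: sub_incl_onto; apply: PQ; apply: sub_inclP.
have phi_lin : linear phi0.
  move=> c x y; apply: (sub_incl_inj (PM := QM)).
  by rewrite phi0P !linearP !phi0P.
pose L := GRing.isLinear.Build _ _ _ _ phi0 phi_lin.
pose phi : {linear sub_module PM -> sub_module QM} := HB.pack phi0 L.
exists phi; split=> // x y; apply: (sub_incl_inj (PM := QM)).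
rewrite sub_incl_intertwining -[phi _]/(phi0 _) -[phi y]/(phi0 y) !phi0P.
by rewrite sub_incl_intertwining.
Qed.

End InducedMaps.

Section Subquotients.
Variables (K : numFieldType) (zeta : K) (g : D21 zeta).
Hypothesis zeta1 : 1 + zeta != 0.
Local Notation e := (@D21_e K zeta g).
Variable l : weight.
Local Notation N := (cofree g zeta1 l).
Local Notation module := (superModule g).
Implicit Types (P Q R : N -> Prop).

Lemma cofree_graded P : submodule P -> graded_submodule P.
Proof. by move=> PM; apply: submodule_graded PM; [apply: cofree_integral | apply: cofree_parity]. Qed.

Section OneSubquotient.
Variables (P Q : N -> Prop) (PM : submodule P) (QM : submodule Q).

Definition subm : module := sub_module (cofree_graded PM).
Local Notation incl := (sub_incl (cofree_graded PM)).

Lemma incl_intertwining : intertwining incl. Proof. exact: sub_incl_intertwining. Qed.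
Lemma incl_inj : injective incl. Proof. exact: sub_incl_inj. Qed.

Lemma subm_integral : integral_weight_module subm.
Proof. exact: embedded_integral incl_intertwining incl_inj. Qed.
Lemma subm_locally_finite : locally_finite_nplus subm.
Proof. exact: embedded_locally_finite incl_intertwining incl_inj. Qed.
Lemma subm_parity : weight_parity subm.
Proof.
have [a aP] := @cofree_parity _ _ g zeta1 l; exists a => v s vs.
exact: aP (intertwining_weight incl_intertwining vs).
Qed.

Definition trace (x : subm) := Q (incl x).

Lemma trace_submodule : submodule trace.
Proof.
case: QM => Q0 QL Qa; split=> [|c u v|x v]; rewrite /trace.
- by rewrite linear0.
- by rewrite linearP; apply: QL.
- by rewrite incl_intertwining; apply: Qa.
Qed.

Lemma trace_graded : graded_submodule trace.
Proof. exact: submodule_graded subm_integral subm_parity trace_submodule. Qed.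

Definition subquo : module := quo_module trace_graded.
Definition subquo_proj : {linear subm -> subquo} := quo_proj trace_graded.

Lemma subquo_proj0 x : subquo_proj x = 0 <-> Q (incl x).
Proof. exact: quo_proj0. Qed.
Lemma subquo_onto q : exists x, subquo_proj x = q.
Proof. exact: quo_proj_onto. Qed.
Lemma subquo_intertwining : intertwining subquo_proj.
Proof. exact: quo_proj_intertwining. Qed.

Lemma subquo_integral : integral_weight_module subquo.
Proof. exact: surjective_integral subquo_intertwining subquo_onto subm_integral. Qed.
Lemma subquo_locally_finite : locally_finite_nplus subquo.
Proof. exact: surjective_locally_finite subquo_intertwining subquo_onto subm_locally_finite. Qed.

Lemma subquo_irreducible : (exists v, P v /\ ~ Q v) ->
  (forall R, submodule R -> (forall x, Q x -> P x -> R x) -> (forall x, R x -> P x) ->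
    (forall x, R x -> Q x) \/ (forall x, P x -> R x)) ->
  irreducible subquo.
Proof.
move=> [v [Pv nQv]] cov; split.
  have [y yv] := sub_incl_onto (cofree_graded PM) Pv.
  by exists (subquo_proj y) => /subquo_proj0; rewrite yv.
move=> W [WM _]; pose R x := exists y, incl y = x /\ W (subquo_proj y).
have RM : submodule R.
  case: WM => W0 WL Wa; split=> [|c _ _ [y [<- Wy]] [z [<- Wz]]|x _ [y [<- Wy]]].
  - by exists 0; rewrite !linear0.
  - by exists (c *: y + z); rewrite !linearP; split=> //; apply: WL.
  - by exists (act x y); rewrite incl_intertwining subquo_intertwining; split=> //; apply: Wa.
have [||RQ|PR] := cov R RM.
- move=> x Qx Px; have [y yx] := sub_incl_onto (cofree_graded PM) Px.
  exists y; split=> //; have -> : subquo_proj y = 0 by apply/subquo_proj0; rewrite yx.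
  by case: WM.
- by move=> _ [y [<- _]]; apply: sub_inclP.
- by left=> q; have [y <-] := subquo_onto q => Wy; apply/subquo_proj0/RQ; exists y.
right=> q; have [y <-] := subquo_onto q.
have [y' [/incl_inj <- Wy]] : R (incl y) by apply: PR; apply: sub_inclP.
exact: Wy.
Qed.

Lemma subquo_hwv v s : P v -> ~ Q v -> has_weight v s -> (forall i, Q (act (e i) v)) ->
  exists w : subquo, hwv w s.
Proof.
move=> Pv nQv vs ev; have [y yv] := sub_incl_onto (cofree_graded PM) Pv.
have ys : has_weight y s.
  by apply: (embedded_weight incl_intertwining incl_inj); rewrite yv.
exists (subquo_proj y); split.
- by move/subquo_proj0; rewrite yv.
- exact: intertwining_weight subquo_intertwining ys.
- by have [a aP] := subm_parity; exists (a (+) root_parity s); exists y => //; apply: aP.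
- move=> i; rewrite -subquo_intertwining; apply/subquo_proj0.
  by rewrite incl_intertwining yv.
Qed.

Lemma subquo_is_L v s : irreducible subquo -> P v -> ~ Q v -> has_weight v s ->
  (forall i, Q (act (e i) v)) -> is_L (s + rho) subquo.
Proof.
move=> irr Pv nQv vs ev; have [w hw] := subquo_hwv Pv nQv vs ev.
by apply: (hwv_is_L zeta1 (v := w)) => //; rewrite addrK.
Qed.

End OneSubquotient.

Lemma vac_generated_submodule : submodule (generated (vac g zeta1 l)).
Proof. exact: generated_submodule. Qed.

Definition irr_module : module := subm vac_generated_submodule.

(** By [submodule_vac], each nonzero submodule contains the generator. *)
Lemma irr_module_irreducible : irreducible irr_module.
Proof.
have [y yv] := sub_incl_onto (cofree_graded vac_generated_submodule) (@generated_self _ _ N (vac g zeta1 l)).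
split; first by exists y => y0; apply: (@vac_neq0 _ _ g zeta1 l); rewrite -yv y0 linear0.
move=> W [WM _]; pose R x := exists2 z : irr_module, W z & sub_incl (cofree_graded vac_generated_submodule) z = x.
have RM : submodule R.
  case: WM => W0 WL Wa; split=> [|c _ _ [a Wa' <-] [b Wb <-]|x _ [a Wa' <-]].
  - by exists 0; rewrite ?linear0.
  - by exists (c *: a + b); rewrite ?linearP //; apply: WL.
  - by exists (act x a); [apply: Wa | rewrite incl_intertwining].
have [all0|] := pselect (forall v, W v -> v = 0); first by left.
move=> n0; right=> v.
have [w [Ww w0]] : exists w, W w /\ w <> 0.
  by apply: contrapT => H; apply: n0 => w Ww; apply: contrapT => w0; apply: H; exists w.
have Rw : R (sub_incl (cofree_graded vac_generated_submodule) w) by exists w.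
have vR := submodule_vac RM Rw (_ : _ <> 0).
have {}vR : R (vac g zeta1 l).
  by apply: vR => E; apply: w0; apply: (incl_inj (PM := vac_generated_submodule)); rewrite E linear0.
have : R (sub_incl (cofree_graded vac_generated_submodule) v).
  exact: (sub_inclP (PM := cofree_graded vac_generated_submodule) v).
by case=> z Wz /(incl_inj (PM := vac_generated_submodule)) <-.
Qed.

Lemma irr_module_is_L : is_L (l + rho) irr_module.
Proof.
have [y yv] := sub_incl_onto (cofree_graded vac_generated_submodule) (@generated_self _ _ N (vac g zeta1 l)).
apply: (hwv_is_L zeta1 (v := y)); first exact: irr_module_irreducible.
rewrite addrK.
have ys : has_weight y l.
  have ii : intertwining (sub_incl (cofree_graded vac_generated_submodule)).
    exact: sub_incl_intertwining.
  have ij : injective (sub_incl (cofree_graded vac_generated_submodule)).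
    exact: sub_incl_inj.
  by apply: (embedded_weight ii ij); rewrite yv; apply: vac_weight.
split=> //.
- by move=> y0; apply: (@vac_neq0 _ _ g zeta1 l); rewrite -yv y0 linear0.
- by have [a aP] := subm_parity vac_generated_submodule; exists (a (+) root_parity l); apply: aP.
- move=> i; apply: (@incl_inj _ vac_generated_submodule); rewrite incl_intertwining linear0 yv.
  by apply: cofree_eq => w; rewrite act_eE linear0 vacE.
Qed.

Lemma irreducible_fg (M : module) : irreducible M -> integral_weight_module M ->
  weight_parity M -> finitely_generated M.
Proof.
move=> [[v v0] irr] Mi Mp; exists [:: v] => U UM Uv.
have [H|//] := irr U (submodule_graded Mi Mp UM).
by case: v0; apply: H; apply: Uv; rewrite mem_head.
Qed.

Lemma irr_module_in_O : in_O irr_module.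
Proof.
split; [|exact: subm_integral|exact: subm_locally_finite].
apply: irreducible_fg; [exact: irr_module_irreducible|exact: subm_integral|exact: subm_parity].
Qed.

Section Extension.
Variables (P Q Q' : N -> Prop) (PM : submodule P) (QM : submodule Q) (QM' : submodule Q').
Hypotheses (Q'Q : forall x, Q' x -> Q x) (QP : forall x, Q x -> P x)
  (exQ : exists x, Q x /\ ~ Q' x) (exP : exists x, P x /\ ~ Q x)
  (proper : forall R, submodule R -> (forall x, R x -> P x) ->
    (forall x, R x -> Q x) \/ (forall x, P x -> R x)).

(** Q' < Q < P, where Q is the only maximal submodule of P: a section of P / Q'
    over P / Q would give a submodule of P, not contained in Q, that meets Q in
    Q', so different from P. *)
Lemma subquo_nonsplit : nonsplit_extension (subquo QM QM') (subquo PM QM).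
Proof.
have [inc [incP incE]] := sub_inclusion (cofree_graded QM) (cofree_graded PM) QP.
have [|iota [iotaP iotaE]] := induced_map (trace_graded QM QM') (trace_graded PM QM') incP.
  by move=> x; rewrite /trace incE.
have idP : intertwining (idfun : {linear subm PM -> subm PM}) by [].
have [|pi [piP piE]] := induced_map (trace_graded PM QM') (trace_graded PM QM) idP.
  by move=> x; apply: Q'Q.
exists (subquo PM QM'), iota, pi; split=> //.
- split; [|exact: subquo_integral|exact: subquo_locally_finite].
  have si : intertwining (subquo_proj PM QM') by exact: quo_proj_intertwining.
  apply: (surjective_fg si); first exact: quo_proj_onto.
  have [v [Pv nQv]] := exP; have [y yv] := sub_incl_onto (cofree_graded PM) Pv.
  exists [:: y] => U UM /(_ y (mem_head _ _)) Uy w.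
  pose R x := exists2 z : subm PM, U z & sub_incl (cofree_graded PM) z = x.
  have RM : submodule R.
    case: UM => U0 UL Ua; split=> [|c _ _ [a Ua' <-] [b Ub <-]|x _ [a Ua' <-]].
    - by exists 0; rewrite ?linear0.
    - by exists (c *: a + b); rewrite ?linearP //; apply: UL.
    - by exists (act x a); [apply: Ua | rewrite incl_intertwining].
  case: (proper RM) => [_ [z _ <-]|RQ|PR]; first exact: sub_inclP.
    by case: nQv; apply: RQ; exists y.
  by have [z Uz /(incl_inj (PM := PM)) <-] := PR _ (sub_inclP w).
- split.
    move=> a b; have [x <-] := subquo_onto a; have [y <-] := subquo_onto b.
    rewrite !iotaE => /quo_proj_eq H; apply/quo_proj_eq.
    by move: H; rewrite /trace -linearB incE.
  move=> w; have [x <-] := subquo_onto w; exists (subquo_proj PM QM' x).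
  exact: piE.
- move=> q; have [x <-] := subquo_onto q; split.
    rewrite piE => /quo_proj0; rewrite /trace /= => Qx.
    have [y yx] := sub_incl_onto (cofree_graded QM) Qx.
    exists (subquo_proj QM QM' y); rewrite iotaE.
    have -> // : inc y = x by apply: (incl_inj (PM := PM)); rewrite incE yx.
  case=> a; have [y <-] := subquo_onto a; rewrite iotaE => <-.
  by rewrite piE; apply/quo_proj0; rewrite /trace /= incE; apply: sub_inclP.
case=> sigma sigmaP sigmaK.
pose R x := exists2 y : subm PM, sub_incl (cofree_graded PM) y = x &
  exists t, subquo_proj PM QM' y = sigma t.
have RM : submodule R.
  split=> [|c _ _ [a <- [s aE]] [b <- [t bE]]|x _ [a <- [s aE]]].
  - by exists 0; rewrite ?linear0 //; exists 0; rewrite !linear0.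
  - exists (c *: a + b); first by rewrite linearP.
    by exists (c *: s + t); rewrite !linearP aE bE.
  - exists (act x a); first by rewrite incl_intertwining.
    by exists (act x s); rewrite sigmaP subquo_intertwining aE.
case: (proper RM) => [_ [y <- _]|RQ|PR]; first exact: sub_inclP.
  have [v [Pv nQv]] := exP; have [y yv] := sub_incl_onto (cofree_graded PM) Pv.
  have [y' y'E] := subquo_onto (sigma (subquo_proj PM QM y)).
  have : Q (sub_incl (cofree_graded PM) y') by apply: RQ; exists y' => //; eexists; apply: y'E.
  move=> Qy'; have E : subquo_proj PM QM y' = subquo_proj PM QM y.
    by rewrite -[RHS]sigmaK -y'E piE.
  have : subquo_proj PM QM y = 0 by rewrite -E; apply/subquo_proj0.
  by move/subquo_proj0; rewrite yv.
have [x [Qx nQ'x]] := exQ.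
have [y yx [t yt]] := PR _ (QP Qx); apply: nQ'x; rewrite -yx.
suff /subquo_proj0 : subquo_proj PM QM' y = 0 by [].
rewrite yt.
have -> : t = 0; last exact: linear0.
rewrite -[t]sigmaK -yt piE; apply/subquo_proj0; rewrite yx //.
Qed.

End Extension.
End Subquotients.

Section SimpleInO.
Variables (K : numFieldType) (zeta : K) (g : D21 zeta).
Hypothesis zeta1 : 1 + zeta != 0.

Lemma exists_L l : exists L : superModule g, is_L l L.
Proof.
by exists (irr_module g zeta1 (l - rho)); have := irr_module_is_L g zeta1 (l - rho); rewrite subrK.
Qed.

Lemma is_L_simple (L : superModule g) l : is_L l L -> simple_in_O L.
Proof.
move=> LL; split; last by case: LL.
apply: isomorphic_in_O (irr_module_in_O g zeta1 (l - rho)).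
apply: is_L_unique LL => //.
by have := irr_module_is_L g zeta1 (l - rho); rewrite subrK.
Qed.

End SimpleInO.

(** * Singular vectors and the lowered vector *)

Section Linkage.
Variables (K : numFieldType) (zeta : K) (g : D21 zeta).
Hypothesis zeta1 : 1 + zeta != 0.
Local Notation e := (@D21_e K zeta g).
Local Notation f := (@D21_f K zeta g).
Variable l : weight.
Local Notation N := (cofree g zeta1 l).
Local Notation module := (superModule g).
Local Notation val := (@sub_val K (seq 'I_3 -> K^o) _ (in_cofree_subspace g zeta1 l)).
Local Notation vac := (vac g zeta1 l).
Implicit Types (P Q R U : N -> Prop).

(** Among the weight vectors in U' outside U, one of the largest height is
    killed modulo U by all e_i. *)
Lemma exists_singular U U' (v0 : N) : submodule U -> submodule U' -> U' v0 -> ~ U v0 ->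
  exists v s, [/\ U' v, ~ U v, has_weight v s & forall i, U (act (e i) v)].
Proof.
move=> UM UM' U'v0 nUv0; have Ni : integral_weight_module N by exact: cofree_integral.
pose P n := exists (v : N) s, [/\ U' v, ~ U v, has_weight v s &
  height l - height s = 2 * n%:Z].
have mkP v s : U' v -> ~ U v -> has_weight v s -> P (`|height l - height s| %/ 2)%N /\
    exists n : nat, height l - height s = 2 * n%:Z.
  move=> U'v nUv vs.
  have [w vw] : exists w, val v w != 0.
    apply: contrapT => H; apply: nUv; suff -> : v = 0 by case: UM.
    apply: cofree_eq => w; rewrite linear0; apply: contrapT => /eqP vw.
    by apply: H; exists w.
  have E := cofree_weight_support vs vw.
  have hE : height l - height s = 2 * (size w)%:Z.
    by rewrite -E heightD heightN height_wsum; lia.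
  split; last by exists (size w).
  by exists v, s; split=> //; rewrite hE; lia.
have exP : exists n, P n.
  have [s [u c]] := integral_comps v0 Ni.
  have U'u := submodule_comps UM' c U'v0; case: c => us vE wu.
  have [t [ts nUt]] : exists t, t \in s /\ ~ U (u t).
    apply: contrapT => H; apply: nUv0; rewrite vE.
    apply: (subspace_sum_seq (submodule_subspace UM)) => t ts.
    by apply: contrapT => nUt; apply: H; exists t.
  by eexists; apply: (mkP (u t) t (U'u _ ts) nUt (wu _ ts)).1.
have [n [[v [s [U'v nUv vs hs]]] nmin]] := nat_min_exists exP.
exists v, s; split=> // i; apply: contrapT => nUe.
have U'e : U' (act (e i) v) by case: UM' => _ _; apply.
have es := act_root (has_root_e g zeta1 i) vs.
have [Pe [m mE]] := mkP _ _ U'e nUe es.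
have := nmin _ Pe; rewrite mE; move: mE hs.
by rewrite heightD height_simple; lia.
Qed.

(** Positive root vectors are iterated brackets of the e_i, and a negative
    root vector cannot have a positive root. *)
Lemma singular_pos_root U (v : N) x a : submodule U -> (forall i, U (act (e i) v)) ->
  a \in pos_roots -> has_root x a -> U (act x v).
Proof.
move=> UM Ue apos xa; have [_ _ Ua] := UM; have US := submodule_subspace UM.
have [->|x0] := eqVneq x 0; first by rewrite act0l; case: US.
have := root_in_list zeta1 xa x0; rewrite in_cons => /orP[/eqP a0|].
  by rewrite a0 in apos.
case/mapP => p pin aE; rewrite aE in apos xa.
have [c ->] := root_line zeta1 pin xa; rewrite actZl; apply: subspaceZ => //.
move: pin; rewrite mem_cat => /orP[ps|ps].
  apply: (side_closed (P := fun y => U (act y v)) (e_part g) Ue _ ps) => a' b' y z ya zb Uy Uz.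
  by rewrite (act_brk _ ya zb); apply: subspaceB => //; [|apply: subspaceZ => //]; apply: (Ua).
have : 0 < height p.1 by apply: height_pos.
move: ps; rewrite /side !inE; do 6?[case/orP => [/eqP ->|]]; [..|move/eqP ->];
  by rewrite /= ?heightD /neg_simple_root ?heightN ?height_simple.
Qed.

Variables (i : 'I_3) (m : nat).
Hypotheses (ij : i != ord0 \/ (m <= 1)%N) (m_gt0 : (0 < m)%N)
  (hm : hval zeta i l = if i == ord0 then 0 else m.-1%:R).

Local Notation u := (dvec g zeta1 l ij).
Local Notation lu := (l - wsum (nseq m i)).

Lemma le_ij k : (k <= m)%N -> i != ord0 \/ (k <= 1)%N.
Proof. by move=> km; case: ij => [->|m1]; [left | right; apply: leq_trans m1]. Qed.

Lemma cartan_diag : D21_cartan_matrix zeta i i = if i == ord0 then 0 else 2.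
Proof.
by rewrite cartanE; have [->|->|->] := I3_cases i; rewrite ?val_i1 ?val_i2 ?I3E.
Qed.

(** The coefficient of a lowering operator in an sl2-module, or in a module
    over the superalgebra generated by e_0, f_0 and h_0. *)
Lemma Fop_delta k : (k < m)%N ->
  Fop zeta l i (delta K (nseq k i)) =
  ((k.+1%:R : K) * (hval zeta i l - (if i == ord0 then 0 else k%:R))) *: delta K (nseq k.+1 i).
Proof.
have hnseq q : hval zeta i (wsum (nseq q i)) = q%:R * D21_cartan_matrix zeta i i.
  elim: q => [|q IH]; first by rewrite /wsum big_nil mul0r; apply: (addrI (hval zeta i 0)); rewrite -hvalD !addr0.
  by rewrite wsum_cons hvalD IH hval_simple // -natr1; ring.
elim: k => [|k IH] km.
  apply/funext => -[|j w]; rewrite scaleE; first by rewrite /= mulr0.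
  rewrite [Fop _ _ _ _ _]/= -[[::]]/(nseq 0 i) Eop_delta andbF.
  rewrite (lin0 (Fop_linear zeta l i)) mulr0 add0r /delta eqseq_cons /Hop /= [i == j]eq_sym.
  case: (j == i); rewrite ?mul0r ?mulr0 // ?mul1r.
  case: (w =P [::]) => [->|_]; rewrite ?mulr0 // /wsum big_nil subr0 if_same subr0.
  by [].
have km' : (k < m)%N by apply: ltnW.
have i0 : i != ord0 by case: ij => // m1; move: km; rewrite ltnNge (leq_trans m1).
apply/funext => -[|j w]; rewrite scaleE; first by rewrite /= mulr0.
rewrite [Fop _ _ _ _ _]/= -[i :: nseq k i]/(nseq k.+1 i) Eop_delta andbT /= {3}/delta eqseq_cons [i == j]eq_sym.
have [_|_] := eqVneq j i; last by rewrite (lin0 (Fop_linear zeta l i)) !(mul0r, mulr0) addr0.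
rewrite /= IH // scaleE mul1r /sgn (negbTE i0) /= expr0 mul1r /Hop.
rewrite -[i :: nseq k i]/(nseq k.+1 i) /delta.
case: (w =P nseq k.+1 i) => [->|_]; last by rewrite !mulr0 addr0.
rewrite hvalD hvalN hnseq cartan_diag (negbTE i0).
by rewrite !mulr1 -![_.+1%:R]natr1; ring.
Qed.

Lemma act_f_dvec k (h1 : i != ord0 \/ (k <= 1)%N) (h2 : i != ord0 \/ (k.+1 <= 1)%N) :
  (k < m)%N -> act (f i) (dvec g zeta1 l h1) =
  ((k.+1%:R : K) * (hval zeta i l - (if i == ord0 then 0 else k%:R))) *: dvec g zeta1 l h2.
Proof.
by move=> km; apply: sub_val_inj; rewrite act_fE /= Fop_delta.
Qed.

Lemma dvec_generated k (h1 : i != ord0 \/ (k <= 1)%N) : (k < m)%N ->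
  generated vac (dvec g zeta1 l h1).
Proof.
elim: k h1 => [|k IH] h1 km.
  by have -> : dvec g zeta1 l h1 = vac by apply: sub_val_inj.
have i0 : i != ord0 by case: ij => // m1; move: km; rewrite ltnNge (leq_trans m1).
have [_ _ Ga] := generated_submodule vac.
have := Ga (f i) _ (IH (or_introl i0) (ltnW km)).
rewrite (act_f_dvec (or_introl i0) h1 (ltnW km)); set c := _ * _ => Gc.
have c0 : c != 0.
  rewrite mulf_neq0 ?pnatr_eq0 // hm (negbTE i0) subr_eq0 eqr_nat.
  by apply/eqP; move: km; lia.
have := subspaceZ c^-1 (submodule_subspace (generated_submodule vac)) Gc.
by rewrite scalerA mulVf // scale1r.
Qed.

Lemma act_e_dvec k : act (e k) u = 0 \/
  (k = i /\ exists h1, act (e k) u = @dvec _ _ g zeta1 l i m.-1 h1).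
Proof.
have [->|ki] := eqVneq k i.
  right; split=> //; exists (le_ij (leq_pred m)); apply: cofree_eq => w.
  by rewrite act_eE !dvecE; case: (m) m_gt0 => //= q _; rewrite eqseq_cons eqxx.
left; apply: cofree_eq => w; rewrite act_eE linear0 dvecE.
by case: (m) m_gt0 => //= q _; rewrite eqseq_cons (negbTE ki).
Qed.

Lemma u_weight : has_weight u lu. Proof. exact: dvec_weight. Qed.

(** By the hypothesis on the weight, the coefficient in [Fop_delta] vanishes
    at the last step. *)
Lemma act_f_last h1 : act (f i) (@dvec _ _ g zeta1 l i m.-1 h1) = 0.
Proof.
have mE : m = m.-1.+1 by rewrite prednK.
have h2 : i != ord0 \/ (m.-1.+1 <= 1)%N by rewrite -mE.
rewrite (act_f_dvec h1 h2) ?prednK // hm.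
by case: ifP => _; rewrite ?subrr mulr0 scale0r.
Qed.

Lemma vac_singular k : act (e k) vac = 0.
Proof. by apply: cofree_eq => w; rewrite act_eE linear0 vacE. Qed.

(** The weight space of u in the module generated by the vacuum is spanned by
    f_i^m applied to the vacuum, which vanishes. *)
Lemma u_notin_generated : ~ generated vac u.
Proof.
move/(_ (hw_span vac) (hw_span_submodule zeta1 (vac_weight g zeta1 l) vac_singular) (hw_span_fw vac [::])).
move=> Su; have := hw_span_proj zeta1 (vac_weight g zeta1 l) Su u_weight.
have fw0 : fw (nseq m i) vac = 0.
  have fwc q h1 : (q < m)%N -> exists c, fw (nseq q i) vac = c *: @dvec _ _ g zeta1 l i q h1.
    elim: q h1 => [|q IH] h1 qm.
      by exists 1; rewrite scale1r; apply: sub_val_inj.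
    have i0 : i != ord0 by case: ij => // m1; move: qm; rewrite ltnNge (leq_trans m1).
    have [c cE] := IH (or_introl i0) (ltnW qm).
    have -> : fw (nseq q.+1 i) vac = act (f i) (fw (nseq q i) vac) by [].
    rewrite cE (actZr (f i) c) (act_f_dvec (or_introl i0) h1 (ltnW qm)) scalerA.
    by eexists.
  rewrite -[m](prednK m_gt0) -[fw _ _]/(act (f i) (fw (nseq m.-1 i) vac)).
  have [|c ->] := fwc m.-1 (le_ij (leq_pred m)); first by rewrite prednK.
  by rewrite (actZr (f i) c) act_f_last scaler0.
move=> H; have : u = 0.
  apply: lspan_empty H => x [w -> E].
  have -> : w = nseq m i by apply: wsum_nseq; apply: oppr_inj; apply: (addrI l).
  exact: fw0.
move=> u0; have /eqP := dvecE g zeta1 l ij (nseq m i); rewrite u0 linear0 eqxx eq_sym.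
by rewrite (negbTE (oner_neq0 _)).
Qed.

End Linkage.

(** * Finite length and linkage along a simple root *)

Section Chain.
Variables (K : numFieldType) (zeta : K) (g : D21 zeta).
Hypothesis zeta1 : 1 + zeta != 0.
Local Notation e := (@D21_e K zeta g).
Local Notation f := (@D21_f K zeta g).
Variable l : weight.
Local Notation N := (cofree g zeta1 l).
Local Notation module := (superModule g).
Local Notation val := (@sub_val K (seq 'I_3 -> K^o) _ (in_cofree_subspace g zeta1 l)).
Local Notation vac := (vac g zeta1 l).
Implicit Types (P Q R U Y : N -> Prop).
Variables (i : 'I_3) (m : nat).
Hypotheses (ij : i != ord0 \/ (m <= 1)%N) (m_gt0 : (0 < m)%N)
  (hm : hval zeta i l = if i == ord0 then 0 else m.-1%:R).
Local Notation u := (dvec g zeta1 l ij).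
Local Notation lu := (l - wsum (nseq m i)).
Local Notation X := (generated u).
Local Notation d := (\dim (ls_part g true)).

Lemma XM : submodule X. Proof. exact: generated_submodule. Qed.
Lemma vacM : submodule (generated vac). Proof. exact: generated_submodule. Qed.

Lemma u_neq0 : u <> 0.
Proof.
move=> u0; have /eqP := dvecE g zeta1 l ij (nseq m i); rewrite u0 linear0 eqxx eq_sym.
by rewrite (negbTE (oner_neq0 _)).
Qed.

Lemma vac_le U x : submodule U -> U x -> x <> 0 -> forall y, generated vac y -> U y.
Proof. by move=> UM Ux x0 y; apply=> //; apply: submodule_vac UM Ux x0. Qed.

(** F E kills u for each triple: for an even simple root by [act_f_last] when
    it is alpha_i, and because e_j u = 0 otherwise; for 2 delta since N has no
    weight with so large a coefficient of delta. *)
Lemma dvec_cas E3 F3 j : (forall j, [/\ has_root (E3 j) (even_root j),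
      has_root (F3 j) (- even_root j), brk (E3 j) (F3 j) = H3 g j &
      j != ord0 -> E3 j = e j /\ F3 j = f j]) ->
  cas E3 F3 j u = ((coord3 j lu + 1)%:~R ^+ 2) *: u.
Proof.
move=> sl2; have FE0 : act (F3 j) (act (E3 j) u) = 0.
  have [rE _ _ jE] := sl2 j; have [j0|j0] := eqVneq j ord0; last first.
    have [-> ->] := jE j0; have [->|[ji [h1 ->]]] := act_e_dvec g zeta1 l ij m_gt0 j.
      by rewrite act0r.
    by rewrite ji (act_f_last g zeta1 ij m_gt0 hm).
  suff -> : act (E3 j) u = 0 by rewrite act0r.
  apply: cofree_eq => w; rewrite linear0; apply: contrapT => /eqP vw.
  have := cofree_weight_support (act_root rE (u_weight g zeta1 l ij)) vw.
  rewrite /even_root j0 => /(congr1 (fun s : weight => s.1.1)) /=.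
  have := wsum1 w; have := wsum1 (nseq m i); rewrite count_nseq /=.
  move=> E1 E2.
  have m1 : (((i == ord0) : nat) * m <= 1)%N.
    by case: ij => [/negbTE ->|]; rewrite ?mul0n //; case: (i == ord0); rewrite ?mul0n ?mul1n.
  move: E1 E2 m1; rewrite eq_sym; set a := (wsum w).1.1; set b := (wsum _).1.1; lia.
rewrite /cas FE0; have Hu : act (H3 g j) u = (coord3 j lu)%:~R *: u.
  case: (u_weight g zeta1 l ij); rewrite /H3 /coord3 /h_2eps1 /h_2eps2 -/i1 -/i2.
  by have [->|->|->] := I3_cases j; rewrite ?val_i1 ?val_i2.
by rewrite Hu actZr Hu rmorphD /=; module_over K.
Qed.

(** The three Casimir operators bound the three coordinates of the weight of a
    singular vector, hence the lengths of the words in its support. *)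
Lemma singular_bounded : exists b : nat, forall U (v : N) s, submodule U -> X v -> ~ U v ->
  has_weight v s -> (forall k, U (act (e k) v)) -> bounded b v.
Proof.
have [E3 [F3 sl2]] := sl2_triples g zeta1.
have sl2' j : [/\ has_root (E3 j) (even_root j), has_root (F3 j) (- even_root j) &
    brk (E3 j) (F3 j) = H3 g j] by case: (sl2 j).
pose B := (absz (coord3 ord0 lu + 1)%R + absz (coord3 i1 lu + 1)%R +
  absz (coord3 i2 lu + 1)%R + d)%N.
exists (absz (height l) + 6 * B.+1 + 1)%N => U v s UM Xv nUv vs Ue w wb.
apply: contrapT => /eqP vw; have E := cofree_weight_support vs vw.
have bnd j : (`|coord3 j s + 1| <= `|coord3 j lu + 1| + d%:Z)%R.
  apply: (cas_singular zeta1 sl2' (dvec_cas j sl2) UM Xv vs nUv).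
  have [rE _ _ _] := sl2 j; apply: singular_pos_root UM Ue _ rE.
  by rewrite /even_root; have [->|->|->] := I3_cases j; rewrite ?val_i1 ?val_i2.
have := congr1 height E; rewrite heightD heightN height_wsum.
have := bnd ord0; have := bnd i1; have := bnd i2.
have -> : height s = 4 * coord3 ord0 s + coord3 i1 s + coord3 i2 s.
  by rewrite /coord3 val_i1 val_i2.
move: wb; rewrite /B; move: (height l) (size w) (coord3 ord0 s) (coord3 i1 s) (coord3 i2 s).
move: (coord3 ord0 lu) (coord3 i1 lu) (coord3 i2 lu) d => c0 c1 c2 d hl sw x y z.
lia.
Qed.

(** The length function is the dimension of the space of bounded functions in
    the submodule.  It increases strictly since a larger submodule has a new
    singular vector, which is bounded. *)
Lemma exists_length : exists (mu : (N -> Prop) -> nat) (b : nat),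
  (forall U, submodule U -> (mu U <= b)%N) /\
  forall U U', submodule U -> submodule U' -> (forall x, U x -> U' x) ->
    (forall x, U' x -> X x) -> (exists x, U' x /\ ~ U x) -> (mu U < mu U')%N.
Proof.
have [b bP] := singular_bounded.
pose ev (v : N) : 'rV[K]_(size (words b)) := \row_j val v (nth [::] (words b) j).
have ev_lin : linear ev by move=> c x y; apply/rowP => j; rewrite !mxE !linearP.
have ev_inj v : bounded b v -> ev v = 0 -> v = 0.
  move=> vb v0; apply: cofree_eq => w; rewrite linear0.
  have [wb|/vb//] := ltnP (size w) b.
  have wi : (index w (words b) < size (words b))%N by rewrite index_mem mem_words.
  have := congr1 (fun A : 'rV[K]_(size (words b)) => A 0 (Ordinal wi)) v0; rewrite !mxE /=.
  by rewrite nth_index // mem_words.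
have bsub : subspace (fun v : N => bounded b v).
  split=> [|c x y Bx By] w wb; first by rewrite linear0.
  by rewrite linearP /= fnE scaleE Bx // By // mulr0 addr0.
have ex U : exists V : {vspace 'rV[K]_(size (words b))}, submodule U ->
    forall r, r \in V <-> exists2 v : N, U v /\ bounded b v & ev v = r.
  have [UM|nU] := pselect (submodule U); last by exists 0%VS.
  have [|V VP] := @prop_vspace K 'rV[K]_(size (words b))
    (fun r => exists2 v : N, U v /\ bounded b v & ev v = r); last by exists V.
  have S := subspaceI (submodule_subspace UM) bsub.
  split; first by exists 0; [case: S | rewrite (lin0 ev_lin)].
  move=> c _ _ [x Sx <-] [y Sy <-]; exists (c *: x + y); last by rewrite ev_lin.
  by case: S => _; apply.
have [V VP] := choice ex.
exists (fun U => \dim (V U)), (size (words b)); split=> [U UM|U U' UM UM' UU' U'X [x [U'x nUx]]].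
  by have := dimvS (subvf (V U)); rewrite dimvf /dim /= mul1n.
have sub : (V U <= V U')%VS.
  apply/subvP => r /(VP U UM)[v [Uv vb] <-]; apply/(VP U' UM').
  by exists v => //; split=> //; apply: UU'.
rewrite ltn_neqAle dimvS // andbT; apply/negP => dE.
have VE : V U = V U' by apply/eqP; rewrite eqEdim sub (eqP dE) leqnn.
have [v [s [U'v nUv vs Ue]]] := exists_singular UM UM' U'x nUx.
have vb := bP U v s UM (U'X _ U'v) nUv vs Ue.
have : ev v \in V U by rewrite VE; apply/(VP U' UM'); exists v.
case/(VP U UM) => v' [Uv' v'b] vE; apply: nUv.
have -> // : v = v'.
apply: subr0_eq; apply: ev_inj; first exact: (subspaceB bsub vb v'b).
by rewrite (linB ev_lin) vE subrr.
Qed.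

Lemma weight_sum (A B : N -> Prop) (v : N) s : submodule A -> submodule B ->
  (exists a b, [/\ A a, B b & v = a + b]) -> has_weight v s ->
  exists a b, [/\ A a, B b, has_weight a s, has_weight b s & v = a + b].
Proof.
move=> AM BM [a [b [Aa Bb vE]]] vs; have Ni : integral_weight_module N by exact: cofree_integral.
pose S (x : N) := (exists t, has_weight x t) /\ (A x \/ B x).
have inS (D : N -> Prop) x : submodule D -> (forall y, D y -> A y \/ B y) -> D x -> lspan S x.
  move=> DM DAB Dx; have [r [c cc]] := integral_comps x Ni.
  have Dc := submodule_comps DM cc Dx; case: cc => _ -> wc.
  apply: (subspace_sum_seq (lspan_subspace _)) => t tr; apply: lspan_gen; split.
    by exists t; apply: wc.
  by apply: DAB; apply: Dc.
have Sv : lspan S v.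
  rewrite vE; apply: subspaceD; first exact: lspan_subspace.
    by apply: (inS A) => //; left.
  by apply: (inS B) => //; right.
have := lspan_proj (act_linearr (h_2delta g)) (act_linearr (h_2eps1 g)) (act_linearr (h_2eps2 g))
  (l := s) _ Sv vs.
case/(_ _)/Wrap => [x [] //|].
have As := submodule_subspace AM; have Bs := submodule_subspace BM.
have Ws := has_weight_subspace N s.
apply: (@lspan_min _ _ _ (fun v => exists a b : N, [/\ A a, B b, has_weight a s, has_weight b s & v = a + b])).
  split; first by exists 0, 0; rewrite addr0; case: As Bs Ws => ? _ [? _] [? _].
  move=> c x y [a1 [b1 [? ? ? ? ->]]] [a2 [b2 [? ? ? ? ->]]].
  exists (c *: a1 + a2), (c *: b1 + b2); case: As Bs Ws => _ H1 [_ H2] [_ H3].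
  split; [exact: H1 | exact: H2 | exact: H3 | exact: H3 |].
  by rewrite scalerDr addrACA.
move=> x [[_ [Ax|Bx]] xs].
  by exists x, 0; rewrite addr0; split=> //; [case: Bs | case: Ws].
by exists 0, x; rewrite add0r; split=> //; [case: As | case: Ws].
Qed.

Definition sum_sub (A B : N -> Prop) (v : N) := exists a b, [/\ A a, B b & v = a + b].

Lemma sum_submodule A B : submodule A -> submodule B -> submodule (sum_sub A B).
Proof.
move=> [A0 AL Aa] [B0 BL Ba]; split.
- by exists 0, 0; rewrite addr0.
- move=> c _ _ [a [b [? ? ->]]] [a' [b' [? ? ->]]].
  exists (c *: a + a'), (c *: b + b'); split; [exact: AL | exact: BL |].
  by rewrite scalerDr addrACA.
move=> x _ [a [b [? ? ->]]]; exists (act x a), (act x b).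
by split; [exact: Aa | exact: Ba | rewrite actDr].
Qed.

Lemma meet_submodule A B : submodule A -> submodule B -> submodule (fun v : N => A v /\ B v).
Proof.
move=> [A0 AL Aa] [B0 BL Ba]; split=> // [c x y [? ?] [? ?]|x v [? ?]].
  by split; [exact: AL | exact: BL].
by split; [exact: Aa | exact: Ba].
Qed.

Lemma zero_submodule : submodule (fun v : N => v = 0).
Proof.
split=> // [c x y -> ->|x v ->]; first by rewrite scaler0 addr0.
by rewrite act0r.
Qed.

Variable L0 : module.
Hypothesis L0_is_L : is_L (l + rho) L0.

Definition linked_weight s := forall L : module, is_L (s + rho) L -> linked L0 L.

(** Y is good if the highest weights of all its composition factors, in the
    form of singular vectors v of subquotients Q / Q', are linked to the
    socle. *)
Definition good Y := forall Q Q' (v : N) s, submodule Q -> submodule Q' ->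
  (forall x, Q' x -> Q x) -> (forall x, Q x -> Y x) -> Q v -> ~ Q' v -> has_weight v s ->
  (forall k, Q' (act (e k) v)) -> linked_weight s.

Lemma is_L_linked (L L' : module) s : is_L s L -> is_L s L' -> linked L L'.
Proof.
move=> HL HL'; apply: rst_step; split; try exact: is_L_simple zeta1 _ _ _.
- exact: (is_L_simple zeta1 HL).
- exact: (is_L_simple zeta1 HL').
- by left; apply: (is_L_unique zeta1 HL HL').
Qed.

Lemma good_vac : good (generated vac).
Proof.
move=> Q Q' v s QM QM' Q'Q Qvac Qv nQ'v vs ev.
have Q'0 x : Q' x -> x = 0.
  move=> Q'x; apply: contrapT => x0; apply: nQ'v.
  by apply: (vac_le QM' Q'x x0); apply: Qvac.
have v0 : v <> 0 by move=> v0; apply: nQ'v; rewrite v0; case: QM'.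
have vE := singular_vac (fun k => Q'0 _ (ev k)).
have vl : has_weight v l.
  by rewrite vE; apply: (subspaceZ _ (has_weight_subspace N l)); apply: vac_weight.
rewrite (has_weight_uniq vs vl v0) => L HL; exact: is_L_linked L0_is_L HL.
Qed.

(** Otherwise take Y, U and P as in the introductory argument: P / (P meet Y)
    is the new factor of U, and it is a nonsplit extension away from a factor
    of Y. *)
Lemma linked_lowered : linked_weight lu.
Proof.
have [mu [b [mub muS]]] := exists_length.
have sub_not (A B : N -> Prop) : ~ (forall x, A x -> B x) -> exists x, A x /\ ~ B x.
  move=> H; apply: contrapT => H'; apply: H => x Ax; apply: contrapT => nBx.
  by apply: H'; exists x.
have vacX x : generated vac x -> X x by apply: (vac_le XM (@generated_self _ _ N u) u_neq0).
have [n [[Y [YM [goodY vacY YX Yn]]] nmax]] := @nat_max_exists (fun n => exists Y,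
    submodule Y /\ [/\ good Y, (forall x, generated vac x -> Y x), (forall x, Y x -> X x) & mu Y = n]) b
  (ex_intro _ _ (ex_intro _ _ (conj vacM (And4 good_vac (fun x H => H) vacX erefl))))
  (fun n H => let: ex_intro Y (conj YM (And4 _ _ _ E)) := H in
     eq_ind _ (fun n => (n <= b)%N) (mub Y YM) _ E).
(* If Y = X, the vector u is singular modulo the socle. *)
have [XY|/sub_not[x0 [Xx0 nYx0]]] := pselect (forall x, X x -> Y x).
  have := goodY X (generated vac) u lu XM vacM vacX XY (@generated_self _ _ N u).
  apply=> //; first exact: (u_notin_generated m_gt0 hm).
    exact: u_weight.
  move=> k; have [->|[_ [h1 ->]]] := act_e_dvec g zeta1 l ij m_gt0 k; first by case: vacM.
  by apply: (dvec_generated ij m_gt0 hm); rewrite prednK.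
exfalso.
have [nU [[U [UM [YU UX exU Un]]] nUmin]] := @nat_min_exists (fun n => exists U,
    submodule U /\ [/\ (forall x, Y x -> U x), (forall x, U x -> X x), (exists x, U x /\ ~ Y x) & mu U = n])
  (ex_intro _ _ (ex_intro _ _ (conj XM (And4 YX (fun x H => H) (ex_intro _ x0 (conj Xx0 nYx0)) erefl)))).
have coverU R : submodule R -> (forall x, Y x -> R x) -> (forall x, R x -> U x) ->
    (forall x, R x -> Y x) \/ (forall x, U x -> R x).
  move=> RM YR RU; have [?|/sub_not exR] := pselect (forall x, R x -> Y x); first by left.
  have [?|/sub_not exR'] := pselect (forall x, U x -> R x); first by right.
  have RX x : R x -> X x by move=> /RU /UX.
  have : (mu U <= mu R)%N by rewrite Un; apply: nUmin; exists R.
  by rewrite leqNgt (muS R U).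
suff goodU : good U.
  have : (mu U <= n)%N by apply: nmax; exists U; split=> //; split=> // x /vacY /YU.
  by rewrite -Yn leqNgt (muS Y U).
move=> Q Q' v s QM QM' Q'Q QU Qv nQ'v vs ev.
(* A singular vector in Y + Q' is replaced by its component in Y. *)
have [Ys|nYs] := pselect (sum_sub Y Q' v).
  have [y [q [Yy Q'q ys qs vE]]] := weight_sum YM QM' Ys vs.
  have QS := submodule_subspace QM; have QS' := submodule_subspace QM'.
  have yE : y = v - q by rewrite vE addrK.
  apply: (goodY (fun x => Y x /\ Q x) (fun x => Y x /\ Q' x) y s) => //.
  - exact: meet_submodule.
  - exact: meet_submodule.
  - by move=> x [? ?]; split=> //; apply: Q'Q.
  - by move=> x [].
  - by split=> //; rewrite yE; apply: subspaceB => //; apply: Q'Q.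
  - by move=> [_ Q'y]; apply: nQ'v; rewrite vE; apply: subspaceD.
  - move=> k; split; first by case: YM => _ _; apply.
    by rewrite yE actDr actNr; apply: subspaceB => //; case: QM' => _ _; apply.
have Q'Y x : Q' x -> Y x.
  have SM := sum_submodule YM QM'.
  case: (coverU _ SM) => [y Yy|_ [y [q [Yy Q'q ->]]]|H Q'x|H].
  - by exists y, 0; rewrite addr0; split=> //; case: QM'.
  - by apply: (subspaceD (submodule_subspace UM)); [apply: YU | apply: QU; apply: Q'Q].
  - by apply: H; exists 0, x; rewrite add0r; split=> //; case: YM.
  - by case: nYs; apply: H; apply: QU.
have nYv : ~ Y v.
  by move=> Yv; apply: nYs; exists v, 0; rewrite addr0; split=> //; case: QM'.
(* Now Q' is inside Y and v is outside, by minimality of U, so v stands for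
   the new factor U / Y. *)
have [nP [[P [PM [PU exP Pn]]] nPmin]] := @nat_min_exists (fun n => exists P,
    submodule P /\ [/\ (forall x, P x -> U x), (exists x, P x /\ ~ Y x) & mu P = n])
  (ex_intro _ _ (ex_intro _ _ (conj UM (And3 (fun x H => H) exU erefl)))).
have PX x : P x -> X x by move=> /PU /UX.
have properY R : submodule R -> (forall x, R x -> P x) ->
    (forall x, R x -> Y x) \/ (forall x, P x -> R x).
  move=> RM RP; have [?|/sub_not exR] := pselect (forall x, R x -> Y x); first by left.
  have [?|/sub_not exR'] := pselect (forall x, P x -> R x); first by right.
  have : (mu P <= mu R)%N.
    by rewrite Pn; apply: nPmin; exists R; split=> //; split=> // x /RP /PU.
  by rewrite leqNgt (muS R P).
pose Q0 (x : N) := P x /\ Y x.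
have Q0M : submodule Q0 by apply: meet_submodule.
have properP R : submodule R -> (forall x, R x -> P x) ->
    (forall x, R x -> Q0 x) \/ (forall x, P x -> R x).
  move=> RM RP; case: (properY R RM RP) => H; [left | by right].
  by move=> x Rx; split; [apply: RP | apply: H].
(* U = Y + P, and the component q of v in P is singular modulo P meet Y. *)
have [y [q [Yy Pq ys qs vE]]] : exists y q : N, [/\ Y y, P q, has_weight y s, has_weight q s & v = y + q].
  apply: weight_sum => //; have SM := sum_submodule YM PM.
  case: (coverU _ SM) => [x Yx|_ [x [p [Yx Pp ->]]]|H|H].
  - by exists x, 0; rewrite addr0; split=> //; case: PM.
  - by apply: (subspaceD (submodule_subspace UM)); [apply: YU | apply: PU].
  - have [x [Px nYx]] := exP; case: nYx; apply: H.
    by exists 0, x; rewrite add0r; split=> //; case: YM.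
  - by apply: H; apply: QU.
have qE : q = v - y by rewrite vE addrC addKr.
have nQ0q : ~ Q0 q.
  by move=> [_ Yq]; apply: nYv; rewrite vE; apply: (subspaceD (submodule_subspace YM)).
have eq k : Q0 (act (e k) q).
  split; first by case: PM => _ _; apply.
  rewrite qE actDr actNr; apply: (subspaceB (submodule_subspace YM)); first exact: Q'Y.
  by case: YM => _ _; apply.
have q0 : q <> 0 by move=> q0; apply: nQ0q; rewrite q0; case: Q0M.
have Q0vac : Q0 vac.
  by split; [apply: submodule_vac PM Pq q0 | apply: vacY; apply: generated_self].
have Q0X x : Q0 x -> X x by move=> [/PX].
(* Q0' is a maximal submodule of Q0; there is one since Q0 contains the vacuum. *)
have [nR [[Q0' [QM0' [Q0'Q0 exQ0 Q0n]]] nRmax]] := @nat_max_exists (fun n => exists R,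
    submodule R /\ [/\ (forall x, R x -> Q0 x), (exists x, Q0 x /\ ~ R x) & mu R = n]) b
  (ex_intro _ _ (ex_intro _ _ (conj zero_submodule (And3
     (fun x x0 => eq_ind_r Q0 (let: And3 H _ _ := Q0M in H) x0)
     (ex_intro _ _ (conj Q0vac (@vac_neq0 _ _ g zeta1 l))) erefl))))
  (fun n H => let: ex_intro Y (conj YM (And3 _ _ E)) := H in
     eq_ind _ (fun n => (n <= b)%N) (mub Y YM) _ E).
have T'irr : irreducible (subquo Q0M QM0').
  apply: subquo_irreducible => // R RM Q0'R RQ0.
  have [?|/sub_not exR] := pselect (forall x, R x -> Q0' x); first by left.
  have [?|/sub_not exR'] := pselect (forall x, Q0 x -> R x); first by right.
  have Q0'R' x : Q0' x -> R x by move=> Q0'x; apply: Q0'R => //; apply: Q0'Q0.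
  have RX x : R x -> X x by move=> /RQ0 /Q0X.
  have : (mu R <= mu Q0')%N by rewrite Q0n; apply: nRmax; exists R.
  by rewrite leqNgt (muS Q0' R).
have Tirr : irreducible (subquo PM Q0M).
  apply: subquo_irreducible; first by exists q.
  by move=> R RM _; apply: properP.
have [x1 [Q0x1 nQ0'x1]] := exQ0.
have [t [s' [Q0t nQ0't ts' et]]] := exists_singular QM0' Q0M Q0x1 nQ0'x1.
have T'L : is_L (s' + rho) (subquo Q0M QM0') by apply: (subquo_is_L T'irr Q0t).
have TL : is_L (s + rho) (subquo PM Q0M) by apply: (subquo_is_L Tirr Pq).
have l1 : linked L0 (subquo Q0M QM0').
  by apply: (goodY Q0 Q0' t s') T'L => // x [].
have l2 : linked (subquo Q0M QM0') (subquo PM Q0M).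
  apply: rst_step; split.
  - exact: (is_L_simple zeta1 T'L).
  - exact: (is_L_simple zeta1 TL).
  - right; apply: subquo_nonsplit => //; first by move=> x [].
    by exists q.
move=> L HL; apply: rst_trans l1 _; apply: rst_trans l2 _.
exact: is_L_linked TL HL.
Qed.

End Chain.

(** * Linkage of the weights of one family *)

Section WeightLinks.
Variables (K : numFieldType) (zeta : K) (g : D21 zeta).
Hypothesis zeta1 : 1 + zeta != 0.
Local Notation module := (superModule g).

(** Stated for all modules with these highest weights, so that no choice of
    representatives is involved. *)
Definition weights_linked (l l' : weight) := forall L L' : module,
  is_L l L -> is_L l' L' -> linked L L'.

Lemma weights_linked_refl l : weights_linked l l.
Proof. by move=> L L' H H'; apply: is_L_linked H H'. Qed.
Lemma weights_linked_sym l l' : weights_linked l l' -> weights_linked l' l.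
Proof. by move=> H L L' HL HL'; apply: rst_sym; apply: H. Qed.
Lemma weights_linked_trans l1 l2 l3 :
  weights_linked l1 l2 -> weights_linked l2 l3 -> weights_linked l1 l3.
Proof.
move=> H12 H23 L L' HL HL'; have [M HM] := exists_L g zeta1 l2.
by apply: rst_trans (H12 _ _ HL HM) (H23 _ _ HM HL').
Qed.

Lemma wsum_nseqE i n : wsum (nseq n i) = simple_root i *+ n.
Proof. by elim: n => [|n IH]; rewrite ?wsum_cons ?IH ?mulrS // /wsum big_nil. Qed.

(** The shift by rho turns the condition on the value m of a coroot at l into
    the value m - 1 at the highest weight, and leaves the odd condition
    unchanged because rho is orthogonal to alpha_0. *)
Lemma weights_linked_simple (l : weight) i m : i != ord0 \/ (m <= 1)%N -> (0 < m)%N ->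
  hval zeta i (l - rho) = (if i == ord0 then 0 else m.-1%:R) ->
  weights_linked l (l - wsum (nseq m i)).
Proof.
move=> ij m0 hm L L' HL HL'.
have HL0 : is_L (l - rho + rho) L by rewrite subrK.
by apply: (linked_lowered zeta1 ij m0 hm HL0); rewrite addrAC subrK.
Qed.

Lemma weights_linked_odd x y z : (1 + zeta) * x%:~R + y%:~R + zeta * z%:~R = 0 ->
  weights_linked (x, y, z) (x - 1, y + 1, z + 1).
Proof.
move=> at0.
have := @weights_linked_simple (x, y, z) ord0 1 (or_intror isT) isT.
have -> : (x, y, z) - wsum (nseq 1 ord0) = (x - 1, y + 1, z + 1) :> weight.
  by rewrite /wsum big_seq1.
apply; rewrite eqxx /hval /= !rmorphB /=.
have -> : (1 + zeta) * (x%:~R - (-1)%:~R) + (y%:~R - 1%:~R) + zeta * (z%:~R - 1%:~R) =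
  (1 + zeta) * x%:~R + y%:~R + zeta * z%:~R by ring.
by rewrite at0 mulr0.
Qed.

Lemma weights_linked_neg2 x y z : weights_linked (x, y, z) (x, - y, z).
Proof.
wlog y0 : y / 0 < y.
  move=> H; have [y0|y0|->] := ltrgtP y 0; last by rewrite oppr0; apply: weights_linked_refl.
    by apply: weights_linked_sym; rewrite -{2}[y]opprK; apply: H; rewrite oppr_gt0.
  exact: H.
case: y y0 => // n n0.
have := @weights_linked_simple (x, n%:Z, z) i1 n (or_introl _) n0.
rewrite neq10 wsum_nseqE simple_root1.
have -> : (x, n%:Z, z) - (0, 2, 0) *+ n = (x, - n%:Z, z) :> weight.
  have E q : (0, 2, 0) *+ q = (0, 2 * q%:Z, 0) :> weight.
    by elim: q => // q IH; rewrite mulrS IH; congr (_, _, _); rewrite /=; lia.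
  by rewrite E; congr (_, _, _); rewrite /=; lia.
apply=> //; rewrite /hval val_i1 /=.
by rewrite -[m in m.-1%:R]prednK // -[X in X%:~R](_ : (n.-1%:Z) = _) //=; lia.
Qed.

Lemma weights_linked_neg3 x y z : weights_linked (x, y, z) (x, y, - z).
Proof.
wlog z0 : z / 0 < z.
  move=> H; have [z0|z0|->] := ltrgtP z 0; last by rewrite oppr0; apply: weights_linked_refl.
    by apply: weights_linked_sym; rewrite -{2}[z]opprK; apply: H; rewrite oppr_gt0.
  exact: H.
case: z z0 => // n n0.
have := @weights_linked_simple (x, y, n%:Z) i2 n (or_introl _) n0.
rewrite neq20 wsum_nseqE simple_root2.
have -> : (x, y, n%:Z) - (0, 0, 2) *+ n = (x, y, - n%:Z) :> weight.
  have E q : (0, 0, 2) *+ q = (0, 0, 2 * q%:Z) :> weight.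
    by elim: q => // q IH; rewrite mulrS IH; congr (_, _, _); rewrite /=; lia.
  by rewrite E; congr (_, _, _); rewrite /=; lia.
apply=> //; rewrite /hval val_i2 /=.
by rewrite -[X in X%:~R](_ : (n.-1%:Z) = _) //=; lia.
Qed.

Lemma weights_linked_signs x y z y' z' : `|y| = `|y'| -> `|z| = `|z'| ->
  weights_linked (x, y, z) (x, y', z').
Proof.
move=> /eqP + /eqP; rewrite !eqr_norm2 => /orP[] /eqP -> /orP[] /eqP ->.
- exact: weights_linked_refl.
- exact/weights_linked_sym/weights_linked_neg3.
- exact/weights_linked_sym/weights_linked_neg2.
apply: (@weights_linked_trans _ (x, y', - z')).
  exact/weights_linked_sym/weights_linked_neg2.
exact/weights_linked_sym/weights_linked_neg3.
Qed.

End WeightLinks.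

Section Families.
Variables (K : numFieldType) (p d : nat).
Hypotheses (p_gt0 : (0 < p)%N) (d_gt0 : (0 < d)%N).
Local Notation zeta := (p%:R / d%:R : K).
Variable g : D21 zeta.

Lemma zeta1_neq0 : 1 + zeta != 0.
Proof.
have d0 : d%:R != 0 :> K by rewrite pnatr_eq0 -lt0n.
have -> : 1 + zeta = (d + p)%:R / d%:R by rewrite natrD; field.
by rewrite mulf_neq0 ?invr_eq0 // pnatr_eq0 -lt0n addn_gt0 d_gt0.
Qed.
Let zeta1 := zeta1_neq0.

(** The weights of WT_c, for c in Z, with the signs that make them orthogonal
    to the odd simple root. *)
Definition family (c n : int) : weight := (n, - (n + c * p%:Z), - (n - c * d%:Z)).

Lemma family_step c n : weights_linked g (family c n) (family c (n - 1)).
Proof.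
have -> : family c (n - 1) = (n - 1, - (n + c * p%:Z) + 1, - (n - c * d%:Z) + 1).
  by rewrite /family; congr (_, _, _); ring.
apply: weights_linked_odd => //.
have d0 : d%:R != 0 :> K by rewrite pnatr_eq0 -lt0n.
by rewrite !rmorphN !rmorphD !rmorphN !rmorphM /= -!pmulrn; field.
Qed.

Lemma family_linked c n : weights_linked g (family c 0) (family c n).
Proof.
elim: n => [|n IH|n IH]; first exact: weights_linked_refl.
  apply: (weights_linked_trans zeta1 IH); apply: weights_linked_sym.
  by have := @family_step c (n.+1%:Z); rewrite (_ : n.+1%:Z - 1 = n%:Z) //; lia.
apply: (weights_linked_trans zeta1 IH).
by have := @family_step c (- n%:Z); rewrite (_ : - n%:Z - 1 = - n.+1%:Z) //; lia.
Qed.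

Lemma signedP a (n : int) : signed a `|n| = n \/ signed a `|n| = - n.
Proof.
rewrite /signed; case: (ger0P n) => n0; case: a;
  rewrite ?expr1 ?expr0 ?mul1r ?mulN1r ?opprK; first [by left | by right].
Qed.

Lemma norm_signed a (n : int) : `|signed a `|n| | = `|n|.
Proof. by case: (signedP a n) => ->; rewrite ?normrN. Qed.

Definition base (k : nat) : weight := family k%:Z 0.

(** If the first coordinate is n, the weight is in the family of k up to the
    signs of the other two; if it is - n, it is in the family of - k. *)
Lemma WT_linked k f : WT p d k f -> weights_linked g (base k) f.
Proof.
move=> [n [a [b [c ->]]]]; rewrite /f_weight.
set y := signed b _; set z := signed c _.
have yE : `|y| = `|n + k%:Z * p%:Z| by rewrite norm_signed PoszM.
have zE : `|z| = `|n - k%:Z * d%:Z| by rewrite norm_signed PoszM.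
have [->|->] := signedP a n.
  apply: (weights_linked_trans zeta1 (@family_linked k%:Z n)).
  by apply: weights_linked_signs; rewrite ?normrN ?yE ?zE.
apply: (@weights_linked_trans _ _ _ zeta1 _ (family (- k%:Z) 0)).
  by apply: weights_linked_signs => //; rewrite -[LHS]normrN; congr `|_|; ring.
apply: (weights_linked_trans zeta1 (@family_linked (- k%:Z) (- n))).
apply: weights_linked_signs => //; rewrite ?yE ?zE; congr `|_|; ring.
Qed.

Hypothesis p_d_coprime : coprime p d.

Lemma signed_exists (y t : int) : `|y| = `|t| -> exists a, y = signed a `|t|.
Proof.
move=> <-; exists (y < 0); rewrite /signed.
by case: (ltP y 0) => y0; rewrite ?(ltr0_norm y0) ?(ger0_norm y0) ?expr1 ?expr0 ?mulN1r ?mul1r ?opprK.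
Qed.

(** (d + p) x = d y + p z up to signs; p divides d (y - x), hence y - x, and
    the quotient t determines z. *)
Lemma atypical_WT (l : weight) : atypical zeta l -> exists k, WT p d k l.
Proof.
case=> al oal; case: l => [[x y] z].
have [b [c [[nb nc] form]]] : exists b c : int, (`|b| = 1 /\ `|c| = 1) /\
    (weight_form zeta (x, y, z) al = 0 ->
     (1 + zeta) * x%:~R = (b * y)%:~R + zeta * (c * z)%:~R).
  move: oal; rewrite /odd_root !inE !eqr_oppLR => oal.
  have [s [b [c [-> s1 b1 c1]]]] : exists s b c : int, [/\ al = (s, s * b, s * c),
      s ^+ 2 = 1, `|b| = 1 & `|c| = 1].
    by case/orP: oal => /or4P[] /eqP->; [exists 1, 1, 1 | exists 1, 1, (-1) | exists 1, (-1), 1 |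
      exists 1, (-1), (-1) | exists (-1), 1, 1 | exists (-1), 1, (-1) | exists (-1), (-1), 1 |
      exists (-1), (-1), (-1)].
  exists b, c; split=> //; rewrite /weight_form /= => /(congr1 (fun t => s%:~R * t)).
  have s1K : (s%:~R : K) ^+ 2 = 1 by rewrite -rmorphXn s1.
  rewrite mulr0 !rmorphM /= => E; apply/eqP; rewrite -subr_eq0 -oppr_eq0 -{}E; apply/eqP.
  by rewrite -[LHS]mul1r -[X in X * _]s1K; ring.
move=> /form E.
have d0 : d%:R != 0 :> K by rewrite pnatr_eq0 -lt0n.
have {}E : (d%:Z + p%:Z) * x = d%:Z * (b * y) + p%:Z * (c * z).
  apply/eqP; rewrite -(eqr_int K); apply/eqP.
  rewrite !rmorphM !rmorphD !rmorphM /= -!pmulrn.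
  have := congr1 (fun t => d%:R * t) E; rewrite !rmorphM /=.
  have -> : d%:R * ((1 + zeta) * x%:~R) = (d%:R + p%:R) * x%:~R by field.
  by move=> ->; field.
have pd : (p%:Z %| d%:Z * (b * y - x))%Z.
  by apply/dvdzP; exists (x - c * z); move: E; lia.
rewrite Gauss_dvdzr in pd; last by rewrite /coprimez /gcdz /= eqz_nat; move: p_d_coprime.
have [t tE] := dvdzP pd.
have by_ : b * y = x + t * p%:Z by rewrite -tE; ring.
have cz_ : c * z = x - t * d%:Z.
  have p0 : p%:Z != 0 by rewrite eqz_nat -lt0n.
  apply: (mulfI p0); move: E; rewrite by_ => E.
  have -> : p%:Z * (c * z) = (d%:Z + p%:Z) * x - d%:Z * (x + t * p%:Z) by rewrite E; ring.
  by ring.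
have ny : `|y| = `|x + t * p%:Z| by rewrite -by_ normrM nb mul1r.
have nz : `|z| = `|x - t * d%:Z| by rewrite -cz_ normrM nc mul1r.
exists `|t|%N; have [t0|t0] := lerP 0 t.
  have tt : (`|t|%N : int) = t by lia.
  have [a aE] := @signed_exists x x erefl.
  have [b' bE] := signed_exists ny; have [c' cE] := signed_exists nz.
  by exists x, a, b', c'; rewrite /f_weight !PoszM tt -aE -bE -cE.
have tt : (`|t|%N : int) = - t by lia.
have [a aE] := @signed_exists x (- x) (esym (normrN _)).
have ny' : `|y| = `|- x + - t * p%:Z| by rewrite ny -normrN; congr `|_|; ring.
have nz' : `|z| = `|- x - - t * d%:Z| by rewrite nz -normrN; congr `|_|; ring.
have [b' bE] := @signed_exists y (- x + - t * p%:Z) ny'.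
have [c' cE] := @signed_exists z (- x - - t * d%:Z) nz'.
by exists (- x), a, b', c'; rewrite /f_weight !PoszM tt -aE -bE -cE.
Qed.

End Families.

Local Open Scope complex_scope.

Theorem proposition4p2 (R : realType) (p d : nat)
    (p_gt0 : (0 < p)%N) (d_gt0 : (0 < d)%N) (p_d_coprime : coprime p d)
    (g : D21 (p%:R / d%:R : R[i])) :
  exists B : nat -> superModule g -> Prop,
    [/\ forall k, is_block (B k),
        forall k f, WT p d k f -> forall L, is_L f L -> B k L
      & forall B' : superModule g -> Prop, is_block B' -> atypical_block B' ->
          exists k, forall M, B' M <-> B k M].
Proof.
have zeta1 := zeta1_neq0 R[i] p d_gt0.
exists (fun k M => in_O M /\ forall S, irreducible S -> subquotient S M ->
  forall L, is_L (base p d k) L -> linked L S).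
split.
- move=> k; have [L0 HL0] := exists_L g zeta1 (base p d k).
  exists L0; first exact: (is_L_simple zeta1 HL0).
  move=> M; split=> -[MO H]; split=> // S Sirr Ssub.
    exact: H HL0.
  move=> L HL; apply: rst_trans (is_L_linked zeta1 HL HL0) _.
  exact: H.
- move=> k f fk L HL; split; first by case: (is_L_simple zeta1 HL).
  move=> S Sirr Ssub L0 HL0; have HS := is_L_subquotient zeta1 HL Sirr Ssub.
  exact: (WT_linked p_gt0 d_gt0 fk HL0 HS).
move=> B' [L LO BL] aB'.
have [l HL] := simple_in_O_is_L zeta1 LO.
have BLL : B' L.
  apply/BL; split; first by case: LO.
  by move=> S Sirr Ssub; apply: (is_L_linked zeta1 HL); apply: is_L_subquotient HL Sirr Ssub.
have [l' HL' al'] := aB' L BLL LO.2.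
have [k kl'] := atypical_WT p_gt0 d_gt0 p_d_coprime al'.
exists k => M; rewrite BL; split=> -[MO H]; split=> // S Sirr Ssub.
  move=> L0 HL0; apply: rst_trans (WT_linked p_gt0 d_gt0 kl' HL0 HL') _.
  exact: H.
have [L0 HL0] := exists_L g zeta1 (base p d k).
apply: rst_trans (rst_sym _ _ _ _ (WT_linked p_gt0 d_gt0 kl' HL0 HL')) _.
exact: H HL0.
Qed.
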